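(* Fix an integer $p\ge 2$, $\boldsymbol\theta\in\mathcal{S}^{p-1}$ and $f\in\mathcal{F}$. Let $(\kappa_n)$ be a positive real sequence that diverges to infinity. Then, under ${\rm P}^{(n)}_{\boldsymbol\theta,\kappa_n,f}$, $$\frac{\sqrt{n(p-1)}(\hat{\boldsymbol\theta}_n-\boldsymbol\theta)}{\sqrt{1-\hat e_{n2}}}\stackrel{\mathcal{D}}{\to}\mathcal{N}\big(\mathbf{0},\mathbf{I}_p-\boldsymbol\theta\boldsymbol\theta'\big)$$ as $n\to\infty$, and, still under ${\rm P}^{(n)}_{\boldsymbol\theta,\kappa_n,f}$, $$\frac{n(p-1)\big(1-(\boldsymbol\theta'\hat{\boldsymbol\theta}_n)^2\big)}{1-\hat e_{n2}}\stackrel{\mathcal{D}}{\to}\chi^2_{p-1}\quad\text{and}\quad\frac{2n(p-1)(1-\boldsymbol\theta'\hat{\boldsymbol\theta}_n)}{1-\hat e_{n2}}\stackrel{\mathcal{D}}{\to}\chi^2_{p-1}$$ as $n\to\infty$, where, in all cases, $\hat e_{n2}=\frac1n\sum_{i=1}^n(\mathbf{X}_{ni}'\hat{\boldsymbol\theta}_n)^2$.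
   Context: $\mathcal{S}^{p-1}$ is the unit sphere of $\mathbb{R}^p$, a prime denotes transposition, and $\stackrel{\mathcal{D}}{\to}$ denotes convergence in distribution. For a function $f$, $\varphi_f:=f'/f$ wherever $f$ is differentiable. The class $\mathcal{F}$ is the collection of functions $f:\mathbb{R}\to\mathbb{R}^+$ that (i) are monotone non-decreasing on $(-\infty,0]$ and monotone increasing on $[0,\infty)$; (ii) are differentiable in a neighborhood of $\infty$ (i.e., over $(M,\infty)$ for some $M$); (iii) are such that $\kappa\varphi_f(\kappa)$ diverges to infinity as $\kappa\to\infty$ and $\kappa\mapsto\kappa\varphi_f(\kappa)$ is monotone non-decreasing over $(M,\infty)$ for some $M$; and (iv) satisfy, for any $\xi,\zeta>-1$, $$\int_{-1}^1(1-s)^\xi(1+s)^\zeta\,\big|e^{\log f(\kappa s)-\log f(\kappa)}-e^{(s-1)\kappa\varphi_f(\kappa)}\big|\,ds=o\bigg(\frac{1}{(\kappa\varphi_f(\kappa))^{\xi+1}}\bigg)\quad\text{as }\kappa\to\infty.$$ ${\rm P}^{(n)}_{\boldsymbol\theta,\kappa_n,f}$ is the hypothesis under which $\mathbf{X}_{n1},\ldots,\mathbf{X}_{nn}$ are mutually independent random vectors on $\mathcal{S}^{p-1}$ with common density, with respect to the surface area measure, $\mathbf{x}\mapsto\frac{c_{p,\kappa_n,f}\Gamma((p-1)/2)}{2\pi^{(p-1)/2}}f(\kappa_n\mathbf{x}'\boldsymbol\theta)$, where $c_{p,\kappa,f}:=1\big/\int_{-1}^1(1-s^2)^{(p-3)/2}f(\kappa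 s)\,ds$. The spherical mean is $\hat{\boldsymbol\theta}_n:=\bar{\mathbf{X}}_n/\|\bar{\mathbf{X}}_n\|$, with $\bar{\mathbf{X}}_n:=\frac1n\sum_{i=1}^n\mathbf{X}_{ni}$ (well defined almost surely). *)

(* Defs.v *)
From HB Require Import structures.
From mathcomp Require Import all_boot all_order all_algebra.
From mathcomp Require Import all_classical all_reals all_analysis.
Set Implicit Arguments.
Unset Strict Implicit.
Unset Printing Implicit Defensive.
Import Order.TTheory GRing.Theory Num.Theory.
Import numFieldNormedType.Exports.
Local Open Scope classical_set_scope.
Local Open Scope ring_scope.

Definition dot (R : realType) (p : nat) (x y : 'cV[R]_p) : R :=
  (x^T *m y) 0 0.

(* The library norm on matrices is the sup norm. *)
Definition enorm (R : realType) (p : nat) (x : 'cV[R]_p) : R :=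
  Num.sqrt (dot x x).

Definition sphere (R : realType) (p : nat) : set 'cV[R]_p :=
  [set x | enorm x = 1].

Definition borel (E : ptopologicalType) := g_sigma_algebraType (@open E).

(* p-fold product of a measure on R, by iterated integration. *)
Fixpoint power_measure (R : realType) (mu : set R -> \bar R) (p : nat) :
    set 'cV[R]_p -> \bar R :=
  match p return set 'cV[R]_p -> \bar R with
  | 0 => fun A => (\1_A (0 : 'cV[R]_0))%:E
  | q.+1 => fun A => (\int[mu]_t
      power_measure mu [set v : 'cV[R]_q | A (col_mx (t%:M : 'cV[R]_1) v)])%E
  end.

(* Surface area of A as p times the volume of the cone over A in the unit
   ball (Lebesgue measure in polar coordinates). *)
Definition surface_measure (R : realType) (p : nat) :
    set (borel 'cV[R]_p) -> \bar R :=
  fun A => (p%:R%:E * power_measure (@lebesgue_measure R)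
    [set x : 'cV[R]_p |
      [/\ x != 0, enorm x <= 1 & A ((enorm x)^-1 *: x)]]%R)%E.

Definition std_normal (R : realType) (p : nat) : set 'cV[R]_p -> \bar R :=
  @power_measure R (normal_prob 0 1) p.

(* N(m, Sigma) is the law of m + A Z, for Z standard normal and A any square
   matrix with A A' = Sigma; the law does not depend on the choice of A.
   Junk value if Sigma is not positive semidefinite. *)
Definition mvnormal (R : realType) (p : nat) (m : 'cV[R]_p) (Sigma : 'M[R]_p) :
    set (borel 'cV[R]_p) -> \bar R :=
  fun B => std_normal [set z : 'cV[R]_p |
    B (m + xget 0 [set A : 'M[R]_p | A *m A^T = Sigma] *m z)].

(* Law of the sum of the squares of k independent standard normals. *)
Definition chi2 (R : realType) (k : nat) : set (borel R) -> \bar R :=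
  fun B => std_normal [set z : 'cV[R]_k | B (dot z z)].

(* The nth variable may live on its own probability space; the limit is given
   by its law mu. *)
Definition cvg_in_law (R : realType) (E : ptopologicalType)
    (d : nat -> measure_display) (T : forall n, measurableType (d n))
    (P : forall n, probability (T n) R) (Y : forall n, T n -> E)
    (mu : set (borel E) -> \bar R) : Prop :=
  forall g : E -> R, continuous g -> bounded_fun g ->
    (\int[P n]_w (g (Y n w))%:E)%E @[n --> \oo]
      --> (\int[mu]_x (g x)%:E)%E.

Definition phi (R : realType) (f : R -> R) (x : R) : R := derive1 f x / f x.

(* R^+ is read as [0, +oo[, whence the extended logarithm and exponential:
   log 0 = -oo and e^(-oo) = 0. The little-o of the last condition is spelled
   out; the integral there is nonnegative. *)
Definition class_F (R : realType) (f : R -> R) : Prop :=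
  [/\ (forall x, 0 <= f x),
      {in `]-oo, 0] &, {homo f : x y / x <= y}} /\
        {in `[0, +oo[ &, {homo f : x y / x < y}},
      exists M : R, forall x, M < x -> derivable f x 1,
      (k * phi f k @[k --> +oo] --> +oo) /\
        exists M : R, {in `]M, +oo[ &, {homo (fun k => k * phi f k) :
          x y / x <= y}}
    & forall xi zeta : R, -1 < xi -> -1 < zeta ->
      forall eps : R, 0 < eps -> \forall k \near +oo,
        (\int[lebesgue_measure]_(s in `[(-1)%R, 1%R])
           (((1 - s) `^ xi * (1 + s) `^ zeta)%:E *
            `| expeR (lne (f (k * s))%:E - lne (f k)%:E) -
               (expR ((s - 1) * (k * phi f k)))%:E |)
         <= (eps * (1 / (k * phi f k) `^ (xi + 1)))%:E)%E].

Definition Gamma (R : realType) (x : R) : R :=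
  \int[lebesgue_measure]_(t in `]0, +oo[) (t `^ (x - 1) * expR (- t)).

Definition norm_cst (R : realType) (p : nat) (kappa : R) (f : R -> R) : R :=
  (\int[lebesgue_measure]_(s in `[-1, 1])
     ((1 - s ^+ 2) `^ ((p%:R - 3) / 2) * f (kappa * s)))^-1.

Definition rot_sym_density (R : realType) (p : nat) (theta : 'cV[R]_p)
    (kappa : R) (f : R -> R) (x : 'cV[R]_p) : R :=
  norm_cst p kappa f * Gamma ((p%:R - 1) / 2) / (2 * pi `^ ((p%:R - 1) / 2))
  * f (kappa * dot x theta).

Definition rot_sym_sample (R : realType) (p : nat) (theta : 'cV[R]_p)
    (kappa : R) (f : R -> R) (n : nat) (d : measure_display)
    (T : measurableType d) (P : probability T R)
    (X : 'I_n -> T -> 'cV[R]_p) : Prop :=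
  [/\ (forall i, measurable_fun setT (X i : T -> borel 'cV[R]_p)),
      (forall i w, X i w \in @sphere R p),
      (forall B : 'I_n -> set (borel 'cV[R]_p), (forall i, measurable (B i)) ->
         P (\bigcap_(i : 'I_n) (X i @^-1` B i)) =
         (\prod_(i < n) P (X i @^-1` B i))%E)
    & (forall i (B : set (borel 'cV[R]_p)), measurable B ->
         P (X i @^-1` B) = (\int[@surface_measure R p]_(x in B)
           (rot_sym_density theta kappa f x)%:E)%E)].

Definition sample_mean (R : realType) (p n : nat) (x : 'I_n -> 'cV[R]_p) :
    'cV[R]_p :=
  n%:R^-1 *: \sum_(i < n) x i.

Definition spherical_mean (R : realType) (p n : nat) (x : 'I_n -> 'cV[R]_p) :
    'cV[R]_p :=
  (enorm (sample_mean x))^-1 *: sample_mean x.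

Definition e_hat2 (R : realType) (p n : nat) (x : 'I_n -> 'cV[R]_p) : R :=
  n%:R^-1 * \sum_(i < n) dot (x i) (spherical_mean x) ^+ 2.

(* Main.v *)
Require Import Defs.
From HB Require Import structures.
From mathcomp Require Import all_boot all_order all_algebra.
From mathcomp Require Import all_classical all_reals all_analysis.
From mathcomp Require Import measurable_realfun.
From mathcomp Require Import ring lra.
Set Implicit Arguments.
Unset Strict Implicit.
Unset Printing Implicit Defensive.
Import Order.TTheory GRing.Theory Num.Theory.
Import numFieldNormedType.Exports.
Local Open Scope classical_set_scope.
Local Open Scope ring_scope.

(* Idea. Write X = u theta + Q xi, with u = X'theta and Q an orthonormal basis of
   the complement of theta, so that |xi|^2 = 1 - u^2. By rotational symmetry xi
   has covariance (b/q) I, where q = p - 1 and b = E (1 - u^2), and the law of u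
   has density proportional to (1 - s^2)^((p - 3)/2) f(kappa s). Condition (iv)
   compares its moments with those of the exponential weight
   e^((s - 1) kappa phi_f(kappa)); Laplace's method then gives, with
   a = kappa phi_f(kappa) tending to infinity,
     E (1 - u) = O(b), E (1 - u^2)^2 = O(b^2), b = O(1/a).
   Hence 1/n sum (1 - u_i^2) = b (1 + o(1)) in probability (Chebyshev) and the
   characteristic function of sqrt (q/(n b)) sum xi_i tends to that of a standard
   Gaussian vector. Since 1 - e_n2 = b (1 + o(1)) and the spherical mean is
   theta + Q (1/n sum xi_i) (1 + o(1)), the studentized vector tends to Q Z, and
   the two other statistics are its squared norm and the squared norm of its part
   orthogonal to theta. *)

(** * Borel sets and iterated product measures *)

(** The sample size n and kappa_n grow at unrelated speeds, so no estimate may trade one against the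
    other. This works because errors are measured relative to b: a fourth moment of order b^2 makes
    the Lyapunov ratio O(1/n) whatever kappa_n is. For the same reason moments are needed only up to
    constant factors, with unrelated constants above and below: b is never replaced by an
    equivalent, it is the normalization itself, and the statistic estimates it. The growth of
    kappa_n enters only through b = O(1/a), which makes b at most 1 and the mean of 1 - u small.
    Since the probability space changes with n, limits are taken on expectations: closeness of two
    vectors outside events of small probability is turned into closeness of expectations of bounded
    Lipschitz functions, and continuous test functions are reached at the end through Lipschitz
    minorants. Characteristic functions are kept real, as pairs of a cosine and a sine; the sine
    parts of the sums and of the limit vanish by symmetry. *)

Lemma continuous_borel_measurable (E F : ptopologicalType) (g : E -> F) :
  continuous g -> measurable_fun setT (g : borel E -> borel F).
Proof.
move=> cg; refine (@measurability _ _ (borel E) (borel F) setT g (@open F) _ _) => //.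
move=> _ [U oU <-]; rewrite setTI; apply: sub_sigma_algebra.
by move/continuousP : cg; apply.
Qed.

Lemma measurable_borelR (R : realType) d (T : measurableType d) (f : T -> R) :
  measurable_fun setT (f : T -> borel R) <-> measurable_fun setT f.
Proof.
split=> mf.
  apply: (@measurability _ _ _ _ _ _ _ (RGenOpens.measurableE R)).
  move=> _ [_ [x [y ->]] <-]; apply: mf => //.
  by apply: sub_sigma_algebra; exact: interval_open.
refine (@measurability _ _ T (borel R) setT f (@open R) _ _) => //.
move=> _ [U oU <-]; apply: mf => //.
exact: open_measurable.
Qed.

Lemma continuous_borel_measurableR (R : realType) (E : ptopologicalType)
  (g : E -> R) : continuous g -> measurable_fun setT (g : borel E -> R).
Proof.
by move=> cg; apply/measurable_borelR; exact: continuous_borel_measurable.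
Qed.

Section borel_vectors.
Context {R : realType}.

Lemma measurable_coord p i j :
  measurable_fun setT (fun x : borel 'cV[R]_p => (x : 'cV[R]_p) i j).
Proof. by apply: continuous_borel_measurableR; exact: coord_continuous. Qed.

(** Countability is the point: boxes are indexed by rational centres and radii 1/(k + 1). Those that
    stick out of [U] are replaced by the empty set, so that the index remains a plain countable
    type. *)
Lemma open_bigcup_box p (U : set 'cV[R]_p) : open U ->
  U = \bigcup_(ck : 'cV[rat]_p * nat)
    (if `[< forall x : 'cV[R]_p,
             (forall i, `|x i 0 - ratr (ck.1 i 0)| < ck.2.+1%:R^-1) -> U x >]
     then [set x : 'cV[R]_p |
             forall i, `|x i 0 - ratr (ck.1 i 0)| < ck.2.+1%:R^-1]
     else set0).
Proof.
move=> oU; apply/seteqP; split => [x Ux|x [[c k] _]] /=; last first.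
  by case: ifPn => // /asboolP; apply.
have /nbhs_ballP[e /= e0 eU] : nbhs x U by exact: open_nbhs_nbhs.
(* Half of [e], because a point of the box is compared with [x] through the centre. *)
have [k ke] : exists k : nat, k.+1%:R^-1 < e / 2.
  have e20 : 0 < e / 2 by rewrite divr_gt0.
  have [k _ /(_ k (leqnn k))/= ke] := near_infty_natSinv_lt (PosNum e20).
  by exists k.
have [c xc] : exists c : 'cV[rat]_p, forall i, `|x i 0 - ratr (c i 0)| < k.+1%:R^-1.
  have xr i : exists r : rat, `|x i 0 - ratr r| < k.+1%:R^-1.
    have : x i 0 - k.+1%:R^-1 < x i 0 + k.+1%:R^-1.
      by rewrite ltrBlDr -addrA ltrDl addr_gt0// invr_gt0.
    move=> /rat_in_itvoo[r]; rewrite in_itv/= => /andP[h1 h2]; exists r.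
    by rewrite distrC ltr_distl h1 h2.
  have /choice[r rx] := xr.
  by exists (\col_i r i) => i; rewrite mxE.
exists (c, k) => //=; case: ifPn => [_ //|/asboolP bad]; exfalso; apply: bad => y yc.
apply: eU; split => // i j; rewrite (ord1 j)/= /ball/=.
rewrite (_ : x i 0 - y i 0 = (x i 0 - ratr (c i 0)) - (y i 0 - ratr (c i 0))); last by ring.
rewrite (le_lt_trans (ler_normB _ _))// (splitr e) ltrD//.
  exact: lt_trans (xc i) ke.
exact: lt_trans (yc i) ke.
Qed.

(** The preimage of a box is a finite intersection of conditions on coordinates, and open sets are
    countable unions of boxes. Measurability of vector-valued maps is reduced to coordinates in this
    way throughout. *)
Lemma measurable_cVP d (T : measurableType d) p (f : T -> 'cV[R]_p) :
  (forall i, measurable_fun setT (fun w => f w i 0)) ->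
  measurable_fun setT (f : T -> borel 'cV[R]_p).
Proof.
move=> mf; refine (@measurability _ _ T (borel 'cV[R]_p) setT f (@open 'cV[R]_p) _ _) => //.
move=> _ [U oU <-]; rewrite setTI.
rewrite (open_bigcup_box oU) preimage_bigcup.
apply: countable_bigcupT_measurable => [|[c k]/=].
  exact: countableP.
case: ifPn => _; last by rewrite preimage_set0.
rewrite (_ : _ @^-1` _ = \bigcap_(i in [set: 'I_p])
    [set w | `|f w i 0 - ratr (c i 0)| < k.+1%:R^-1]); last first.
  by apply/seteqP; split => [w h i _|w h i]; exact: h.
apply: fin_bigcap_measurable => // i _.
rewrite -[X in measurable X]setTI.
apply: (@measurable_fun_ltr _ T R setT (fun w => `|f w i 0 - ratr (c i 0)|)
  (cst k.+1%:R^-1)) => //.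
by apply: measurableT_comp => //; apply: measurable_funB.
Qed.

Lemma measurable_col_mx p :
  measurable_fun setT (fun tv : measurableTypeR R * borel 'cV[R]_p =>
    col_mx (tv.1%:M : 'cV[R]_1) (tv.2 : 'cV[R]_p) : borel 'cV[R]_p.+1).
Proof.
apply: (@measurable_cVP _ _ p.+1
  (fun tv : measurableTypeR R * borel 'cV[R]_p => col_mx (tv.1%:M : 'cV[R]_1) tv.2)) => i.
case: (@splitP 1 p i) => j ij.
  rewrite (_ : (fun _ => _) = fst); first exact: measurable_fst.
  apply/funext => tv; rewrite mxE; case: splitP => k ik.
    by rewrite mxE (ord1 k).
  by move: (ltn_ord j); rewrite -ij ik.
rewrite (_ : (fun _ => _) = (fun x : borel 'cV[R]_p => (x : 'cV[R]_p) j 0) \o snd).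
  by apply: measurableT_comp; [exact: measurable_coord|exact: measurable_snd].
apply/funext => tv /=; rewrite mxE; case: splitP => k ik.
  by move: (ltn_ord k); rewrite -ik ij.
by congr (tv.2 _ _); apply: val_inj; move: ik; rewrite /= ij => /addnI.
Qed.

End borel_vectors.

Definition pushforward_measure d d' (T1 : measurableType d)
  (T2 : measurableType d') (R : realType) (m : {measure set T1 -> \bar R})
  (f : T1 -> T2) (mf : measurable_fun setT f) : {measure set T2 -> \bar R} :=
  measure_function_pushforward__canonical__measure_function_Measure m mf.

Lemma ge0_integral_pushforwardT d d' (T1 : measurableType d)
  (T2 : measurableType d') (R : realType) (m : {measure set T1 -> \bar R})
  (f : T1 -> T2) (mf : measurable_fun setT f) (F : T2 -> \bar R) :
  measurable_fun setT F -> (forall y, 0 <= F y)%E ->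
  (\int[pushforward_measure m mf]_y F y = \int[m]_x F (f x))%E.
Proof.
by move=> mF F0; rewrite ge0_integral_pushforward// preimage_setT.
Qed.

Lemma ge0_integralZlT d (T : measurableType d) (R : realType)
  (m : {measure set T -> \bar R}) (F : T -> \bar R) (k : R) :
  measurable_fun setT F -> (forall x, 0 <= F x)%E -> 0 <= k ->
  (\int[m]_x (k%:E * F x) = k%:E * \int[m]_x F x)%E.
Proof. by move=> mF F0 k0; rewrite ge0_integralZl. Qed.

Section cons_measure.
Context {R : realType} (p : nat).
Variables (mu : {sigma_finite_measure set (measurableTypeR R) -> \bar R})
  (nu : {sigma_finite_measure set (borel 'cV[R]_p) -> \bar R}).

(** One step of the recursion of [power_measure], recast as the image of a product measure:
    [power_measure] is a bare set function, whereas this is a sigma-finite measure to which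
    Fubini-Tonelli applies. *)
Definition cons_measure : set (borel 'cV[R]_p.+1) -> \bar R :=
  pushforward_measure (mu \x nu)%E (@measurable_col_mx R p).

HB.instance Definition _ := isMeasure.Build _ _ _ cons_measure
  (measure0 _) (measure_ge0 _) (@measure_semi_sigma_additive _ _ _ _).

Let uncons (x : borel 'cV[R]_p.+1) : measurableTypeR R * borel 'cV[R]_p :=
  ((x : 'cV[R]_p.+1) 0 0, dsubmx (x : 'cV[R]_(1 + p))).

Let measurable_uncons : measurable_fun setT uncons.
Proof.
apply: measurable_fun_pair; first exact: measurable_coord.
apply: (@measurable_cVP R _ (borel 'cV[R]_p.+1) p (fun x => dsubmx (x : 'cV[R]_(1 + p)))) => i.
rewrite (_ : (fun _ => _) =
    (fun x : borel 'cV[R]_p.+1 => (x : 'cV[R]_p.+1) (rshift 1 i) 0)).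
  exact: measurable_coord.
by apply/funext => x; rewrite mxE.
Qed.

Let uncons_cons t v : uncons (col_mx (t%:M : 'cV[R]_1) (v : 'cV[R]_p)) = (t, v).
Proof.
congr (_, _); last by rewrite col_mxKd.
rewrite mxE; case: splitP => [j _|k /=]; last by rewrite add1n.
by rewrite (ord1 j) mxE.
Qed.

Let cons_measure_sigma_finite : sigma_finite setT cons_measure.
Proof.
have /sigma_finiteP[F [TF ndF Foo]] := sigma_finiteT mu.
have /sigma_finiteP[G [TG ndG Goo]] := sigma_finiteT nu.
exists (fun n => uncons @^-1` (F n `*` G n)).
  apply/seteqP; split => // x _.
  have [m _ Fm] : (\bigcup_i F i) (uncons x).1 by rewrite -TF.
  have [n _ Gn] : (\bigcup_i G i) (uncons x).2 by rewrite -TG.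
  exists (maxn m n) => //; split => /=.
    by move: Fm; exact/subsetPset/ndF/leq_maxl.
  by move: Gn; exact/subsetPset/ndG/leq_maxr.
move=> n; have [mF Fn] := Foo n; have [mG Gn] := Goo n; split.
  rewrite -[X in measurable X]setTI; apply: measurable_uncons => //.
  exact: measurableX.
rewrite /cons_measure /= /pushforward -comp_preimage.
rewrite (_ : uncons \o _ = id) ?preimage_id; last first.
  by apply/funext => -[t v]/=; rewrite uncons_cons.
by rewrite product_measure1E// lte_mul_pinfty// ge0_fin_numE.
Qed.

HB.instance Definition _ := Measure_isSigmaFinite.Build _ _ _ cons_measure
  cons_measure_sigma_finite.

End cons_measure.

Section product_power.
Context {R : realType} (mu : {sigma_finite_measure set (measurableTypeR R) -> \bar R}).

Fixpoint mpower p : {sigma_finite_measure set (borel 'cV[R]_p) -> \bar R} :=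
  match p with
  | 0 => @dirac _ (borel 'cV[R]_0) (0 : 'cV[R]_0) R
  | q.+1 => cons_measure mu (mpower q)
  end.

(** The integral in [power_measure] is over [R], the one in the product measure over
    [measurableTypeR R]. The identity is measurable between the two, so one integral is the
    push-forward of the other. *)
Lemma integral_measurableTypeR (F : R -> \bar R) :
  measurable_fun setT F -> (forall t, 0 <= F t)%E ->
  (@integral _ R R mu setT F = \int[mu]_t F t)%E.
Proof.
move=> mF F0.
have mid : @measurable_fun _ _ (measurableTypeR R) R setT idfun.
  by move=> _ A mA; rewrite setTI.
exact: (ge0_integral_pushforwardT mu mid).
Qed.

Lemma measurable_xsection_col_mx p (A : set (borel 'cV[R]_p.+1)) (t : R) :
  measurable A -> measurable [set v : borel 'cV[R]_p |
    A (col_mx (t%:M : 'cV[R]_1) (v : 'cV[R]_p))].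
Proof.
move=> mA.
have := @measurable_fun_pair2 _ _ _ _ _ _ _ t (@measurable_col_mx R p).
by move=> /(_ measurableT _ mA); rewrite setTI.
Qed.

Lemma power_measureE p (A : set (borel 'cV[R]_p)) : measurable A ->
  power_measure mu A = mpower p A.
Proof.
elim: p A => [//|p IHp] A mA.
pose B : set (measurableTypeR R * borel 'cV[R]_p) :=
  [set tv | A (col_mx (tv.1%:M : 'cV[R]_1) (tv.2 : 'cV[R]_p))].
have mB : measurable B.
  by have := @measurable_col_mx R p measurableT _ mA; rewrite setTI.
have -> : power_measure mu A =
    @integral _ R R mu setT (fun t : R => mpower p (xsection B t)).
  congr (@integral _ R R mu setT _); apply/funext => t.
  rewrite [LHS]IHp; last exact: measurable_xsection_col_mx.
  by congr (mpower p _); apply/seteqP; split => v /=; rewrite /xsection/= inE.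
rewrite integral_measurableTypeR//.
exact: (measurable_fun_xsection _ mB).
Qed.

Lemma ge0_integral_mpowerS p (F : borel 'cV[R]_p.+1 -> \bar R) :
  measurable_fun setT F -> (forall x, 0 <= F x)%E ->
  (\int[mpower p.+1]_x F x =
   \int[mu]_t \int[mpower p]_v F (col_mx (t%:M : 'cV[R]_1) (v : 'cV[R]_p)))%E.
Proof.
move=> mF F0.
rewrite (ge0_integral_pushforwardT (mu \x mpower p)%E (@measurable_col_mx R p))//.
rewrite fubini_tonelli1//.
exact: (measurableT_comp mF (@measurable_col_mx R p)).
Qed.

Lemma measurable_integral_col_mx p (F : borel 'cV[R]_p.+1 -> \bar R) :
  measurable_fun setT F -> (forall x, 0 <= F x)%E ->
  measurable_fun setT (fun t : measurableTypeR R =>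
    \int[mpower p]_v F (col_mx (t%:M : 'cV[R]_1) (v : 'cV[R]_p)))%E.
Proof.
move=> mF F0.
apply: (measurable_fun_fubini_tonelli_F (fun tv : measurableTypeR R * borel 'cV[R]_p =>
  F (col_mx (tv.1%:M : 'cV[R]_1) (tv.2 : 'cV[R]_p)))) => //.
exact: (measurableT_comp mF (@measurable_col_mx R p)).
Qed.

Lemma ge0_integral_mpower0 (F : borel 'cV[R]_0 -> \bar R) :
  measurable_fun setT F -> (\int[mpower 0]_x F x = F (0%R : 'cV[R]_0))%E.
Proof. by move=> mF; rewrite integral_dirac// diracT mul1e. Qed.

End product_power.

Section lebesgue_invariance.
Context {R : realType}.
Local Notation mu := (@lebesgue_measure R).

(** The device behind every change of variable on the line: an image measure is recognized as
    Lebesgue measure by its values on half-open intervals. *)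
Lemma lebesgue_measure_unique (nu : {measure set (measurableTypeR R) -> \bar R}) :
  (forall a b : R, a < b -> nu `]a, b]%classic = (b - a)%:E) ->
  forall A, measurable A -> mu A = nu A.
Proof.
move=> nuE; apply: lebesgue_stieltjes_measure_unique => _ [[a b] _ <-] /=.
have [ab|ba] := ltP a b.
  rewrite nuE//; transitivity (mu `]a, b]%classic) => //.
  by rewrite lebesgue_measure_itv/= lte_fin ab.
by rewrite set_itv_ge ?measure0// bnd_simp -leNgt.
Qed.

Lemma ge0_integral_lebesgue_shift (F : measurableTypeR R -> \bar R) (a : R) :
  measurable_fun setT F -> (forall t, 0 <= F t)%E ->
  (\int[mu]_t F (t + a)%R = \int[mu]_t F t)%E.
Proof.
move=> mF F0.
have ms : @measurable_fun _ _ (measurableTypeR R) (measurableTypeR R) setT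
    (fun t : R => t + a) by exact: measurable_funD.
rewrite -(ge0_integral_pushforwardT mu ms)//.
apply/esym/eq_measure_integral => A mA _.
apply: lebesgue_measure_unique => // x y xy.
rewrite /= /pushforward (_ : _ @^-1` _ = `]x - a, y - a]%classic).
  by rewrite lebesgue_measure_itv/= lte_fin ltrD2r xy -EFinB; congr EFin; ring.
by apply/seteqP; split => t /=; rewrite !in_itv/= ltrBlDr lerBrDr.
Qed.

Lemma ge0_integral_lebesgue_opp (F : measurableTypeR R -> \bar R) :
  measurable_fun setT F -> (forall t, 0 <= F t)%E ->
  (\int[mu]_t F (- t)%R = \int[mu]_t F t)%E.
Proof.
move=> mF F0.
have ms : @measurable_fun _ _ (measurableTypeR R) (measurableTypeR R) setT
    (fun t : R => - t) by exact: measurable_funN.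
rewrite -(ge0_integral_pushforwardT mu ms)//.
apply/esym/eq_measure_integral => A mA _.
apply: lebesgue_measure_unique => // x y xy.
rewrite /= /pushforward (_ : _ @^-1` _ = `[- y, - x[%classic).
  by rewrite lebesgue_measure_itv/= lte_fin ltrN2 xy -EFinB; congr EFin; ring.
by apply/seteqP; split => t /=; rewrite !in_itv/= andbC ltrNr lerNl.
Qed.

Lemma ge0_integral_lebesgue_scale (F : measurableTypeR R -> \bar R) (r : R) : 0 < r ->
  measurable_fun setT F -> (forall t, 0 <= F t)%E ->
  (\int[mu]_t F (r * t)%R = r^-1%:E * \int[mu]_t F t)%E.
Proof.
move=> r0 mF F0.
have ms : @measurable_fun _ _ (measurableTypeR R) (measurableTypeR R) setT
    (fun t : R => r * t) by exact: measurable_funM.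
rewrite -(ge0_integral_pushforwardT mu ms)//.
have rV0 : 0 <= r by exact: ltW.
pose nu := mscale (NngNum rV0) (pushforward_measure mu ms).
have -> : (\int[mu]_t F t = \int[nu]_t F t)%E.
  apply: eq_measure_integral => A mA _.
  apply: lebesgue_measure_unique => // x y xy.
  rewrite /= /mscale/= /pushforward (_ : _ @^-1` _ = `]x / r, y / r]%classic).
    rewrite lebesgue_measure_itv/= lte_fin ltr_pM2r ?invr_gt0// xy -EFinB -EFinM.
    by congr EFin; field; rewrite gt_eqF.
  by apply/seteqP; split => t /=;
    rewrite !in_itv/= ltr_pdivrMr// ler_pdivlMr// mulrC.
rewrite ge0_integral_mscale//= muleA -EFinM mulVf ?gt_eqF// mul1e.
by [].
Qed.

End lebesgue_invariance.

(** * Euclidean geometry and Lebesgue measure on column vectors *)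

Section measurable_vector_ops.
Context {R : realType} d (T : measurableType d) (p : nat).
Implicit Types (f g : T -> 'cV[R]_p).
Local Notation mV f := (measurable_fun setT (f : T -> borel 'cV[R]_p)).

Lemma measurable_cV_coord f i : mV f -> measurable_fun setT (fun w => f w i 0).
Proof. by move=> mf; apply: (measurableT_comp (measurable_coord i 0) mf). Qed.

Lemma measurable_cVD f g : mV f -> mV g -> mV (fun w => f w + g w).
Proof.
move=> mf mg; apply: measurable_cVP => i.
under eq_fun do rewrite mxE.
by apply: measurable_funD; exact: measurable_cV_coord.
Qed.

Lemma measurable_cVZ (h : T -> R) f : measurable_fun setT h -> mV f ->
  mV (fun w => h w *: f w).
Proof.
move=> mh mf; apply: measurable_cVP => i.
under eq_fun do rewrite mxE.
by apply: measurable_funM => //; exact: measurable_cV_coord.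
Qed.

Lemma measurable_cV_mulmx q (A : 'M[R]_(q, p)) f : mV f ->
  measurable_fun setT ((fun w => A *m f w) : T -> borel 'cV[R]_q).
Proof.
move=> mf; apply: measurable_cVP => i.
under eq_fun do rewrite mxE.
apply: measurable_sum => j.
by apply: measurable_funM => //; exact: measurable_cV_coord.
Qed.

Lemma measurable_cV_sum n (F : 'I_n -> T -> 'cV[R]_p) : (forall i, mV (F i)) ->
  mV (fun w => \sum_(i < n) F i w).
Proof.
move=> mF; apply: measurable_cVP => i.
under eq_fun do rewrite summxE.
by apply: measurable_sum => j; exact: measurable_cV_coord.
Qed.

Lemma measurable_dot f g : mV f -> mV g ->
  measurable_fun setT (fun w => dot (f w) (g w)).
Proof.
move=> mf mg; rewrite /dot; under eq_fun do rewrite mxE.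
apply: measurable_sum => j; under eq_fun do rewrite mxE.
by apply: measurable_funM; exact: measurable_cV_coord.
Qed.

Lemma measurable_enorm f : mV f -> measurable_fun setT (fun w => enorm (f w)).
Proof.
move=> mf; rewrite /enorm; apply: measurableT_comp; last exact: measurable_dot.
by apply: continuous_measurable_fun; exact: sqrt_continuous.
Qed.

Lemma measurable_fun_inv (g : T -> R) : measurable_fun setT g ->
  measurable_fun setT (fun w => (g w)^-1).
Proof.
move=> mg; rewrite (_ : (fun _ => _) = (fun w => g w * (`|g w| `^ (-1)) ^+ 2)).
  apply: measurable_funM => //; apply: measurable_funX.
  apply: (@measurableT_comp _ _ _ _ _ _ (fun x : R => x `^ (-1)) _ (fun w => `|g w|)).
    exact: measurable_powR.
  exact: measurableT_comp.
apply/funext => w; rewrite powR_inv1// exprVn -normrX ger0_norm ?sqr_ge0// expr2 invfM.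
by have [->|g0] := eqVneq (g w) 0; [rewrite mul0r invr0|rewrite mulVKf].
Qed.

Lemma measurable_enormV f : mV f ->
  measurable_fun setT (fun w => (enorm (f w))^-1).
Proof. by move=> mf; apply: measurable_fun_inv; exact: measurable_enorm. Qed.

End measurable_vector_ops.

Section dot_theory.
Context {R : realType} {p : nat}.
Implicit Types x y z : 'cV[R]_p.

Lemma dotE x y : dot x y = \sum_i x i 0 * y i 0.
Proof. by rewrite /dot mxE; apply: eq_bigr => i _; rewrite mxE. Qed.

Lemma dotC x y : dot x y = dot y x.
Proof. by rewrite !dotE; apply: eq_bigr => i _; rewrite mulrC. Qed.

Lemma dotDl x y z : dot (x + y) z = dot x z + dot y z.
Proof. by rewrite !dotE -big_split; apply: eq_bigr => i _; rewrite mxE mulrDl. Qed.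

Lemma dotZl a x y : dot (a *: x) y = a * dot x y.
Proof. by rewrite !dotE mulr_sumr; apply: eq_bigr => i _; rewrite mxE mulrA. Qed.

Lemma dotDr x y z : dot z (x + y) = dot z x + dot z y.
Proof. by rewrite dotC dotDl !(dotC z). Qed.

Lemma dotZr a x y : dot x (a *: y) = a * dot x y.
Proof. by rewrite dotC dotZl dotC. Qed.

Lemma dotNl x y : dot (- x) y = - dot x y.
Proof. by rewrite -scaleN1r dotZl mulN1r. Qed.

Lemma dotNr x y : dot x (- y) = - dot x y.
Proof. by rewrite dotC dotNl dotC. Qed.

Lemma dotBl x y z : dot (x - y) z = dot x z - dot y z.
Proof. by rewrite dotDl dotNl. Qed.

Lemma dotBr x y z : dot z (x - y) = dot z x - dot z y.
Proof. by rewrite dotDr dotNr. Qed.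

Lemma dot0l x : dot 0 x = 0.
Proof. by rewrite -(scale0r x) dotZl mul0r. Qed.

Lemma dot0r x : dot x 0 = 0.
Proof. by rewrite dotC dot0l. Qed.

Lemma dot_suml n (F : 'I_n -> 'cV[R]_p) x :
  dot (\sum_i F i) x = \sum_i dot (F i) x.
Proof.
by elim/big_ind2 : _ => [|a b c e <- <-|//]; rewrite ?dot0l ?dotDl.
Qed.

Lemma dot_sumr n (F : 'I_n -> 'cV[R]_p) x :
  dot x (\sum_i F i) = \sum_i dot x (F i).
Proof. by rewrite dotC dot_suml; apply: eq_bigr => i _; rewrite dotC. Qed.

Lemma dot_ge0 x : 0 <= dot x x.
Proof. by rewrite dotE sumr_ge0// => i _; rewrite -expr2 sqr_ge0. Qed.

Lemma dot_eq0 x : (dot x x == 0) = (x == 0).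
Proof.
apply/eqP/eqP => [|->]; last exact: dot0l.
rewrite dotE => /eqP; rewrite psumr_eq0 => [/allP h|i _]; last first.
  by rewrite -expr2 sqr_ge0.
apply/matrixP => i j; rewrite (ord1 j) mxE.
by have := h i (mem_index_enum _); rewrite mulf_eq0 orbb => /eqP.
Qed.

Lemma dot_gt0 x : x != 0 -> 0 < dot x x.
Proof. by move=> x0; rewrite lt0r dot_ge0 dot_eq0 x0. Qed.

Lemma dot_mulmxl q (A : 'M[R]_(q, p)) x (y : 'cV[R]_q) :
  dot (A *m x) y = dot x (A^T *m y).
Proof. by rewrite /dot trmx_mul mulmxA. Qed.

Lemma dot_mulmxr q (A : 'M[R]_(q, p)) x (y : 'cV[R]_q) :
  dot y (A *m x) = dot (A^T *m y) x.
Proof. by rewrite /dot trmx_mul trmxK mulmxA. Qed.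

Lemma enorm_ge0 x : 0 <= enorm x.
Proof. exact: sqrtr_ge0. Qed.

Lemma enorm_sqr x : enorm x ^+ 2 = dot x x.
Proof. by rewrite sqr_sqrtr// dot_ge0. Qed.

Lemma enorm_eq0 x : (enorm x == 0) = (x == 0).
Proof. by rewrite -sqrf_eq0 enorm_sqr dot_eq0. Qed.

Lemma enorm_gt0 x : (0 < enorm x) = (x != 0).
Proof. by rewrite lt0r enorm_ge0 enorm_eq0 andbT. Qed.

Lemma enorm0 : enorm (0 : 'cV[R]_p) = 0.
Proof. by apply/eqP; rewrite enorm_eq0. Qed.

Lemma enormZ a x : enorm (a *: x) = `|a| * enorm x.
Proof.
by rewrite /enorm dotZl dotZr mulrA -expr2 sqrtrM ?sqr_ge0// sqrtr_sqr.
Qed.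

Lemma enormN x : enorm (- x) = enorm x.
Proof. by rewrite /enorm dotNl dotNr opprK. Qed.

Lemma Cauchy_Schwarz x y : dot x y ^+ 2 <= dot x x * dot y y.
Proof.
have [->|y0] := eqVneq y 0; first by rewrite !dot0r expr0n mulr0.
have Y0 := dot_gt0 y0.
have := dot_ge0 (dot y y *: x - dot x y *: y).
rewrite !(dotBl, dotBr, dotZl, dotZr) (dotC y x).
rewrite (_ : _ - _ = dot y y * (dot x x * dot y y - dot x y ^+ 2)); last by ring.
by rewrite pmulr_rge0// subr_ge0.
Qed.

Lemma normr_dot x y : `|dot x y| <= enorm x * enorm y.
Proof.
rewrite -(@ler_pXn2r _ 2)// ?nnegrE ?mulr_ge0 ?enorm_ge0//.
by rewrite real_normK ?num_real// exprMn !enorm_sqr Cauchy_Schwarz.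
Qed.

Lemma enormD x y : enorm (x + y) <= enorm x + enorm y.
Proof.
rewrite -(@ler_pXn2r _ 2)// ?nnegrE ?addr_ge0 ?enorm_ge0//.
rewrite sqrrD !enorm_sqr dotDl !dotDr (dotC y x).
have := le_trans (ler_norm _) (normr_dot x y).
rewrite mulr2n; lra.
Qed.

Lemma dot_delta i x : dot (delta_mx i 0) x = x i 0.
Proof.
rewrite dotE (bigD1 i)//= big1 ?addr0 ?mxE ?eqxx ?mul1r// => j ji.
by rewrite mxE (negbTE ji) mul0r.
Qed.

Lemma dot_sum_delta x : dot x x = \sum_i dot (delta_mx i 0) x ^+ 2.
Proof. by rewrite dotE; apply: eq_bigr => i _; rewrite dot_delta. Qed.

Lemma normr_coord_enorm x i : `|x i 0| <= enorm x.
Proof.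
rewrite -(@ler_pXn2r _ 2)// ?nnegrE ?enorm_ge0//.
rewrite real_normK ?num_real// enorm_sqr dotE (bigD1 i)//= -expr2 lerDl.
by rewrite sumr_ge0// => j _; rewrite -expr2 sqr_ge0.
Qed.

Lemma enorm_le_sum x : enorm x <= \sum_i `|x i 0|.
Proof.
rewrite -(@ler_pXn2r _ 2)// ?nnegrE ?enorm_ge0 ?sumr_ge0//.
rewrite enorm_sqr dotE expr2 mulr_suml; apply: ler_sum => i _.
rewrite -expr2 -real_normK ?num_real// expr2 ler_wpM2l// (bigD1 i)//= lerDl.
by rewrite sumr_ge0.
Qed.

End dot_theory.

Section lebesgue_power_invariance.
Context {R : realType}.

Definition lebp p : {sigma_finite_measure set (borel 'cV[R]_p) -> \bar R} :=
  mpower (@lebesgue_measure R) p.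

Lemma ge0_integral_lebpS p (F : borel 'cV[R]_p.+1 -> \bar R) :
  measurable_fun setT F -> (forall x, 0 <= F x)%E ->
  (\int[lebp p.+1]_x F x =
   \int[lebesgue_measure]_t \int[lebp p]_v F (col_mx (t%:M : 'cV[R]_1) (v : 'cV[R]_p)))%E.
Proof. exact: ge0_integral_mpowerS. Qed.

Lemma measurable_shift p (a : 'cV[R]_p) :
  measurable_fun setT (fun x : borel 'cV[R]_p => (x : 'cV[R]_p) + a : borel 'cV[R]_p).
Proof. exact: (@measurable_cVD _ _ (borel 'cV[R]_p) p id (cst a)). Qed.

Lemma col_mxDr p (t : R) (v : 'cV[R]_p) (a : 'cV[R]_p.+1) :
  col_mx (t%:M : 'cV[R]_1) v + a =
  col_mx ((t + a 0 0)%:M : 'cV[R]_1) (v + dsubmx (a : 'cV[R]_(1 + p))).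
Proof.
apply/matrixP => i j; rewrite (ord1 j) [LHS]mxE [in LHS]mxE [RHS]mxE.
case: (@splitP 1 p i) => k ik; rewrite !mxE/=.
  rewrite !(ord1 k) !mulr1n; congr (_ + a _ _); apply: val_inj.
  by rewrite [LHS]ik (ord1 k).
by congr (_ + a _ _); apply: val_inj.
Qed.

Lemma ge0_integral_lebp_shift p (F : borel 'cV[R]_p -> \bar R) (a : 'cV[R]_p) :
  measurable_fun setT F -> (forall x, 0 <= F x)%E ->
  (\int[lebp p]_x F ((x : 'cV[R]_p) + a)%R = \int[lebp p]_x F x)%E.
Proof.
elim: p F a => [|p IHp] F a mF F0.
  rewrite !ge0_integral_mpower0//; first by congr F; apply/matrixP => -[].
  exact: (measurableT_comp mF (measurable_shift a)).
rewrite !ge0_integral_lebpS; [|done|done|exact: (measurableT_comp mF (measurable_shift a))|done].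
pose G (t : measurableTypeR R) : \bar R := (\int[lebp p]_v F (col_mx (t%:M : 'cV[R]_1) (v : 'cV[R]_p)))%E.
rewrite -[RHS](ge0_integral_lebesgue_shift (F := G) (a 0 0)); last 2 first.
- exact: measurable_integral_col_mx.
- by move=> t; apply: integral_ge0.
apply: eq_integral => t _.
rewrite /G -(IHp (fun v => F (col_mx ((t + a 0 0)%:M : 'cV[R]_1) (v : 'cV[R]_p)))
  (dsubmx (a : 'cV[R]_(1 + p))))//; last first.
  exact: (measurableT_comp mF (measurable_fun_pair2 _ (@measurable_col_mx R p))).
apply: eq_integral => v _; congr F.
exact: col_mxDr.
Qed.

Lemma measurable_cons p (t : R) : measurable_fun setT
  (fun v : borel 'cV[R]_p => col_mx (t%:M : 'cV[R]_1) (v : 'cV[R]_p) : borel 'cV[R]_p.+1).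
Proof. exact: (measurable_fun_pair2 _ (@measurable_col_mx R p)). Qed.

Lemma measurable_opp p :
  measurable_fun setT (fun x : borel 'cV[R]_p => - (x : 'cV[R]_p) : borel 'cV[R]_p).
Proof.
apply: (@measurable_cVP _ _ (borel 'cV[R]_p) p) => i.
by under eq_fun do rewrite mxE; apply: measurable_funN; exact: measurable_coord.
Qed.

Lemma measurable_scale p (r : R) : measurable_fun setT
  (fun x : borel 'cV[R]_p => r *: (x : 'cV[R]_p) : borel 'cV[R]_p).
Proof. exact: (@measurable_cVZ _ _ (borel 'cV[R]_p) p (cst r) id). Qed.

Lemma ge0_integral_lebp_opp p (F : borel 'cV[R]_p -> \bar R) :
  measurable_fun setT F -> (forall x, 0 <= F x)%E ->
  (\int[lebp p]_x F (- (x : 'cV[R]_p))%R = \int[lebp p]_x F x)%E.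
Proof.
elim: p F => [|p IHp] F mF F0.
  rewrite !ge0_integral_mpower0//; first by congr F; apply/matrixP => -[].
  exact: (measurableT_comp mF (@measurable_opp _)).
rewrite !ge0_integral_lebpS; [|done|done|exact: (measurableT_comp mF (@measurable_opp _))|done].
pose G (t : measurableTypeR R) : \bar R := (\int[lebp p]_v F (col_mx (t%:M : 'cV[R]_1) (v : 'cV[R]_p)))%E.
rewrite -[RHS](ge0_integral_lebesgue_opp (F := G)); last 2 first.
- exact: measurable_integral_col_mx.
- by move=> t; apply: integral_ge0.
apply: eq_integral => t _.
rewrite /G -(IHp (fun v => F (col_mx ((- t)%:M : 'cV[R]_1) (v : 'cV[R]_p))))//; last first.
  exact: (measurableT_comp mF (@measurable_cons _ _)).
by apply: eq_integral => v _; congr F; rewrite raddfN -opp_col_mx.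
Qed.

Lemma ge0_integral_lebp_scale p (F : borel 'cV[R]_p -> \bar R) (r : R) : 0 < r ->
  measurable_fun setT F -> (forall x, 0 <= F x)%E ->
  (\int[lebp p]_x F (r *: (x : 'cV[R]_p))%R = (r ^- p)%:E * \int[lebp p]_x F x)%E.
Proof.
move=> r0; elim: p F => [|p IHp] F mF F0.
  rewrite !ge0_integral_mpower0//; last first.
    exact: (measurableT_comp mF (@measurable_scale _ _)).
  by rewrite expr0 invr1 mul1e; congr F; apply/matrixP => -[].
rewrite !ge0_integral_lebpS; [|done|done|exact: (measurableT_comp mF (@measurable_scale _ _))|done].
pose G (t : measurableTypeR R) : \bar R := (\int[lebp p]_v F (col_mx (t%:M : 'cV[R]_1) (v : 'cV[R]_p)))%E.
have mG : @measurable_fun _ _ (measurableTypeR R) _ setT G by exact: measurable_integral_col_mx.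
have G0 t : (0 <= G t)%E by apply: integral_ge0.
transitivity (\int[lebesgue_measure]_t ((r ^- p)%:E * G (r * t)%R))%E.
  apply: eq_integral => t _.
  rewrite -(IHp (fun v => F (col_mx ((r * t)%:M : 'cV[R]_1) (v : 'cV[R]_p))))//; last first.
    exact: (measurableT_comp mF (@measurable_cons _ _)).
  by apply: eq_integral => v _; congr F; rewrite -scale_scalar_mx -scale_col_mx.
have ms : @measurable_fun _ _ (measurableTypeR R) (measurableTypeR R) setT
    (fun t : R => r * t) by exact: measurable_funM.
have rp : (0 <= (r ^- p)%:E)%E by rewrite lee_fin invr_ge0 exprn_ge0// ltW.
have mGs := measurableT_comp mG ms.
rewrite ge0_integralZlT; [|exact: mGs|by move=> t; exact: G0|by rewrite -lee_fin].
by rewrite (ge0_integral_lebesgue_scale r0 mG G0) muleA -EFinM -invfM -exprSr.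
Qed.

End lebesgue_power_invariance.

Section power_of_product.
Context {R : realType} (mu : {sigma_finite_measure set (measurableTypeR R) -> \bar R}).

Lemma cons_mx0 p (t : R) (v : 'cV[R]_p) :
  (col_mx (t%:M : 'cV[R]_1) v : 'cV[R]_p.+1) ord0 0 = t.
Proof.
rewrite mxE; case: splitP => [j _|k /=]; last by rewrite add1n.
by rewrite (ord1 j) mxE.
Qed.

Lemma cons_mxS p (t : R) (v : 'cV[R]_p) i :
  (col_mx (t%:M : 'cV[R]_1) v : 'cV[R]_p.+1) (lift ord0 i) 0 = v i 0.
Proof.
rewrite mxE; case: splitP => [j /= ij|k /= /addnI/val_inj ->//].
by move: (ltn_ord j); rewrite -ij.
Qed.

Lemma measurable_prod_coord p (h : R -> R) : measurable_fun setT h ->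
  measurable_fun setT
    (fun x : borel 'cV[R]_p => \prod_i h ((x : 'cV[R]_p) i 0)).
Proof.
move=> mh; apply: (@measurable_prod _ _ _ _ _ _
  (fun i (x : borel 'cV[R]_p) => h ((x : 'cV[R]_p) i 0))) => i _.
by apply: (measurableT_comp mh); exact: measurable_coord.
Qed.

(** Serves twice: for the volume of cubes, and for the total mass of the Gaussian measure. *)
Lemma ge0_integral_mpower_prod p (h : R -> R) : measurable_fun setT h ->
  (forall t, 0 <= h t) ->
  (\int[mpower mu p]_x (\prod_i h ((x : 'cV[R]_p) i 0))%:E =
   (\int[mu]_t (h t)%:E) ^+ p)%E.
Proof.
move=> mh h0; elim: p => [|p IHp].
  rewrite ge0_integral_mpower0 ?big_ord0//.
  by apply/measurable_EFinP; exact: measurable_prod_coord.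
rewrite ge0_integral_mpowerS; last 2 first.
- by apply/measurable_EFinP; exact: measurable_prod_coord.
- by move=> x; rewrite lee_fin prodr_ge0.
transitivity (\int[mu]_t ((\int[mpower mu p]_x (\prod_i h ((x : 'cV[R]_p) i 0))%:E) * (h t)%:E))%E.
  apply: eq_integral => t _; rewrite muleC -ge0_integralZlT; last 3 first.
  - by apply/measurable_EFinP; exact: measurable_prod_coord.
  - by move=> x; rewrite lee_fin prodr_ge0.
  - exact: h0.
  apply: eq_integral => v _; rewrite big_ord_recl cons_mx0 -EFinM.
  by congr (_ * _)%:E; apply: eq_bigr => i _; rewrite cons_mxS.
rewrite ge0_integralZl//.
- by rewrite IHp expeS muleC.
- exact/measurable_EFinP.
- by move=> t _; rewrite lee_fin.
- by apply: integral_ge0 => x _; rewrite lee_fin prodr_ge0.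
Qed.

End power_of_product.

(** * Orthogonal invariance of Lebesgue measure, normalized by the unit ball *)

Section unit_ball.
Context {R : realType} (p : nat).

Definition unit_ball : set (borel 'cV[R]_p) := [set x : 'cV[R]_p | enorm x <= 1].

Lemma measurable_unit_ball : measurable unit_ball.
Proof.
have := @measurable_enorm R _ (borel 'cV[R]_p) p id (@measurable_id _ _ _).
move=> /(_ measurableT `]-oo, 1]%classic); rewrite setTI => h.
rewrite (_ : unit_ball = enorm (p:=p) @^-1` `]-oo, 1]%classic).
  by apply: h; exact: measurable_itv.
by apply/seteqP; split => x; rewrite /unit_ball /= in_itv.
Qed.

Let cube (r : R) (x : 'cV[R]_p) : R := \prod_i \1_`[- r, r] (x i 0).

Let cubeE r x : cube r x = (\1_[set x : 'cV[R]_p | forall i, `|x i 0| <= r] x).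
Proof.
rewrite /cube indicE; case: (asboolP (forall i, `|x i 0| <= r)) => h.
  rewrite mem_set// big1// => i _; rewrite indicE mem_set//= in_itv/= -ler_norml.
  exact: h.
rewrite memNset//; move/existsNP : h => [i hi].
rewrite (bigD1 i)//= indicE memNset ?mul0r//= in_itv/= -ler_norml.
exact/negP/negP.
Qed.

Let integral_cube r : 0 <= r ->
  (\int[lebp p]_x (cube r x)%:E = ((r + r) ^+ p)%:E)%E.
Proof.
move=> r0; rewrite ge0_integral_mpower_prod//.
rewrite (_ : (\int[_]_t _)%E = (r + r)%:E) ?EFin_expe//.
have -> : (\int[@lebesgue_measure R]_t (\1_`[- r, r] t)%:E)%E =
    lebesgue_measure (`[- r, r]%classic : set R) by rewrite integral_indic ?setIT.
rewrite lebesgue_measure_itv/= lte_fin.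
have [rr|rr] := ltP; first by rewrite -EFinB opprK.
by congr EFin; move: r0 rr; lra.
Qed.

Let measurable_cube r : measurable_fun setT
  (fun x : borel 'cV[R]_p => (cube r x)%:E).
Proof. by apply/measurable_EFinP; exact: measurable_prod_coord. Qed.

Let le_cube r (A : set (borel 'cV[R]_p)) : measurable A ->
  (forall x : 'cV[R]_p, A x -> forall i, `|x i 0| <= r) -> 0 <= r ->
  (lebp p A <= ((r + r) ^+ p)%:E)%E.
Proof.
move=> mA Ar r0; rewrite -integral_cube// -[A]setIT -integral_indic//.
apply: ge0_le_integral => //.
- by apply/measurable_EFinP; exact: measurable_indic.
- move=> x _; rewrite lee_fin cubeE !indicE.
  have [xA|] := boolP (x \in A); last by [].
  by rewrite mem_set//; apply: Ar; rewrite -inE.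
Qed.

Lemma lebp_unit_ball_lty : (lebp p unit_ball < +oo)%E.
Proof.
apply: le_lt_trans (le_cube measurable_unit_ball _ ler01) (ltry _) => x x1 i.
exact: le_trans (normr_coord_enorm x i) x1.
Qed.

(** Positivity and finiteness are all that is asked of the volume of the ball: they allow it to be
    cancelled in an equation. Positivity comes from a small inscribed cube. *)
Lemma lebp_unit_ball_gt0 : (0 < lebp p unit_ball)%E.
Proof.
(* The cube of half-side [r] lies in the ball, since the Euclidean norm is at most the sum of the
   [p] absolute coordinates; [p.+1] keeps [r] positive when [p] is 0. *)
pose r : R := p.+1%:R^-1.
have r0 : 0 < r by rewrite invr_gt0.
apply: (@lt_le_trans _ _ ((r + r) ^+ p)%:E); first by rewrite lte_fin exprn_gt0// addr_gt0.
rewrite -(integral_cube (ltW r0)) -[unit_ball]setIT -integral_indic//; last first.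
  exact: measurable_unit_ball.
apply: ge0_le_integral => //.
- by move=> x _; rewrite lee_fin cubeE.
- by apply/measurable_EFinP/measurable_indic; exact: measurable_unit_ball.
- move=> x _; rewrite lee_fin cubeE !indicE.
  have [xr|xr] := pselect (forall i, `|(x : 'cV[R]_p) i 0| <= r); last first.
    by rewrite memNset.
  rewrite (mem_set xr) mem_set//= /unit_ball/=; apply: le_trans (enorm_le_sum x) _.
  apply: (@le_trans _ _ (\sum_(i < p) r)); first exact: ler_sum.
  by rewrite sumr_const card_ord -mulr_natl ler_pdivrMr// mul1r ler_nat.
Qed.

End unit_ball.
Arguments unit_ball {R}.

Section orthogonal_invariance.
Context {R : realType} (p : nat).
Variables (H : 'M[R]_p) (HH : H^T *m H = 1%:M).
Local Notation V := (borel 'cV[R]_p).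

Lemma orth_dot (x y : 'cV[R]_p) : dot (H *m x) (H *m y) = dot x y.
Proof. by rewrite dot_mulmxl mulmxA HH mul1mx. Qed.

Lemma orth_enorm (x : 'cV[R]_p) : enorm (H *m x) = enorm x.
Proof. by rewrite /enorm orth_dot. Qed.

Let mH : measurable_fun setT (fun x : V => H *m (x : 'cV[R]_p) : V).
Proof. exact: (@measurable_cV_mulmx _ _ V p p H id). Qed.

(** The argument for uniqueness of Haar measure. The double integral of F(Hx) G(y + Hx) is the left
    side by translation in y; translating x by -H'y turns it into that of F(Hx - y) G(Hx), which is
    the right side by reflection and translation in y. *)
Lemma ge0_integral_lebp_mulmx_swap (F G : V -> \bar R) :
  measurable_fun setT F -> (forall x, 0 <= F x)%E ->
  measurable_fun setT G -> (forall x, 0 <= G x)%E ->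
  (\int[lebp p]_x F (H *m (x : 'cV[R]_p))%R * \int[lebp p]_x G x =
   \int[lebp p]_x G (H *m (x : 'cV[R]_p))%R * \int[lebp p]_x F x)%E.
Proof.
move=> mF F0 mG G0.
have mFH : measurable_fun setT (fun x : V => F (H *m (x : 'cV[R]_p))%R).
  exact: measurableT_comp mF mH.
have mGH : measurable_fun setT (fun x : V => G (H *m (x : 'cV[R]_p))%R).
  exact: measurableT_comp mG mH.
have HHT : H *m H^T = 1%:M by exact: mulmx1C.
transitivity (\int[lebp p]_x \int[lebp p]_y
    (F (H *m (x : 'cV[R]_p))%R * G ((y : 'cV[R]_p) + H *m (x : 'cV[R]_p))%R))%E.
  rewrite -ge0_integralZr; [|done|exact: mFH|by move=> x _|by apply: integral_ge0].
  apply: eq_integral => x _.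
  rewrite ge0_integralZl; [|done| |by move=> y _|done]; last first.
    exact: (measurableT_comp mG (measurable_shift _)).
  by rewrite ge0_integral_lebp_shift.
have m1 : measurable_fun setT (fun xy : V * V => F (H *m (xy.1 : 'cV[R]_p))%R *
    G ((xy.2 : 'cV[R]_p) + H *m (xy.1 : 'cV[R]_p))%R)%E.
  apply: emeasurable_funM; first exact: (measurableT_comp mFH measurable_fst).
  apply: (measurableT_comp mG).
  apply: (@measurable_cVD _ _ (V * V)%type p snd (fun xy => H *m (xy.1 : 'cV[R]_p))).
    exact: measurable_snd.
  exact: (measurableT_comp mH measurable_fst).
rewrite (fubini_tonelli (fun xy : V * V => F (H *m (xy.1 : 'cV[R]_p))%R *
    G ((xy.2 : 'cV[R]_p) + H *m (xy.1 : 'cV[R]_p))%R)%E m1); last first.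
  by move=> xy; rewrite mule_ge0.
transitivity (\int[lebp p]_y \int[lebp p]_x
    (F (H *m (x : 'cV[R]_p) - (y : 'cV[R]_p))%R * G (H *m (x : 'cV[R]_p))%R))%E.
  apply: eq_integral => y _ /=.
  rewrite -(@ge0_integral_lebp_shift _ p (fun x : V => (F (H *m (x : 'cV[R]_p))%R *
    G ((y : 'cV[R]_p) + H *m (x : 'cV[R]_p))%R)%E) (- (H^T *m (y : 'cV[R]_p)))).
  - apply: eq_integral => x _; rewrite mulmxDr mulmxN mulmxA HHT mul1mx.
    by rewrite addrCA subrr addr0.
  - exact: (measurable_fun_pair1 _ m1).
  - by move=> x; rewrite mule_ge0.
have m2 : measurable_fun setT (fun xy : V * V =>
    F (H *m (xy.1 : 'cV[R]_p) - (xy.2 : 'cV[R]_p))%R * G (H *m (xy.1 : 'cV[R]_p))%R)%E.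
  apply: emeasurable_funM; last exact: (measurableT_comp mGH measurable_fst).
  apply: (measurableT_comp mF).
  apply: (@measurable_cVD _ _ (V * V)%type p (fun xy => H *m (xy.1 : 'cV[R]_p))
    (fun xy => - (xy.2 : 'cV[R]_p))).
    exact: (measurableT_comp mH measurable_fst).
  exact: (measurableT_comp (@measurable_opp _ _) measurable_snd).
rewrite -(fubini_tonelli (fun xy : V * V =>
    F (H *m (xy.1 : 'cV[R]_p) - (xy.2 : 'cV[R]_p))%R * G (H *m (xy.1 : 'cV[R]_p))%R)%E m2);
  last by move=> xy; rewrite mule_ge0.
rewrite -[RHS]ge0_integralZr; [|done|exact: mGH|by move=> x _|by apply: integral_ge0].
apply: eq_integral => x _.
have mFx : measurable_fun setT (fun y : V => F ((y : 'cV[R]_p) + H *m (x : 'cV[R]_p))%R).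
  exact: (measurableT_comp mF (measurable_shift _)).
rewrite /= ge0_integralZr; [|done| |by move=> y _|done]; last first.
  rewrite (_ : (fun _ => _) = (fun y : V => F ((y : 'cV[R]_p) + H *m (x : 'cV[R]_p))%R) \o
    (fun y : V => - (y : 'cV[R]_p) : V)).
    exact: (measurableT_comp mFx (@measurable_opp _ _)).
  by apply/funext => y /=; rewrite addrC.
rewrite muleC; congr (_ * _)%E.
rewrite -(ge0_integral_lebp_shift (H *m (x : 'cV[R]_p)) mF F0).
rewrite -(ge0_integral_lebp_opp mFx); last by move=> y.
by apply: eq_integral => y _; rewrite addrC.
Qed.

(* An orthogonal change of variables multiplies Lebesgue measure by a constant,
   which is 1 because the unit ball is preserved. *)
Lemma ge0_integral_lebp_orth (F : V -> \bar R) :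
  measurable_fun setT F -> (forall x, 0 <= F x)%E ->
  (\int[lebp p]_x F (H *m (x : 'cV[R]_p))%R = \int[lebp p]_x F x)%E.
Proof.
move=> mF F0.
have mB := @measurable_unit_ball R p.
have := @ge0_integral_lebp_mulmx_swap F (fun x => (\1_(unit_ball p) x : R)%:E) mF F0.
have mI : measurable_fun setT (fun x : V => (\1_(unit_ball p) x : R)%:E).
  by apply/measurable_EFinP; exact: measurable_indic.
move=> /(_ mI) h; have {h} := h (fun x : V => ltac:(by rewrite lee_fin)).
rewrite (_ : (fun x => (\1_(unit_ball p) (H *m x) : R)%:E) = (fun x => (\1_(unit_ball p) x)%:E)).
  rewrite integral_indic// setIT => h.
  have b0 := @lebp_unit_ball_gt0 R p; have boo := @lebp_unit_ball_lty R p.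
  have [b b0' bE] : exists2 b : R, 0 < b & lebp p (unit_ball p) = b%:E.
    by case: (lebp p (unit_ball p)) b0 boo => [b b0 _|//|//]; exists b.
  have hb : (\int[lebp p]_x F (H *m (x : 'cV[R]_p))%R * b%:E =
      b%:E * \int[lebp p]_x F x)%E by rewrite -bE; exact: h.
  have cancel y : (b^-1%:E * (b%:E * y) = y)%E.
    by rewrite muleA -EFinM mulVf ?mul1e// gt_eqF.
  by rewrite -[LHS]cancel [X in (_ * X)%E]muleC hb cancel.
apply/funext => x; rewrite !indicE; congr (_%:R%:E).
by congr nat_of_bool; apply/idP/idP; rewrite !inE /unit_ball /= orth_enorm.
Qed.

End orthogonal_invariance.

(** * Polar decomposition and Laplace asymptotics *)

Section density_measure.
Context d (T : measurableType d) {R : realType} (mu : {measure set T -> \bar R}).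
Variables (h : T -> R) (mh : measurable_fun setT h) (h0 : forall x, 0 <= h x).

Definition mdensity (A : set T) : \bar R := (\int[mu]_(x in A) (h x)%:E)%E.

Let mdensity0 : mdensity set0 = 0%E.
Proof. by rewrite /mdensity integral_set0. Qed.

Let mdensity_ge0 A : (0 <= mdensity A)%E.
Proof. by apply: integral_ge0 => x _; rewrite lee_fin. Qed.

Let mdensity_semi_sigma_additive : semi_sigma_additive mdensity.
Proof.
move=> F mF tF mUF; rewrite /mdensity ge0_integral_bigcup//.
- by apply: is_cvg_ereal_nneg_natsum_cond => n _ _; exact: mdensity_ge0.
- by apply/measurable_EFinP; exact: measurable_funTS.
- by move=> x _; rewrite lee_fin.
Qed.

HB.instance Definition _ := isMeasure.Build _ _ _ mdensity
  mdensity0 mdensity_ge0 mdensity_semi_sigma_additive.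

Definition density_measure : {measure set T -> \bar R} := mdensity.

Import HBNNSimple.

(** Clear for simple functions, level set by level set; monotone convergence on both sides gives the
    rest. *)
Lemma ge0_integral_mdensity (F : T -> \bar R) :
  measurable_fun setT F -> (forall x, 0 <= F x)%E ->
  (\int[density_measure]_x F x = \int[mu]_x (F x * (h x)%:E))%E.
Proof.
move=> mF F0; pose g := nnsfun_approx measurableT mF.
have mE : measurable_fun setT (EFin \o h) by exact/measurable_EFinP.
have gF x : limn (fun n => (g n x)%:E) = F x.
  by apply/cvg_lim => //; apply: cvg_nnsfun_approx.
transitivity (limn (fun n => \int[density_measure]_x (g n x)%:E)%E).
  rewrite -monotone_convergence//.
  - by apply: eq_integral => x _; rewrite gF.
  - by move=> n; exact/measurable_EFinP.
  - by move=> n x _; rewrite lee_fin.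
  - by move=> x _ m n mn; rewrite lee_fin; exact/lefP/nd_nnsfun_approx.
transitivity (limn (fun n => \int[mu]_x ((g n x)%:E * (h x)%:E))%E).
  congr (limn _); apply/funext => n.
  rewrite integralT_nnsfun sintegralE.
  transitivity (\sum_(k \in range (g n))
      \int[mu]_x (k%:E * ((\1_(g n @^-1` [set k]) x)%:E * (h x)%:E)))%E.
    apply: eq_fsbigr => k kg; rewrite ge0_integralZlT//.
    - congr (_ * _)%E.
      transitivity (\int[mu]_(x in g n @^-1` [set k]) (h x)%:E)%E; first by [].
      rewrite integral_mkcond; apply: eq_integral => x _; rewrite patchE indicE.
      by case: ifPn => _; rewrite ?mul1e ?mul0e.
    - by apply: emeasurable_funM => //; apply/measurable_EFinP/measurable_indic.
    - by move=> x; rewrite -EFinM lee_fin mulr_ge0.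
    - by move: kg; rewrite inE => -[x _ <-].
  rewrite -ge0_integral_fsum//.
  - apply: eq_integral => x _; rewrite [in RHS]fimfunE -fsumEFin//.
    rewrite ge0_mule_fsuml//; last first.
      by move=> r; rewrite nnfun_muleindic_ge0.
    by apply: eq_fsbigr => r _; rewrite EFinM muleA.
  - move=> k; apply: emeasurable_funM => //.
    by apply: emeasurable_funM => //; apply/measurable_EFinP/measurable_indic.
  - by move=> k x _; rewrite muleA mule_ge0 ?lee_fin//; exact: nnfun_muleindic_ge0.
rewrite -monotone_convergence//.
- apply: eq_integral => x _; rewrite -gF; apply/cvg_lim => //.
  apply: cvgeZr => //.
  by rewrite gF; apply: cvg_nnsfun_approx.
- by move=> n; apply: emeasurable_funM => //; apply/measurable_EFinP.
- by move=> n x _; rewrite -EFinM lee_fin mulr_ge0.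
- move=> x _ m n mn; rewrite -!EFinM lee_fin ler_wpM2r//.
  exact/lefP/nd_nnsfun_approx.
Qed.

End density_measure.

(** * Substitution by the cosine of the polar angle *)

Section change_of_variable.
Context {R : realType}.
Local Notation mu := (@lebesgue_measure R).

Lemma FTC_is_derive (F f : R -> R) (a b : R) : a < b ->
  (forall x, a <= x <= b -> is_derive x 1 F (f x)) ->
  (forall x, a <= x <= b -> {for x, continuous f}) ->
  (\int[mu]_(x in `[a, b]) (f x)%:E = (F b - F a)%:E)%E.
Proof.
move=> ab dF cf.
have cF x : a <= x <= b -> {for x, continuous F}.
  by move=> /dF dFx; apply: differentiable_continuous; apply/derivable1_diffP.
have aab : a <= a <= b by rewrite lexx ltW.
have bab : a <= b <= b by rewrite lexx ltW.
rewrite (@continuous_FTC2 _ f F)//.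
- apply: continuous_in_subspaceT => x; rewrite inE/= in_itv/=; exact: cf.
- split.
  + move=> x; rewrite in_itv/= => /andP[ax xb].
    by have := dF x; rewrite !ltW// => /(_ isT) [].
  + by apply: cvg_at_right_filter; exact: cF.
  + by apply: cvg_at_left_filter; exact: cF.
- move=> x; rewrite in_itv/= => /andP[ax xb].
  by rewrite derive1E; have := dF x; rewrite !ltW// => /(_ isT) [].
Qed.

(** For a vector with first coordinate t and remaining part of norm [rho], [tau rho t] is the cosine
    of its angle with the first axis. On ]-1, 1[ the map [psi rho] is its inverse and [dpsi rho] the
    derivative of that inverse; real powers are used so that exponents can be added later. *)
Let psi (rho s : R) : R := rho * s * (1 - s ^+ 2) `^ (- 2^-1).
Let dpsi (rho s : R) : R := rho * (1 - s ^+ 2) `^ (- 2^-1 - 1).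
Let tau (rho t : R) : R := t / Num.sqrt (t ^+ 2 + rho ^+ 2).

Let sqr_lt1 (s : R) : -1 < s < 1 -> 0 < 1 - s ^+ 2.
Proof. by move=> /andP[s1 s2]; nra. Qed.

Let is_derive_psi (rho s : R) : -1 < s < 1 -> is_derive s (1 : R) (psi rho) (dpsi rho s).
Proof.
move=> s1; have q0 := sqr_lt1 s1.
have dq : is_derive s (1 : R) (fun s : R => 1 - s ^+ 2) (- (2 * s)).
  by apply: is_derive_eq; rewrite /GRing.scale/=; ring.
have dc := @is_derive1_powR R (- 2^-1) _ q0.
have dd := @is_derive1_comp R (fun s => s `^ (- 2^-1)) (fun s : R => 1 - s ^+ 2) s _ _ dc dq.
have dl : is_derive s (1 : R) (fun s : R => rho * s) rho.
  by apply: is_derive_eq; rewrite /GRing.scale/=; ring.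
apply: (is_derive_eq (is_deriveM dl dd)).
rewrite /GRing.scale/= /dpsi.
have -> : (1 - s ^+ 2) `^ (- 2^-1) = (1 - s ^+ 2) `^ (- 2^-1 - 1) * (1 - s ^+ 2).
  rewrite -[X in _ = _ * X](powRr1 (ltW q0)) -powRD ?subrK//.
  by apply/implyP => _; rewrite gt_eqF.
by field.
Qed.

Let continuous_dpsi (rho s : R) : -1 < s < 1 -> {for s, continuous (dpsi rho)}.
Proof.
move=> s1; have q0 := sqr_lt1 s1.
have dq : is_derive s (1 : R) (fun s : R => 1 - s ^+ 2) (- (2 * s)).
  by apply: is_derive_eq; rewrite /GRing.scale/=; ring.
have dc := @is_derive1_powR R (- 2^-1 - 1) _ q0.
have dd := @is_derive1_comp R (fun s => s `^ (- 2^-1 - 1)) (fun s : R => 1 - s ^+ 2) s _ _ dc dq.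
apply: differentiable_continuous; apply/derivable1_diffP.
by apply: derivableM => //; case: dd.
Qed.

Let dpsi_ge0 (rho s : R) : 0 < rho -> 0 <= dpsi rho s.
Proof. by move=> r0; rewrite mulr_ge0 ?powR_ge0// ltW. Qed.

Let psiE (rho s : R) : -1 < s < 1 -> psi rho s = rho * s / Num.sqrt (1 - s ^+ 2).
Proof. by move=> /sqr_lt1 q0; rewrite /psi powRN powR12_sqrt// ltW. Qed.

Let psiK (rho s : R) : 0 < rho -> -1 < s < 1 -> tau rho (psi rho s) = s.
Proof.
move=> r0 s1; have q0 := sqr_lt1 s1; rewrite psiE// /tau.
have k0 : 0 < Num.sqrt (1 - s ^+ 2) by rewrite sqrtr_gt0.
have -> : (rho * s / Num.sqrt (1 - s ^+ 2)) ^+ 2 + rho ^+ 2 =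
    (rho / Num.sqrt (1 - s ^+ 2)) ^+ 2.
  rewrite !expr_div_n sqr_sqrtr ?ltW//; field.
  by rewrite gt_eqF.
rewrite sqrtr_sqr gtr0_norm ?divr_gt0//; field.
by rewrite !gt_eqF.
Qed.

Let tau_den (rho t : R) : 0 < rho -> 0 < Num.sqrt (t ^+ 2 + rho ^+ 2).
Proof.
by move=> r0; rewrite sqrtr_gt0 ltr_wpDl ?sqr_ge0// exprn_gt0.
Qed.

Let tau_sqr (rho t : R) : 0 < rho ->
  1 - tau rho t ^+ 2 = (rho / Num.sqrt (t ^+ 2 + rho ^+ 2)) ^+ 2.
Proof.
move=> r0; have d0 := tau_den t r0.
have d1 : 0 < t ^+ 2 + rho ^+ 2 by rewrite -sqrtr_gt0.
rewrite /tau !expr_div_n sqr_sqrtr ?ltW//; field.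
by rewrite gt_eqF.
Qed.

Let tau_bound (rho t : R) : 0 < rho -> -1 < tau rho t < 1.
Proof.
move=> r0; have := tau_sqr t r0; have d0 := tau_den t r0.
have : 0 < (rho / Num.sqrt (t ^+ 2 + rho ^+ 2)) ^+ 2.
  by rewrite exprn_gt0// divr_gt0.
by move=> h1 h2; rewrite -ltr_norml -(@ltr_pXn2r _ 2)// ?nnegrE//
  real_normK ?num_real// expr1n -subr_gt0 h2.
Qed.

Let tauK (rho t : R) : 0 < rho -> psi rho (tau rho t) = t.
Proof.
move=> r0; have d0 := tau_den t r0.
rewrite psiE ?tau_bound// tau_sqr// sqrtr_sqr gtr0_norm ?divr_gt0// /tau.
by field; rewrite !gt_eqF.
Qed.

Let FTC_psi (rho u v : R) : -1 < u -> u < v -> v < 1 ->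
  (\int[mu]_(s in `[u, v]) (dpsi rho s)%:E = (psi rho v - psi rho u)%:E)%E.
Proof.
move=> u0 uv v1; apply: FTC_is_derive => // x /andP[ux xv].
  by apply: is_derive_psi; rewrite (lt_le_trans u0)// (le_lt_trans xv).
by apply: continuous_dpsi; rewrite (lt_le_trans u0)// (le_lt_trans xv).
Qed.

(** Integrating the nonnegative [dpsi] gives the weak inequality; equality is excluded because
    [tau rho] inverts [psi rho]. *)
Let psi_nd (rho s s' : R) : 0 < rho -> -1 < s < 1 -> -1 < s' < 1 ->
  (psi rho s < psi rho s') = (s < s').
Proof.
have mono (u v : R) : 0 < rho -> -1 < u < 1 -> -1 < v < 1 -> u < v ->
    psi rho u <= psi rho v.
  move=> r0 /andP[u0 u1] /andP[v0 v1] uv; rewrite -subr_ge0 -lee_fin.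
  rewrite -(FTC_psi rho u0 uv v1).
  by apply: integral_ge0 => x _; rewrite lee_fin dpsi_ge0.
move=> r0 s1 s'1; apply/idP/idP => [h|ss'].
  rewrite ltNge le_eqVlt negb_or; apply/andP; split.
    by apply: contraTN h => /eqP ->; rewrite ltxx.
  by apply: contraTN h => /(mono _ _ r0 s'1 s1); rewrite leNgt.
rewrite lt_neqAle mono// andbT; apply: contraTN ss' => /eqP e.
by rewrite -(psiK r0 s1) e psiK// ltxx.
Qed.

Lemma ge0_integral_cosine (rho : R) (F : measurableTypeR R -> \bar R) : 0 < rho ->
  measurable_fun setT F -> (forall s, 0 <= F s)%E ->
  (\int[mu]_t F (t / Num.sqrt (t ^+ 2 + rho ^+ 2))%R =
   \int[mu]_(s in `](-1)%R, 1%R[) (F s * (rho * (1 - s ^+ 2) `^ (- 2^-1 - 1))%:E))%E.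
Proof.
move=> r0 mF F0.
pose w (s : measurableTypeR R) : R := dpsi rho s * \1_(`]-1, 1[%classic : set R) s.
have mdp : measurable_fun setT (dpsi rho).
  apply: measurable_funM => //.
  apply: (measurableT_comp (measurable_powR _)).
  by apply: measurable_funB => //; exact: measurable_funX.
have mw : measurable_fun setT w by apply: measurable_funM.
have w0 s : 0 <= w s by rewrite mulr_ge0 ?dpsi_ge0.
have mpsi : @measurable_fun _ _ (measurableTypeR R) (measurableTypeR R) setT (psi rho).
  apply: measurable_funM; first exact: measurable_funM.
  apply: (measurableT_comp (measurable_powR _)).
  by apply: measurable_funB => //; exact: measurable_funX.
have mtau : @measurable_fun _ _ (measurableTypeR R) (measurableTypeR R) setT (tau rho).
  apply: measurable_funM => //.
  rewrite (_ : (fun _ => _) = (fun x => x `^ (- 2^-1)) \o (fun t => t ^+ 2 + rho ^+ 2)).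
    apply: measurableT_comp; first exact: measurable_powR.
    by apply: measurable_funD => //; exact: measurable_funX.
  apply/funext => t /=; rewrite powRN powR12_sqrt//.
  by rewrite addr_ge0 ?sqr_ge0.
(* In place of a Jacobian formula: the measure with density [dpsi rho] on ]-1, 1[, carried by
   [psi rho], gives mass b - a to ]a, b] by the fundamental theorem of calculus, hence is Lebesgue
   measure. *)
pose nu := pushforward_measure (density_measure mu mw w0) mpsi.
have nuE A : measurable A -> mu A = nu A.
  apply: lebesgue_measure_unique => a b ab.
  have -> : nu `]a, b]%classic = (\int[mu]_(s in psi rho @^-1` `]a, b]) (w s)%:E)%E by [].
  have ta := tau_bound a r0; have tb := tau_bound b r0.
  have tab : tau rho a < tau rho b by rewrite -(@psi_nd rho)// !tauK.
  rewrite -[RHS]EFinB; transitivity ((psi rho (tau rho b) - psi rho (tau rho a))%:E).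
    rewrite -FTC_psi//; [|by case/andP: ta|by case/andP: tb].
    rewrite -integral_itv_obnd_cbnd.
      rewrite integral_mkcond [RHS]integral_mkcond; apply: eq_integral => s _.
      rewrite !patchE /w indicE.
      have [sab|sab] := boolP (s \in `]tau rho a, tau rho b]%classic).
        move: sab; rewrite inE/= in_itv/= => /andP[sa sb].
        have s1 : -1 < s < 1.
          by rewrite (lt_trans _ sa) ?(le_lt_trans sb)//; [case/andP: tb|case/andP: ta].
        rewrite [s \in psi rho @^-1` _]mem_set/=; last first.
          rewrite in_itv/= -{1}(tauK a r0) psi_nd// sa leNgt.
          by rewrite -{1}(tauK b r0) psi_nd// -leNgt.
        by rewrite mem_set ?mulr1//= in_itv.
      have [s1|s1] := boolP (s \in `]-1, 1[%classic); last first.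
        by rewrite mulr0; case: ifP.
      rewrite memNset//= in_itv/=; move: sab; rewrite notin_setE/= in_itv/=.
      move: s1; rewrite inE/= in_itv/= => s1.
      apply: contra_not => /andP[h1 h2].
      by rewrite -(psi_nd r0 ta s1) tauK// h1 leNgt -(psi_nd r0 tb s1) tauK// -leNgt.
    by apply: measurable_funTS; apply/measurable_EFinP; exact: mdp.
  by rewrite !tauK.
transitivity (\int[nu]_t F (tau rho t))%E.
  by apply: eq_measure_integral => A mA _; exact: nuE.
have mFtau := measurableT_comp mF mtau.
rewrite (ge0_integral_pushforwardT _ mpsi mFtau); last by move=> t; exact: F0.
rewrite ge0_integral_mdensity; [| |by move=> s; exact: F0]; last first.
  exact: measurableT_comp mFtau mpsi.
rewrite [RHS]integral_mkcond; apply: eq_integral => s _.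
rewrite patchE /w indicE /=; case: ifPn; last by rewrite mulr0 mule0.
by rewrite inE/= in_itv/= => s1; rewrite psiK// mulr1.
Qed.

End change_of_variable.

(** * Polar coordinates around the first axis *)

Section polar.
Context {R : realType}.
Local Notation mu := (@lebesgue_measure R).

Definition punctured_ball p : set (borel 'cV[R]_p) :=
  [set x : 'cV[R]_p | x != 0 /\ enorm x <= 1].

Lemma measurable_set0cV p : measurable ([set (0 : 'cV[R]_p)] : set (borel 'cV[R]_p)).
Proof.
have := @measurable_enorm R _ (borel 'cV[R]_p) p id (@measurable_id _ _ _).
move=> /(_ measurableT [set 0]); rewrite setTI => h.
rewrite (_ : [set _] = enorm (p:=p) @^-1` [set 0]); first exact: h.
by apply/seteqP; split => [x ->|x /= /eqP]; rewrite /= ?enorm0 ?enorm_eq0// => /eqP.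
Qed.

Lemma measurable_punctured_ball p : measurable (@punctured_ball p).
Proof.
rewrite (_ : @punctured_ball p = unit_ball p `\ (0 : 'cV[R]_p)).
  by apply: measurableD; [exact: measurable_unit_ball|exact: measurable_set0cV].
by apply/seteqP; split => [x [/eqP]|x [xB /eqP]].
Qed.

(** Doubling preserves the origin, yet scaling multiplies its finite mass by 2^(-p), which is below
    1 for p > 0. *)
Lemma lebp_set0 p : (0 < p)%N -> lebp p [set (0 : 'cV[R]_p)] = 0%E.
Proof.
move=> p0; have m0 := @measurable_set0cV p.
pose F (x : borel 'cV[R]_p) : \bar R := (\1_[set (0 : 'cV[R]_p)] x)%:E.
have mF : measurable_fun setT F by apply/measurable_EFinP/measurable_indic.
have F0 x : (0 <= F x)%E by rewrite lee_fin.
have := @ge0_integral_lebp_scale R p F 2 (ltr0Sn R 1) mF F0.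
rewrite (_ : (fun x => F (2 *: x)) = F); last first.
  apply/funext => x; rewrite /F !indicE; congr (_%:R%:E); congr nat_of_bool.
  apply/idP/idP; rewrite !inE /= => /eqP; last by move/eqP => ->; rewrite scaler0.
  by rewrite scaler_eq0 pnatr_eq0/= => /eqP.
have -> : (\int[lebp p]_x F x = lebp p [set (0%R : 'cV[R]_p)])%E.
  by rewrite integral_indic// setIT.
have : (lebp p [set (0%R : 'cV[R]_p)] < +oo)%E.
  apply: le_lt_trans (lebp_unit_ball_lty p); apply: le_measure; rewrite ?inE//.
    exact: measurable_unit_ball.
  by move=> x ->; rewrite /unit_ball /= enorm0.
have : (0 <= lebp p [set (0%R : 'cV[R]_p)])%E by [].
case: (lebp p [set (0%R : 'cV[R]_p)]) => [r| |]//.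
rewrite lee_fin -EFinM => r0 _ [] rE; congr EFin.
have : 2 ^- p < 1 :> R.
  by rewrite invf_lt1 ?exprn_gt0// exprn_egt1// ?ltr1n// -lt0n.
move=> h; apply/eqP; rewrite eq_le r0 andbT leNgt; apply/negP => rp.
by have := ltr_pM2r rp (2 ^- p) 1; rewrite h mul1r -rE ltxx.
Qed.

(* The constant below is never computed: it cancels against the normalization of
   the density, whose total mass is 1. *)
Definition polar_const q : \bar R := (\int[lebp q]_v (enorm (v : 'cV[R]_q) * \1_(unit_ball q) v)%:E)%E.

Lemma measurable_enormT q :
  measurable_fun setT (fun v : borel 'cV[R]_q => enorm (v : 'cV[R]_q)).
Proof. exact: (@measurable_enorm R _ (borel 'cV[R]_q) q id (@measurable_id _ _ _)). Qed.

(** By homogeneity: one factor r comes from the norm and r^q from the volume. *)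
Let scaled_C q (r : R) : 0 < r ->
  (\int[lebp q]_v (enorm (v : 'cV[R]_q) * (enorm (v : 'cV[R]_q) <= r)%R%:R)%:E =
   (r ^+ q.+1)%:E * polar_const q)%E.
Proof.
move=> r0.
pose F (v : borel 'cV[R]_q) : \bar R :=
  (enorm (v : 'cV[R]_q) * (enorm (v : 'cV[R]_q) <= r)%R%:R)%:E.
have mF : measurable_fun setT F.
  apply/measurable_EFinP; apply: measurable_funM; first exact: measurable_enormT.
  apply: (measurableT_comp (f := fun b : bool => b%:R : R)) => //.
  by apply: measurable_fun_ler => //; exact: measurable_enormT.
have F0 v : (0 <= F v)%E by rewrite lee_fin mulr_ge0 ?enorm_ge0.
have := @ge0_integral_lebp_scale R q F r r0 mF F0.
rewrite (_ : (fun x => F (r *: x)) =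
  (fun v => r%:E * (enorm (v : 'cV[R]_q) * \1_(unit_ball q) v)%:E)%E); last first.
  apply/funext => v; rewrite /F enormZ gtr0_norm// -EFinM mulrA; congr (_ * _)%:E.
  rewrite -[X in _ <= X]mulr1 ler_pM2l// indicE; congr (_%:R); congr nat_of_bool.
  by apply/idP/idP; rewrite inE.
rewrite ge0_integralZlT; last 3 first.
- apply/measurable_EFinP; apply: measurable_funM; first exact: measurable_enormT.
  by apply: measurable_indic; exact: measurable_unit_ball.
- by move=> v; rewrite lee_fin mulr_ge0 ?enorm_ge0.
- exact: ltW.
move=> h; rewrite exprSr EFinM -muleA [X in (_ * X)%E]h muleA -EFinM.
by rewrite divff ?mul1e// expf_neq0// gt_eqF.
Qed.

Let dot_cons q (t : R) (v : 'cV[R]_q) :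
  dot (col_mx (t%:M : 'cV[R]_1) v : 'cV[R]_q.+1) (col_mx (t%:M : 'cV[R]_1) v) =
  t ^+ 2 + dot v v.
Proof.
rewrite dotE big_ord_recl cons_mx0 -expr2 dotE; congr (_ + _).
by apply: eq_bigr => i _; rewrite cons_mxS.
Qed.

(** For a fixed transverse part v the first coordinate is traded for the cosine s. The vector then
    has norm |v| / sqrt (1 - s^2), so that the constraint of the unit ball becomes |v| <= sqrt (1 -
    s^2). *)
Let inner q (v : 'cV[R]_q) (G : measurableTypeR R -> \bar R) : v != 0 ->
  measurable_fun setT G -> (forall s, 0 <= G s)%E ->
  (\int[mu]_t (G (t / enorm (col_mx (t%:M : 'cV[R]_1) v : 'cV[R]_q.+1))%R *
      (\1_(@punctured_ball q.+1) (col_mx (t%:M : 'cV[R]_1) v))%:E) =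
   \int[mu]_(s in `](-1)%R, 1%R[) (G s * ((enorm v <= Num.sqrt (1 - s ^+ 2))%R%:R)%:E *
      (enorm v * (1 - s ^+ 2) `^ (- 2^-1 - 1))%:E))%E.
Proof.
move=> v0 mG G0; have rho0 : 0 < enorm v by rewrite enorm_gt0.
pose H (s : measurableTypeR R) : \bar R := (G s * ((enorm v <= Num.sqrt (1 - s ^+ 2))%R%:R)%:E)%E.
have mH : measurable_fun setT H.
  apply: emeasurable_funM => //; apply/measurable_EFinP.
  apply: (measurableT_comp (f := fun b : bool => b%:R : R)) => //.
  apply: measurable_fun_ler => //.
  apply: (measurableT_comp (f := @Num.sqrt R)).
    by apply: continuous_measurable_fun; exact: sqrt_continuous.
  by apply: measurable_funB => //; exact: measurable_funX.
have H0 s : (0 <= H s)%E by rewrite mule_ge0// lee_fin.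
have := ge0_integral_cosine rho0 mH H0; rewrite /H => <-.
apply: eq_integral => t _; rewrite {1}/enorm dot_cons -enorm_sqr.
congr (_ * _%:E)%E; rewrite indicE; congr (_%:R); congr nat_of_bool.
have d0 : 0 < t ^+ 2 + enorm v ^+ 2.
  by rewrite ltr_wpDl ?sqr_ge0// exprn_gt0.
have s0 : 0 < Num.sqrt (t ^+ 2 + enorm v ^+ 2) by rewrite sqrtr_gt0.
have -> : 1 - (t / Num.sqrt (t ^+ 2 + enorm v ^+ 2)) ^+ 2 =
    (enorm v / Num.sqrt (t ^+ 2 + enorm v ^+ 2)) ^+ 2.
  rewrite !expr_div_n sqr_sqrtr ?ltW//; field.
  by rewrite gt_eqF.
rewrite sqrtr_sqr gtr0_norm ?divr_gt0// ler_pdivlMr// ger_pMr//.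
have e : enorm (col_mx (t%:M : 'cV[R]_1) v : 'cV[R]_q.+1) =
    Num.sqrt (t ^+ 2 + enorm v ^+ 2) by rewrite {1}/enorm dot_cons -enorm_sqr.
apply/idP/idP => [|h]; first by rewrite inE => -[_]; rewrite e.
by rewrite inE; split; rewrite -?enorm_gt0 e.
Qed.

Let measurable_G_ball q (G : measurableTypeR R -> \bar R) :
  measurable_fun setT G -> measurable_fun setT (fun x : borel 'cV[R]_q.+1 =>
    (G ((x : 'cV[R]_q.+1) 0 0 / enorm (x : 'cV[R]_q.+1))%R *
    (\1_(@punctured_ball q.+1) x)%:E)%E).
Proof.
move=> mG; apply: emeasurable_funM; last first.
  by apply/measurable_EFinP/measurable_indic; exact: measurable_punctured_ball.
apply: (measurableT_comp mG); apply: measurable_funM; first exact: measurable_coord.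
exact: (@measurable_enormV R _ (borel 'cV[R]_q.+1) q.+1 id (@measurable_id _ _ _)).
Qed.

(** After [inner] and Fubini, the integral over v for fixed s runs over a ball of radius sqrt (1 -
    s^2) and contributes (1 - s^2)^((q + 1)/2) by [scaled_C]. Together with the exponent -3/2 of the
    substitution this leaves (q - 2)/2. *)
Lemma ge0_integral_polar q (G : measurableTypeR R -> \bar R) : (0 < q)%N ->
  measurable_fun setT G -> (forall s, 0 <= G s)%E ->
  (\int[lebp q.+1]_x (G ((x : 'cV[R]_q.+1) 0 0 / enorm (x : 'cV[R]_q.+1))%R *
      (\1_(@punctured_ball q.+1) x)%:E) =
   polar_const q * \int[mu]_(s in `](-1)%R, 1%R[) (G s * ((1 - s ^+ 2) `^ ((q%:R - 2) / 2))%:E))%E.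
Proof.
move=> q0 mG G0; have mF := @measurable_G_ball q G mG.
set F := (X in measurable_fun _ X) in mF.
have F0 x : (0 <= F x)%E by rewrite mule_ge0// lee_fin.
have mFc : measurable_fun setT (fun tv : measurableTypeR R * borel 'cV[R]_q =>
    F (col_mx (tv.1%:M : 'cV[R]_1) (tv.2 : 'cV[R]_q))).
  exact: (measurableT_comp mF (@measurable_col_mx R q)).
rewrite ge0_integral_lebpS; [|exact: mF|exact: F0].
rewrite (fubini_tonelli _ mFc); last by move=> tv; exact: F0.
have mI := measurable_fun_fubini_tonelli_G (m1 := mu) _ mFc (fun tv => F0 _).
have m0 := @measurable_set0cV q.
(* The substitution needs v nonzero; the single point v = 0 is negligible because q > 0. *)
rewrite (ge0_negligible_integral m0 measurableT mI _ (lebp_set0 q0)); last first.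
  by move=> v _; apply: integral_ge0 => t _; exact: F0.
pose K (vs : borel 'cV[R]_q * measurableTypeR R) : \bar R :=
  (G vs.2 * ((enorm (vs.1 : 'cV[R]_q) <= Num.sqrt (1 - vs.2 ^+ 2))%R%:R)%:E *
      (enorm (vs.1 : 'cV[R]_q) * (1 - vs.2 ^+ 2) `^ (- 2^-1 - 1))%:E *
      (\1_(`]-1, 1[%classic : set R) vs.2)%:E)%E.
have K0 vs : (0 <= K vs)%E.
  by rewrite !mule_ge0// lee_fin ?mulr_ge0 ?enorm_ge0 ?powR_ge0.
have mn : measurable_fun setT (fun vs : borel 'cV[R]_q * measurableTypeR R =>
    enorm (vs.1 : 'cV[R]_q)).
  exact: (measurableT_comp (@measurable_enormT q) measurable_fst).
have ms : measurable_fun setT (fun vs : borel 'cV[R]_q * measurableTypeR R =>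
    1 - vs.2 ^+ 2 : R).
  by apply: measurable_funB => //; apply: measurable_funX; exact: measurable_snd.
have mK : measurable_fun setT K.
  apply: emeasurable_funM; last first.
    have mi : @measurable_fun _ _ (measurableTypeR R) R setT
        (fun s => \1_(`]-1, 1[%classic : set R) s) by exact: measurable_indic.
    by apply/measurable_EFinP; exact: (measurableT_comp mi measurable_snd).
  apply: emeasurable_funM.
    apply: emeasurable_funM; first exact: (measurableT_comp mG measurable_snd).
    apply/measurable_EFinP; apply: (measurableT_comp (f := fun b : bool => b%:R : R)) => //.
    apply: measurable_fun_ler => //.
    apply: (measurableT_comp (f := @Num.sqrt R)) => //.
    by apply: continuous_measurable_fun; exact: sqrt_continuous.
  apply/measurable_EFinP; apply: measurable_funM => //.
  exact: (measurableT_comp (measurable_powR _)).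
transitivity (\int[lebp q]_v \int[mu]_s K (v, s))%E.
  have mIK := measurable_fun_fubini_tonelli_F (m2 := mu) _ mK K0.
  rewrite [RHS](ge0_negligible_integral m0 measurableT mIK _ (lebp_set0 q0)); last first.
    by move=> v _; apply: integral_ge0 => s _; exact: K0.
  apply: eq_integral => v; rewrite inE => -[_ /= /eqP v0].
  transitivity (\int[mu]_t (G (t / enorm (col_mx (t%:M : 'cV[R]_1) v : 'cV[R]_q.+1))%R *
      (\1_(@punctured_ball q.+1) (col_mx (t%:M : 'cV[R]_1) v))%:E))%E.
    by apply: eq_integral => t _; congr (G (_ / _)%R * _)%E; exact: cons_mx0.
  rewrite [LHS](inner v0 mG G0) integral_mkcond; apply: eq_integral => s _.
  rewrite patchE /K/= indicE; case: ifPn => _; first by rewrite mule1.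
  by rewrite mule0.
rewrite (fubini_tonelli _ mK K0) [in RHS]integral_mkcond.
rewrite -[RHS]ge0_integralZl.
- apply: eq_integral => s _; rewrite patchE /K /= indicE; case: ifPn => s1; last first.
    by rewrite mule0; apply: integral0_eq => v _; rewrite mule0.
  move: s1; rewrite inE/= in_itv/= => s1.
  have k0 : 0 < 1 - s ^+ 2 by move: s1 => /andP[]; nra.
  have k1 : 0 < Num.sqrt (1 - s ^+ 2) by rewrite sqrtr_gt0.
  transitivity (\int[lebp q]_v (G s * ((1 - s ^+ 2) `^ (- 2^-1 - 1))%:E *
      (enorm (v : 'cV[R]_q) * (enorm (v : 'cV[R]_q) <= Num.sqrt (1 - s ^+ 2))%R%:R)%:E))%E.
    apply: eq_integral => v _; rewrite mule1 -!muleA -!EFinM.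
    by congr (_ * _%:E)%E; ring.
  have mc : measurable_fun setT (fun v : borel 'cV[R]_q => (enorm (v : 'cV[R]_q) *
      (enorm (v : 'cV[R]_q) <= Num.sqrt (1 - s ^+ 2))%R%:R)%:E).
    apply/measurable_EFinP; apply: measurable_funM; first exact: measurable_enormT.
    apply: (measurableT_comp (f := fun b : bool => b%:R : R)) => //.
    by apply: measurable_fun_ler => //; exact: measurable_enormT.
  rewrite ge0_integralZl; [|done|exact: mc| |].
  + rewrite scaled_C// -muleA [RHS]muleC -!muleA; congr (_ * _)%E.
    rewrite muleA -EFinM; congr (_%:E * _)%E.
    have -> : Num.sqrt (1 - s ^+ 2) ^+ q.+1 = (1 - s ^+ 2) `^ (2^-1 * q.+1%:R).
      by rewrite powRrM powR_mulrn ?powR_ge0// powR12_sqrt// ltW.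
    rewrite -powRD.
      by congr (_ `^ _); rewrite -natr1; field.
    by apply/implyP => _; rewrite gt_eqF.
  + by move=> v _; rewrite lee_fin mulr_ge0 ?enorm_ge0.
  + by rewrite mule_ge0// lee_fin powR_ge0.
- done.
- apply: (iffLR (measurable_restrictT _ (measurable_itv _))).
  apply: measurable_funTS; apply: emeasurable_funM => //; apply/measurable_EFinP.
  apply: (measurableT_comp (measurable_powR _)).
  by apply: measurable_funB => //; exact: measurable_funX.
- by move=> s _; rewrite patchE; case: ifPn => // _; rewrite mule_ge0// lee_fin powR_ge0.
- by apply: integral_ge0 => v _; rewrite lee_fin mulr_ge0 ?enorm_ge0.
Qed.

End polar.

(** * Two-sided bounds for Laplace integrals *)

Section laplace_integral.
Context {R : realType}.
Local Notation mu := (@lebesgue_measure R).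
Implicit Types (a t s x eta zeta : R).

(** Trades the exponential for a power of 1 + x, whose integrals against powers have closed
    primitives. Up to a factorial, e^(1 + x) dominates the integer power (1 + x)^(m + 1), with m + 1
    at least b. *)
Lemma expRN_powR_bound (b : R) : exists2 C : R, 0 < C &
  forall x, 0 <= x -> expR (- x) <= C * (1 + x) `^ (- b).
Proof.
pose m := Num.bound `|b|.
exists (m.+1`!%:R * expR 1) => [|x x0].
  by rewrite mulr_gt0// ltr0n fact_gt0.
have bm : b <= m.+1%:R.
  rewrite (le_trans (ler_norm _))// ltW// (lt_trans (archi_boundP _))//.
  by rewrite ltr_nat.
have y1 : 1 <= 1 + x by rewrite lerDl.
have y0 : 0 < 1 + x by rewrite ltr_wpDr.
rewrite powRN ler_pdivlMr ?powR_gt0// expRN mulrC ler_pdivrMr ?expR_gt0//.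
rewrite -mulrA -expRD.
apply: (le_trans (ler_powR y1 bm)); rewrite powR_mulrn ?(ltW y0)//.
have := @expR_ge1Dxn R (1 + x) m (ltW y0) => h.
rewrite mulrC -ler_pdivrMr ?ltr0n ?fact_gt0//.
by rewrite (le_trans _ h)// lerDr.
Qed.

(** The exponent may have either sign: x^eta is monotone in one direction or the other, so its
    extremes are at the ends. *)
Lemma powR_itv_bounds (eta l u x : R) : 0 < l -> l <= x <= u ->
  Num.min (l `^ eta) (u `^ eta) <= x `^ eta <= Num.max (l `^ eta) (u `^ eta).
Proof.
move=> l0 /andP[lx xu].
have x0 := lt_le_trans l0 lx; have u0 := lt_le_trans x0 xu.
have mono (y z : R) : 0 < y -> y <= z -> 0 <= eta -> y `^ eta <= z `^ eta.
  by move=> y0 yz e0; apply: ge0_ler_powR => //; rewrite nnegrE ltW// (lt_le_trans y0).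
have anti (y z : R) : 0 < y -> y <= z -> eta <= 0 -> z `^ eta <= y `^ eta.
  move=> y0 yz e0; have z0 := lt_le_trans y0 yz.
  rewrite -[eta]opprK !(powRN _ (- eta)) lef_pV2 ?posrE ?powR_gt0//.
  by apply: ge0_ler_powR; rewrite ?oppr_ge0// nnegrE ltW.
have [e0|/ltW e0] := leP 0 eta.
  by rewrite ge_min le_max mono// (mono x u)// orbT.
by rewrite ge_min le_max (anti l x)// (anti x u)// orbT.
Qed.

(** The exponent -eta - 2 is chosen for the sake of the primitive (t / (1 + a t))^(eta + 1) / (eta +
    1). For eta < 0 the integrand is singular at 0, whence the exhaustion by the intervals [D n]. *)
Lemma integral_powR_le eta a : -1 < eta -> 0 <= a ->
  (\int[mu]_(t in `]0%R, 1%R]) (t `^ eta * (1 + a * t) `^ (- eta - 2))%:E <=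
   ((1 + a) `^ (- (eta + 1)) / (eta + 1))%:E)%E.
Proof.
move=> eta1 a0; have e0 : 0 < eta + 1 by lra.
pose f t := t `^ eta * (1 + a * t) `^ (- eta - 2).
pose F t := (t / (1 + a * t)) `^ (eta + 1) / (eta + 1).
have f0 t : 0 <= f t by rewrite mulr_ge0 ?powR_ge0.
have F0 t : 0 <= F t by rewrite divr_ge0 ?powR_ge0// ltW.
have mf : measurable_fun setT f.
  apply: measurable_funM; first exact: measurable_powR.
  apply: (measurableT_comp (measurable_powR _)).
  by apply: measurable_funD => //; exact: measurable_funM.
have y0 t : 0 < t -> 0 < 1 + a * t.
  by move=> t0; rewrite ltr_pwDl// mulr_ge0// ltW.
have dF t : 0 < t -> is_derive t (1 : R) F (f t).
  move=> t0; have yt := y0 _ t0.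
  have dq : is_derive t (1 : R) (fun t => t / (1 + a * t)) ((1 + a * t) ^- 2).
    have dl : is_derive t (1 : R) (fun t => 1 + a * t) a.
      by apply: is_derive_eq; rewrite /GRing.scale/=; ring.
    have yn : (fun t => 1 + a * t) t != 0 by rewrite gt_eqF.
    have dV := @is_deriveV R (fun t => 1 + a * t) t a 1 yn dl.
    apply: (is_derive_eq (is_deriveM (is_derive_id t (1 : R)) dV)).
    by rewrite /GRing.scale/=; field; rewrite gt_eqF.
  have q0 : 0 < t / (1 + a * t) by rewrite divr_gt0.
  have dc := @is_derive1_powR R (eta + 1) _ q0.
  have dd := @is_derive1_comp R (fun s => s `^ (eta + 1)) _ t _ _ dc dq.
  apply: (is_derive_eq (is_deriveM dd (is_derive_cst ((eta + 1)^-1) t (1 : R)))).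
  rewrite /GRing.scale/= mulr0 add0r addrK /f.
  rewrite powRM ?invr_ge0 ?ltW// (_ : (1 + a * t)^-1 = (1 + a * t) `^ (-1)); last first.
    by rewrite powR_inv1// ltW.
  rewrite -powRrM (_ : (1 + a * t) ^- 2 = (1 + a * t) `^ (- 2%:R)); last first.
    by rewrite powR_invn// ltW.
  have -> : - eta - 2 = -1 * eta - 2%:R by ring.
  rewrite powRD; last by apply/implyP => _; rewrite gt_eqF.
  by field; rewrite gt_eqF.
have cf t : 0 < t -> {for t, continuous f}.
  move=> t0; have yt := y0 _ t0.
  have dl : is_derive t (1 : R) (fun t => 1 + a * t) a.
    by apply: is_derive_eq; rewrite /GRing.scale/=; ring.
  have dc := @is_derive1_powR R (- eta - 2) _ yt.
  have dd := @is_derive1_comp R (fun s => s `^ (- eta - 2)) _ t _ _ dc dl.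
  have d1 := @is_derive1_powR R eta _ t0.
  by apply: differentiable_continuous; apply/derivable1_diffP; case: (is_deriveM d1 dd).
pose D n : set R := `[n.+2%:R^-1, 1]%classic.
have nV n : (0 < n.+2%:R^-1 :> R) && (n.+2%:R^-1 < 1 :> R).
  by rewrite invr_gt0 ltr0n/= invf_lt1// ltr1n.
have -> : `]0%R, 1%R]%classic = \bigcup_n D n.
  apply/seteqP; split => [t|t [n _]]; rewrite /D /= in_itv/=; last first.
    by case/andP=> nt t1; rewrite in_itv/= t1 andbT (lt_le_trans _ nt)//; case/andP: (nV n).
  move=> /andP[t0 t1]; have [k _ /(_ k (leqnn k))/= kt] := near_infty_natSinv_lt (PosNum t0).
  exists k => //; rewrite /D /= in_itv/= t1 andbT ltW// (lt_trans _ kt)//.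
  by rewrite ltf_pV2 ?posrE// ltr_nat.
have ndD : nondecreasing_seq D.
  move=> m n mn; apply/subsetPset => t; rewrite /D /= !in_itv/= => /andP[h ->].
  by rewrite andbT (le_trans _ h)// lef_pV2 ?posrE// ler_nat.
have cv := @ge0_nondecreasing_set_cvg_integral _ (measurableTypeR R) R D
  (EFin \o f) mu ndD (fun=> measurable_itv _).
have mEf : measurable_fun setT (EFin \o f) by exact/measurable_EFinP.
have {}cv := cv (fun i => measurable_funTS mEf).
have f0' i (x : measurableTypeR R) : D i x -> (0 <= (EFin \o f) x)%E by rewrite lee_fin.
have {}cv := cv f0'.
apply: cvge_le cv.
near=> n; rewrite /D /=.
have /andP[n0 n1] := nV n.
have dFn x : n.+2%:R^-1 <= x <= 1 -> is_derive x (1 : R) F (f x).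
  by move=> /andP[nx _]; apply: dF; exact: lt_le_trans nx.
have cfn x : n.+2%:R^-1 <= x <= 1 -> {for x, continuous f}.
  by move=> /andP[nx _]; apply: cf; exact: lt_le_trans nx.
rewrite (FTC_is_derive n1 dFn cfn) lee_fin (le_trans (_ : _ <= F 1)) ?gerBl//.
rewrite /F mulr1 div1r -(@powR_inv1 _ (1 + a)) ?addr_ge0//.
by rewrite -powRrM mulN1r.
Unshelve. all: by end_near. Qed.

Definition weight eta zeta (s : R) : R := (1 - s) `^ eta * (1 + s) `^ zeta.

Lemma measurable_weight eta zeta : measurable_fun setT (weight eta zeta).
Proof.
apply: measurable_funM; apply: (measurableT_comp (measurable_powR _)).
  exact: measurable_funB.
exact: measurable_funD.
Qed.

Lemma weight_ge0 eta zeta s : 0 <= weight eta zeta s.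
Proof. by rewrite mulr_ge0 ?powR_ge0. Qed.

(** Only the window where (1 - s) a lies in [1/2, 1] is kept. Its length is 1/(2 a), it avoids the
    singularity at s = 1, and on it the exponential and (1 + s)^zeta are bounded below while (1 -
    s)^eta is of order a^(-eta). *)
Lemma laplace_ge eta zeta : exists2 c : R, 0 < c & forall a, 1 <= a ->
  ((c / a `^ (eta + 1))%:E <=
   \int[mu]_(s in `[(-1)%R, 1%R]) (weight eta zeta s * expR ((s - 1) * a))%:E)%E.
Proof.
pose c1 := Num.min ((2^-1) `^ eta) (1 `^ eta).
pose c2 := Num.min (1 `^ zeta) (2 `^ zeta).
have c10 : 0 < c1 by rewrite lt_min !powR_gt0.
have c20 : 0 < c2 by rewrite lt_min !powR_gt0.
exists (c1 * c2 * expR (-1) / 2) => [|a a1].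
  by rewrite divr_gt0// !mulr_gt0// expR_gt0.
have a0 : 0 < a by exact: lt_le_trans a1.
have aV : 0 < a^-1 by rewrite invr_gt0.
have aV1 : a^-1 <= 1 by rewrite invf_le1.
have ab : 1 - a^-1 < 1 - a^-1 / 2 by lra.
apply: (@le_trans _ _ (\int[mu]_(s in `[(1 - a^-1)%R, (1 - a^-1 / 2)%R])
    (c1 * c2 * expR (-1) * a `^ (- eta))%:E)%E).
  rewrite integral_cst//= lebesgue_measure_itv/= lte_fin ab -EFinB -EFinM lee_fin.
  rewrite (_ : 1 - a^-1 / 2 - (1 - a^-1) = a^-1 / 2); last by lra.
  rewrite -powRN opprD powRD; last by apply/implyP => _; rewrite gt_eqF.
  rewrite powR_inv1 ?(ltW a0)//.
  by rewrite le_eqVlt; apply/orP; left; apply/eqP; field; rewrite gt_eqF.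
have mw : measurable_fun setT (fun s => (weight eta zeta s * expR ((s - 1) * a))%:E).
  apply/measurable_EFinP; apply: measurable_funM; first exact: measurable_weight.
  apply: (measurableT_comp (@measurable_expR R)).
  by apply: measurable_funM => //; exact: measurable_funB.
apply: (@le_trans _ _ (\int[mu]_(s in `[(1 - a^-1)%R, (1 - a^-1 / 2)%R])
    (weight eta zeta s * expR ((s - 1) * a))%:E)%E); last first.
  apply: ge0_subset_integral => //.
  - exact: measurable_funTS.
  - by move=> s _; rewrite lee_fin mulr_ge0 ?weight_ge0 ?expR_ge0.
  - by move=> s /=; rewrite !in_itv/= => /andP[h1 h2]; apply/andP; split; lra.
apply: ge0_le_integral => //.
- by move=> s _; rewrite lee_fin !mulr_ge0 ?powR_ge0 ?expR_ge0// ltW.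
- exact: measurable_funTS.
move=> s /=; rewrite in_itv/= => /andP[h1 h2]; rewrite lee_fin.
rewrite (_ : c1 * c2 * expR (-1) * a `^ (- eta) = (c1 * a `^ (- eta)) * c2 * expR (-1)); last by ring.
have ws : 2^-1 <= (1 - s) * a <= 1.
  have aa : a^-1 * a = 1 by rewrite mulVf ?gt_eqF.
  by apply/andP; split; nra.
have e1 : c1 * a `^ (- eta) <= (1 - s) `^ eta.
  have -> : (1 - s) `^ eta = ((1 - s) * a) `^ eta * a `^ (- eta).
    rewrite powRM ?(ltW a0)//; last by lra.
    by rewrite powRN mulfK// gt_eqF// powR_gt0.
  rewrite ler_pM2r ?powR_gt0//.
  by have /andP[] := @powR_itv_bounds eta 2^-1 1 ((1 - s) * a) (ltac:(lra)) ws.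
have e2 : c2 <= (1 + s) `^ zeta.
  have s12 : 1 <= 1 + s <= 2 by apply/andP; split; lra.
  by have /andP[] := @powR_itv_bounds zeta 1 2 (1 + s) ltr01 s12.
have e3 : expR (-1) <= expR ((s - 1) * a).
  rewrite ler_expR (_ : (s - 1) * a = - ((1 - s) * a)); last by ring.
  by rewrite lerN2; case/andP: ws.
rewrite ler_pM ?mulr_ge0 ?powR_ge0 ?expR_ge0 ?(ltW c10) ?(ltW c20)//.
by rewrite ler_pM ?mulr_ge0 ?powR_ge0 ?(ltW c10) ?(ltW c20).
Qed.

Let one_side (eta a : R) (t : measurableTypeR R) : \bar R :=
  (t `^ eta * expR (- (a * t)) * \1_(`]0, 1]%classic : set R) t)%:E.

Let measurable_one_side eta a : measurable_fun setT (one_side eta a).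
Proof.
apply/measurable_EFinP; apply: measurable_funM => //.
apply: measurable_funM; first exact: measurable_powR.
apply: (measurableT_comp (@measurable_expR R)).
by apply: measurable_funN; exact: measurable_funM.
Qed.

Let one_side_ge0 eta a t : (0 <= one_side eta a t)%E.
Proof. by rewrite lee_fin !mulr_ge0 ?powR_ge0 ?expR_ge0. Qed.

Let integral_one_side eta : -1 < eta -> exists2 C : R, 0 < C & forall a, 0 <= a ->
  (\int[mu]_t one_side eta a t <= (C * (1 + a) `^ (- (eta + 1)))%:E)%E.
Proof.
move=> eta1; have e0 : 0 < eta + 1 by lra.
have [C C0 CE] := expRN_powR_bound (eta + 2).
exists (C / (eta + 1)) => [|a a0]; first by rewrite divr_gt0.
have mB : measurable_fun setT (fun t => (t `^ eta * (1 + a * t) `^ (- eta - 2))%:E).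
  apply/measurable_EFinP; apply: measurable_funM; first exact: measurable_powR.
  apply: (measurableT_comp (measurable_powR _)).
  by apply: measurable_funD => //; exact: measurable_funM.
have B0 t : (0 <= (t `^ eta * (1 + a * t) `^ (- eta - 2))%:E)%E.
  by rewrite lee_fin mulr_ge0 ?powR_ge0.
apply: (@le_trans _ _ (\int[mu]_(t in `]0%R, 1%R])
    (C%:E * (t `^ eta * (1 + a * t) `^ (- eta - 2))%:E))%E).
  rewrite [leRHS]integral_mkcond; apply: ge0_le_integral => //.
  - apply: (iffLR (measurable_restrictT _ (measurable_itv _))).
    apply: measurable_funTS; apply: emeasurable_funM; [exact: measurable_cst|exact: mB].
  - move=> t _; rewrite /one_side patchE indicE; case: ifPn => t01; last by rewrite mulr0.
    move: t01; rewrite inE/= in_itv/= => /andP[t0 t1].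
    rewrite mulr1 -EFinM lee_fin mulrCA ler_pM2l ?powR_gt0//.
    have := CE (a * t); rewrite mulr_ge0 ?(ltW t0)// => /(_ isT).
    by rewrite opprD.
rewrite ge0_integralZl//; last 2 first.
- exact: measurable_funTS.
- by rewrite lee_fin ltW.
apply: (@le_trans _ _ (C%:E * ((1 + a) `^ (- (eta + 1)) / (eta + 1))%:E)%E).
  by apply: lee_wpmul2l; [rewrite lee_fin ltW|exact: integral_powR_le].
rewrite -EFinM lee_fin le_eqVlt; apply/orP; left; apply/eqP; ring.
Qed.

(** The two possibly singular factors are separated at s = 0: for s >= 0 the factor (1 + s)^zeta is
    bounded; for s < 0 the factor (1 - s)^eta is, and there the exponential is at most e^(-a). *)
Let weight_split eta zeta : exists2 M : R, 0 < M & forall a s, 0 <= a -> -1 < s < 1 ->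
  ((weight eta zeta s * expR ((s - 1) * a))%:E <=
   M%:E * one_side eta a (1 - s)%R + (M * expR (- a))%:E * one_side zeta 0 (1 + s)%R)%E.
Proof.
pose m1 := Num.max (1 `^ eta) (2 `^ eta).
pose m2 := Num.max (1 `^ zeta) (2 `^ zeta).
have m10 : 0 < m1 by rewrite lt_max powR_gt0.
have m20 : 0 < m2 by rewrite lt_max powR_gt0.
exists (Num.max m1 m2) => [|a s a0 /andP[s0 s1]]; first by rewrite lt_max m10.
have M0 : 0 < Num.max m1 m2 by rewrite lt_max m10.
have eE : (s - 1) * a = - (a * (1 - s)) by ring.
have [sp|sn] := leP 0 s.
  apply: le_trans (leeDl _ _); last first.
    by rewrite mule_ge0// lee_fin mulr_ge0 ?expR_ge0// ltW.
  rewrite /one_side indicE mem_set/= ?in_itv/=; last by apply/andP; split; lra.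
  rewrite mulr1 -EFinM lee_fin /weight eE mulrAC mulrC ler_wpM2r//.
    by rewrite mulr_ge0 ?powR_ge0 ?expR_ge0.
  have /andP[_ h] := @powR_itv_bounds zeta 1 2 (1 + s) ltr01 (ltac:(apply/andP; split; lra)).
  by rewrite (le_trans h)// le_max lexx orbT.
apply: le_trans (leeDr _ _); last by rewrite mule_ge0// lee_fin ltW.
rewrite /one_side indicE mem_set/= ?in_itv/=; last by apply/andP; split; lra.
rewrite mulr1 -EFinM lee_fin mul0r oppr0 expR0 mulr1 /weight eE.
rewrite mulrAC ler_wpM2r ?powR_ge0// ler_pM ?powR_ge0 ?expR_ge0//.
  have /andP[_ h] := @powR_itv_bounds eta 1 2 (1 - s) ltr01 (ltac:(apply/andP; split; lra)).
  by rewrite (le_trans h)// le_max lexx.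
by rewrite ler_expR lerN2 ler_peMr//; lra.
Qed.

(** The half s >= 0 gives the main order; the other half carries the factor e^(-a), which is
    absorbed into a power of a. *)
Lemma laplace_le eta zeta : -1 < eta -> -1 < zeta -> exists2 c : R, 0 < c &
  forall a, 1 <= a ->
  (\int[mu]_(s in `[(-1)%R, 1%R]) (weight eta zeta s * expR ((s - 1) * a))%:E <=
   (c / a `^ (eta + 1))%:E)%E.
Proof.
move=> eta1 zeta1.
have [M M0 MH] := weight_split eta zeta.
have [A A0 AH] := integral_one_side eta1.
have [B B0 BH] := integral_one_side zeta1.
have [C C0 CH] := expRN_powR_bound (eta + 1).
exists (M * A + M * C * B) => [|a a1].
  by rewrite addr_gt0// !mulr_gt0.
have a0 : 0 < a by exact: lt_le_trans a1.
have ge0 : 0 <= eta + 1 by lra.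
have pa : (1 + a) `^ (- (eta + 1)) <= (a `^ (eta + 1))^-1.
  rewrite powRN lef_pV2 ?posrE ?powR_gt0 ?addr_gt0//.
  by apply: ge0_ler_powR => //; rewrite ?nnegrE; lra.
have m1 : measurable_fun setT (fun s : measurableTypeR R => one_side eta a (1 - s)%R).
  apply: (measurableT_comp (measurable_one_side _ _)); exact: measurable_funB.
have m2 : measurable_fun setT (fun s : measurableTypeR R => one_side zeta 0 (1 + s)%R).
  apply: (measurableT_comp (measurable_one_side _ _)); exact: measurable_funD.
have mw : measurable_fun setT (fun s => (weight eta zeta s * expR ((s - 1) * a))%:E).
  apply/measurable_EFinP; apply: measurable_funM; first exact: measurable_weight.
  apply: (measurableT_comp (@measurable_expR R)).
  by apply: measurable_funM => //; exact: measurable_funB.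
have i1 : (\int[mu]_s one_side eta a (1 - s)%R = \int[mu]_t one_side eta a t)%E.
  have mo : measurable_fun setT (fun t : measurableTypeR R => one_side eta a (- t)%R).
    by apply: (measurableT_comp (measurable_one_side _ _)); exact: measurable_funN.
  rewrite -(ge0_integral_lebesgue_opp (measurable_one_side _ _))//.
  rewrite -(ge0_integral_lebesgue_shift (-1) mo)//.
  by apply: eq_integral => s _; congr one_side; ring.
have i2 : (\int[mu]_s one_side zeta 0 (1 + s)%R = \int[mu]_t one_side zeta 0 t)%E.
  rewrite -(ge0_integral_lebesgue_shift 1 (measurable_one_side _ _))//.
  by apply: eq_integral => s _; rewrite addrC.
have Me0 : 0 <= M * expR (- a) by rewrite mulr_ge0 ?expR_ge0// ltW.
apply: (@le_trans _ _ (\int[mu]_s (M%:E * one_side eta a (1 - s)%R +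
    (M * expR (- a))%:E * one_side zeta 0 (1 + s)%R))%E).
  rewrite (@integral_itv_bndoo _ (-1) 1 _ true false); last exact: measurable_funTS.
  rewrite integral_mkcond; apply: ge0_le_integral => //.
  - by move=> s _; rewrite patchE; case: ifPn => // _; rewrite lee_fin mulr_ge0 ?weight_ge0 ?expR_ge0.
  - apply: (iffLR (measurable_restrictT _ (measurable_itv _))).
    exact: measurable_funTS.
  - by apply: emeasurable_funD; apply: emeasurable_funM.
  - move=> s _; rewrite patchE; case: ifPn => s01.
      by apply: MH; [exact: ltW|move: s01; rewrite inE/= in_itv].
    by rewrite adde_ge0// mule_ge0// lee_fin ltW.
rewrite ge0_integralD//; last 4 first.
- by move=> s _; rewrite mule_ge0// lee_fin ltW.
- by apply: emeasurable_funM.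
- by move=> s _; rewrite mule_ge0// lee_fin ltW.
- by apply: emeasurable_funM.
rewrite !ge0_integralZlT//; last by rewrite ltW.
rewrite i1 i2 mulrDl EFinD; apply: leeD.
  rewrite -mulrA EFinM; apply: lee_wpmul2l; first by rewrite lee_fin ltW.
  apply: le_trans (AH a (ltW a0)) _; rewrite lee_fin ler_pM2l//.
rewrite (_ : M * C * B / _ = (M * (C / a `^ (eta + 1))) * B); last by ring.
rewrite [leRHS]EFinM; apply: lee_pmul => //.
- by apply: integral_ge0.
- rewrite lee_fin ler_pM2l//; apply: le_trans (CH a (ltW a0)) _.
  by rewrite ler_pM2l.
- by have := BH 0 (lexx _); rewrite addr0 powR1 mulr1.
Qed.

End laplace_integral.

(** * Moments of the weight given by a function of the class *)

Section class_F_moments.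
Context {R : realType} (f : R -> R) (Ff : class_F f).
Local Notation mu := (@lebesgue_measure R).

Lemma class_F_ge0 x : 0 <= f x.
Proof. by case: Ff => h *; exact: h. Qed.

Lemma class_F_homo : {homo f : x y / x <= y}.
Proof.
case: Ff => f0 [fn fp] _ _ _ x y xy.
have fp' : {in `[0, +oo[ &, {homo f : x y / x <= y}}.
  by move=> s t s0 t0; rewrite le_eqVlt => /predU1P[->//|st]; rewrite ltW// fp.
have [y0|/ltW y0] := leP y 0.
  by apply: fn => //; rewrite in_itv/= ?y0 ?(le_trans xy).
have [x0|/ltW x0] := leP x 0; last by apply: fp' => //; rewrite in_itv/= ?x0 ?y0.
apply: (@le_trans _ _ (f 0)); first by apply: fn => //; rewrite in_itv/= ?x0 ?lexx.
by apply: fp' => //; rewrite in_itv/= ?lexx ?y0.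
Qed.

Lemma measurable_class_F : measurable_fun setT f.
Proof. by apply: nondecreasing_measurable => //; exact: class_F_homo. Qed.

Lemma class_F_gt0 x : 0 < x -> 0 < f x.
Proof.
case: Ff => f0 [fn fp] _ _ _ x0; apply: le_lt_trans (f0 0) _.
by apply: fp; rewrite ?in_itv/= ?lexx ?(ltW x0).
Qed.

(** Covers f (k s) = 0 as well: the logarithm is then -oo and its exponential 0. *)
Let ratioE k s : 0 < k ->
  expeR (lne (f (k * s))%:E - lne (f k)%:E) = (f (k * s) / f k)%:E.
Proof.
move=> k0; have fk := class_F_gt0 k0; rewrite (lne_EFin fk).
have := class_F_ge0 (k * s); rewrite le_eqVlt => /predU1P[<-|fks].
  by rewrite le0_lneNy//= mul0r.
by rewrite lne_EFin//= expRB !lnK.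
Qed.

Let rate k : R := k * phi f k.
Definition moment eta zeta k : \bar R :=
  (\int[mu]_(s in `[(-1)%R, 1%R]) (weight eta zeta s * (f (k * s)%R / f k))%:E)%E.

Lemma rate_cvg : rate k @[k --> +oo] --> +oo.
Proof. by case: Ff => _ _ _ []. Qed.

(** Condition (iv) is applied with half of the lower Laplace constant as epsilon, so that the
    perturbation cannot destroy the lower bound. *)
Lemma moment_bounds eta zeta : -1 < eta -> -1 < zeta ->
  exists c : R * R, 0 < c.1 /\ \forall k \near +oo,
    ((c.1 / rate k `^ (eta + 1))%:E <= moment eta zeta k <=
     (c.2 / rate k `^ (eta + 1))%:E)%E.
Proof.
move=> eta1 zeta1.
have [c c0 cH] := laplace_ge eta zeta.
have [C C0 CH] := laplace_le eta1 zeta1.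
exists (c / 2, C + c / 2); split => /=; first by rewrite divr_gt0.
have cf : \forall k \near +oo, 1 <= rate k by have /cvgryPge := rate_cvg; exact.
have e0 : 0 < c / 2 by rewrite divr_gt0.
case: Ff => _ _ _ _ /(_ eta zeta eta1 zeta1 (c / 2) e0) E.
near=> k.
have k0 : 0 < k by near: k; exact: nbhs_pinfty_gt.
have a1 : 1 <= rate k by near: k; exact: cf.
have a0 : 0 < rate k by exact: lt_le_trans a1.
have fk := class_F_gt0 k0.
have : (\int[mu]_(s in `[(-1)%R, 1%R])
    (((1 - s) `^ eta * (1 + s) `^ zeta)%:E *
      `|expeR (lne (f (k * s))%:E - lne (f k)%:E) -
        (expR ((s - 1) * (k * phi f k)))%:E|) <=
      (c / 2 * (1 / (k * phi f k) `^ (eta + 1)))%:E)%E by near: k; exact: E.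
have -> : (\int[mu]_(s in `[(-1)%R, 1%R])
    (((1 - s) `^ eta * (1 + s) `^ zeta)%:E *
      `|expeR (lne (f (k * s))%:E - lne (f k)%:E) -
        (expR ((s - 1) * (k * phi f k)))%:E|) = \int[mu]_(s in `[(-1)%R, 1%R])
    (weight eta zeta s * `|f (k * s) / f k - expR ((s - 1) * rate k)|)%:E)%E.
  by apply: eq_integral => s _; rewrite ratioE// -EFinB abse_EFin -EFinM.
rewrite -/(rate k) mulrA mulr1.
have mw : measurable_fun setT (weight eta zeta) by exact: measurable_weight.
have me : measurable_fun setT (fun s : R => expR ((s - 1) * rate k)).
  apply: (measurableT_comp (@measurable_expR R)).
  by apply: measurable_funM => //; exact: measurable_funB.
have mr : measurable_fun setT (fun s : R => f (k * s) / f k).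
  apply: measurable_funM => //; apply: (measurableT_comp measurable_class_F).
  exact: measurable_funM.
have m1 : measurable_fun setT (fun s : R => (weight eta zeta s * (f (k * s) / f k))%:E).
  by apply/measurable_EFinP; apply: measurable_funM.
have m2 : measurable_fun setT (fun s : R => (weight eta zeta s * expR ((s - 1) * rate k))%:E).
  by apply/measurable_EFinP; apply: measurable_funM.
have m3 : measurable_fun setT (fun s : R => (weight eta zeta s *
    `|f (k * s) / f k - expR ((s - 1) * rate k)|)%:E).
  apply/measurable_EFinP; apply: measurable_funM => //.
  by apply: measurableT_comp => //; exact: measurable_funB.
have p1 s : (0 <= (weight eta zeta s * (f (k * s) / f k))%:E)%E.
  by rewrite lee_fin mulr_ge0 ?weight_ge0// divr_ge0 ?class_F_ge0.
have p2 s : (0 <= (weight eta zeta s * expR ((s - 1) * rate k))%:E)%E.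
  by rewrite lee_fin mulr_ge0 ?weight_ge0// expR_ge0.
have p3 s : (0 <= (weight eta zeta s *
    `|f (k * s) / f k - expR ((s - 1) * rate k)|)%:E)%E.
  by rewrite lee_fin mulr_ge0 ?weight_ge0.
(* The integrated triangle inequality is used in both directions: to bound the moment by the Laplace
   integral, and conversely. *)
have triangle (u v h : R -> R) : measurable_fun setT (fun s : R => (u s)%:E) ->
    measurable_fun setT (fun s : R => (v s)%:E) -> measurable_fun setT (fun s : R => (h s)%:E) ->
    (forall s, 0 <= u s) -> (forall s, 0 <= v s) -> (forall s, 0 <= h s) ->
    (forall s, u s <= v s + h s) ->
    (\int[mu]_(s in `[(-1)%R, 1%R]) (u s)%:E <= \int[mu]_(s in `[(-1)%R, 1%R]) (v s)%:E
      + \int[mu]_(s in `[(-1)%R, 1%R]) (h s)%:E)%E.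
  move=> mu' mv mh u0 v0 h0 uvh.
  rewrite -ge0_integralD//; last 4 first.
  - by move=> s _; rewrite lee_fin.
  - exact: measurable_funTS.
  - by move=> s _; rewrite lee_fin.
  - exact: measurable_funTS.
  apply: ge0_le_integral => //.
  - by move=> s _; rewrite lee_fin.
  - exact: measurable_funTS.
  - by apply: emeasurable_funD; exact: measurable_funTS.
  - by move=> s _; rewrite -EFinD lee_fin.
have t1 := triangle _ _ _ m1 m2 m3 p1 p2 p3.
have t2 := triangle _ _ _ m2 m1 m3 p2 p1 p3.
have {CH} := CH _ a1; have {cH} := cH _ a1; rewrite -/(moment _ _ _).
have {}t1 : (moment eta zeta k <= \int[mu]_(s in `[(-1)%R, 1%R])
        (weight eta zeta s * expR ((s - 1) * rate k))%:E +
     \int[mu]_(s in `[(-1)%R, 1%R])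
        (weight eta zeta s * `|f (k * s) / f k - expR ((s - 1) * rate k)|)%:E)%E.
  apply: t1 => s; rewrite -mulrDr ler_wpM2l ?weight_ge0//.
  by rewrite -lerBlDl ler_norm.
have {}t2 : (\int[mu]_(s in `[(-1)%R, 1%R])
        (weight eta zeta s * expR ((s - 1) * rate k))%:E <= moment eta zeta k +
     \int[mu]_(s in `[(-1)%R, 1%R])
        (weight eta zeta s * `|f (k * s) / f k - expR ((s - 1) * rate k)|)%:E)%E.
  apply: t2 => s; rewrite -mulrDr ler_wpM2l ?weight_ge0//.
  by rewrite -lerBlDl distrC ler_norm.
move=> lo up er; apply/andP; split.
  have := le_trans lo (le_trans t2 (leeD (lexx _) er)).
  rewrite -leeBlDr// -EFinB; apply: le_trans.
  by rewrite lee_fin le_eqVlt; apply/orP; left; apply/eqP; field; rewrite gt_eqF// powR_gt0.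
apply: le_trans t1 _.
by rewrite mulrDl EFinD; apply: leeD.
Unshelve. all: by end_near. Qed.

End class_F_moments.

(** * Expectations of bounded random variables *)

Section bounded_functions.
Context d (T : measurableType d) {R : realType}.
Implicit Types f g : T -> R.

(** The class in which expectations are computed: stable under sums and products, and integrable for
    every measure of mass 1, which disposes of integrability conditions. *)
Definition bmf f := measurable_fun setT f /\ exists M : R, forall x, `|f x| <= M.

Lemma bmf_cst (c : R) : bmf (fun _ : T => c).
Proof. by split => //; exists `|c|. Qed.

Lemma bmfD f g : bmf f -> bmf g -> bmf (fun x => f x + g x).
Proof.
move=> [mf [M fM]] [mg [N gN]]; split; first exact: measurable_funD.
by exists (M + N) => x; rewrite (le_trans (ler_normD _ _))// lerD.
Qed.

Lemma bmfM f g : bmf f -> bmf g -> bmf (fun x => f x * g x).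
Proof.
move=> [mf [M fM]] [mg [N gN]]; split; first exact: measurable_funM.
by exists (M * N) => x; rewrite normrM ler_pM.
Qed.

Lemma bmfN f : bmf f -> bmf (fun x => - f x).
Proof.
move=> [mf [M fM]]; split; first exact: measurable_funN.
by exists M => x; rewrite normrN.
Qed.

Lemma bmfB f g : bmf f -> bmf g -> bmf (fun x => f x - g x).
Proof. by move=> bf bg; apply: bmfD => //; exact: bmfN. Qed.

Lemma bmfZ (c : R) f : bmf f -> bmf (fun x => c * f x).
Proof. by move=> bf; apply: bmfM => //; exact: bmf_cst. Qed.

Lemma bmfX n f : bmf f -> bmf (fun x => f x ^+ n).
Proof.
move=> bf; elim: n => [|n IHn]; first exact: bmf_cst.
by under [X in bmf X]funext do rewrite exprS; exact: bmfM.
Qed.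

Lemma bmf_norm f : bmf f -> bmf (fun x => `|f x|).
Proof.
move=> [mf [M fM]]; split; first exact: measurableT_comp.
by exists M => x; rewrite normr_id.
Qed.

Lemma bmf_sum I (s : seq I) (P : pred I) (F : I -> T -> R) :
  (forall i, bmf (F i)) -> bmf (fun x => \sum_(i <- s | P i) F i x).
Proof.
move=> bF; elim: s => [|i s IHs].
  by under [X in bmf X]funext do rewrite big_nil; exact: bmf_cst.
under [X in bmf X]funext do rewrite big_cons.
by case: (P i) => //; exact: bmfD.
Qed.

Lemma bmf_prod I (s : seq I) (P : pred I) (F : I -> T -> R) :
  (forall i, bmf (F i)) -> bmf (fun x => \prod_(i <- s | P i) F i x).
Proof.
move=> bF; elim: s => [|i s IHs].
  by under [X in bmf X]funext do rewrite big_nil; exact: bmf_cst.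
under [X in bmf X]funext do rewrite big_cons.
by case: (P i) => //; exact: bmfM.
Qed.

Lemma bmf_cos f : measurable_fun setT f -> bmf (fun x => cos (f x)).
Proof.
move=> mf; split; last by exists 1 => x; rewrite cos_max.
by apply: measurableT_comp mf; apply: continuous_measurable_fun; exact: continuous_cos.
Qed.

Lemma bmf_sin f : measurable_fun setT f -> bmf (fun x => sin (f x)).
Proof.
move=> mf; split; last by exists 1 => x; rewrite sin_max.
by apply: measurableT_comp mf; apply: continuous_measurable_fun; exact: continuous_sin.
Qed.

Lemma bmf_indic (A : set T) : measurable A -> bmf (\1_A).
Proof.
move=> mA; split; first exact: measurable_indic.
by exists 1 => x; rewrite indicE; case: (_ \in _); rewrite ?normr1 ?normr0.
Qed.

(** Linear and quadratic functions are bounded on the sphere only; truncation makes them bounded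
    everywhere and leaves them unchanged where they are evaluated. *)
Definition clip (M : R) f x : R := Num.max (- M) (Num.min M (f x)).

Lemma bmf_clip (M : R) f : 0 <= M -> measurable_fun setT f -> bmf (clip M f).
Proof.
move=> M0 mf; split; first by apply: measurable_maxr => //; exact: measurable_minr.
exists M => x; rewrite ler_norml le_max lexx/= ge_max ge_min lexx/= andbT.
by rewrite (le_trans _ M0)// oppr_le0.
Qed.

Lemma clipE (M : R) f x : `|f x| <= M -> clip M f x = f x.
Proof.
by rewrite ler_norml /clip => /andP[h1 h2]; rewrite (min_idPr h2) (max_idPr h1).
Qed.

End bounded_functions.
Arguments bmf_cst {d T R}.

Lemma bmf_comp d (T : measurableType d) d' (T' : measurableType d') (R : realType)
  (g : T' -> R) (X : T -> T') : bmf g -> measurable_fun setT X -> bmf (fun w => g (X w)).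
Proof.
move=> [mg [M gM]] mX; split; first exact: (measurableT_comp mg mX).
by exists M.
Qed.

Section unit_mass.
Context d (T : measurableType d) {R : realType} (m : {measure set T -> \bar R}).
Hypothesis m1 : m setT = 1%E.
Implicit Types f g : T -> R.
Local Notation E f := (\int[m]_x f x)%R.

Lemma bmf_integrable f : bmf f -> m.-integrable setT (EFin \o f).
Proof.
move=> [mf [M fM]]; apply: (@le_integrable _ _ _ m _ measurableT _ (cst M%:E)).
- exact/measurable_EFinP.
- by move=> x _; rewrite /= lee_fin (le_trans (fM x))// ler_norm.
- apply/integrableP; split=> //.
  by rewrite integral_cst// m1 mule1 ltry.
Qed.

Lemma EFin_E f : bmf f -> (\int[m]_x (f x)%:E)%E = (E f)%:E.
Proof.
move=> bf; rewrite fineK//; apply: integrable_fin_num => //.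
exact: bmf_integrable.
Qed.

Lemma ED f g : bmf f -> bmf g -> \int[m]_x (f x + g x) = E f + E g.
Proof. by move=> bf bg; rewrite RintegralD//; exact: bmf_integrable. Qed.

Lemma EB f g : bmf f -> bmf g -> \int[m]_x (f x - g x) = E f - E g.
Proof. by move=> bf bg; rewrite RintegralB//; exact: bmf_integrable. Qed.

Lemma EZ c f : bmf f -> \int[m]_x (c * f x) = c * E f.
Proof. by move=> bf; rewrite RintegralZl//; exact: bmf_integrable. Qed.

Lemma Ecst (c : R) : \int[m]_x c = c.
Proof. by rewrite Rintegral_cst// m1 mulr1. Qed.

Lemma E_le f g : bmf f -> bmf g -> (forall x, f x <= g x) -> E f <= E g.
Proof. by move=> bf bg fg; apply: le_Rintegral => //; exact: bmf_integrable. Qed.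

Lemma E_ge0 f : (forall x, 0 <= f x) -> 0 <= E f.
Proof. by move=> f0; apply: Rintegral_ge0. Qed.

Lemma E_norm f : bmf f -> `|E f| <= \int[m]_x `|f x|.
Proof. by move=> bf; apply: le_normr_Rintegral => //; exact: bmf_integrable. Qed.

Lemma E_bound f (M : R) : bmf f -> (forall x, `|f x| <= M) -> `|E f| <= M.
Proof.
move=> bf fM; apply: (le_trans (E_norm bf)).
by rewrite -[leRHS]Ecst; apply: E_le => //; [exact: bmf_norm|exact: bmf_cst].
Qed.

Lemma E_sum I (s : seq I) (P : pred I) (F : I -> T -> R) : (forall i, bmf (F i)) ->
  \int[m]_x (\sum_(i <- s | P i) F i x) = \sum_(i <- s | P i) E (F i).
Proof.
move=> bF; elim: s => [|i s IHs].
  by under eq_Rintegral do rewrite big_nil; rewrite Ecst big_nil.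
under eq_Rintegral do rewrite big_cons; rewrite big_cons.
by case: (P i) => //; rewrite ED ?IHs//; exact: bmf_sum.
Qed.

Lemma E_eq f g : (forall x, f x = g x) -> E f = E g.
Proof. by move=> fg; apply: eq_Rintegral => x _. Qed.

Lemma E_indic (A : set T) : measurable A -> E (\1_A) = fine (m A).
Proof. by move=> mA; rewrite /Rintegral integral_indic// setIT. Qed.

End unit_mass.

Section bounded_partial_integral.
Context d1 d2 (T1 : measurableType d1) (T2 : measurableType d2) {R : realType}
  (m2 : {sigma_finite_measure set T2 -> \bar R}).
Hypothesis m21 : m2 setT = 1%E.

Lemma bmf_section1 (f : T1 * T2 -> R) x : bmf f -> bmf (fun y => f (x, y)).
Proof.
move=> [mf [M fM]]; split; last by exists M.
exact: (measurableT_comp mf (measurable_pair1 x)).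
Qed.

Lemma bmf_swap (f : T1 * T2 -> R) : bmf f -> bmf (fun z : T2 * T1 => f (z.2, z.1)).
Proof.
move=> [mf [M fM]]; split; last by exists M.
apply: (measurableT_comp mf).
by apply: measurable_fun_pair; [exact: measurable_snd|exact: measurable_fst].
Qed.

Lemma integral1D (f : T1 * T2 -> R) (M : R) x : bmf f ->
  (\int[m2]_y (f (x, y) + M)%:E = (\int[m2]_y f (x, y) + M)%:E)%E.
Proof.
move=> /(bmf_section1 x) bx; have bc := @bmf_cst _ T2 R M.
by rewrite (EFin_E m21 (bmfD bx bc)) (ED m21 bx bc) Ecst.
Qed.

(** Reduces bounded integrands to nonnegative ones, for which Tonelli applies; under a measure of
    mass 1 the added constant integrates to itself and is cancelled at the end. *)
Lemma bmf_shift_ge0 d (T : measurableType d) (f : T -> R) : bmf f ->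
  exists M : R, forall z, 0 <= f z + M.
Proof.
by move=> [mf [M fM]]; exists M => z; have := fM z; rewrite ler_norml => /andP[h _]; lra.
Qed.

Lemma bmf_integral1 (f : T1 * T2 -> R) : bmf f -> bmf (fun x => \int[m2]_y f (x, y)).
Proof.
move=> bf; have [mf [N fN]] := bf; split; last first.
  exists N => x; apply: E_bound => //; exact: bmf_section1.
have [M fM0] := bmf_shift_ge0 bf.
have mfM : measurable_fun setT (fun z => (f z + M)%:E).
  by apply/measurable_EFinP; apply: measurable_funD.
have h := @measurable_fun_fubini_tonelli_F _ _ _ _ R m2 _ mfM (fun z => fM0 z).
have {h}/measurable_EFinP h : measurable_fun setT (fun x => (\int[m2]_y f (x, y) + M)%:E).
  by apply: eq_measurable_fun h => x _; rewrite -integral1D.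
rewrite (_ : (fun _ => _) = (fun x => (\int[m2]_y f (x, y) + M) - M)).
  exact: measurable_funB.
by apply/funext => x; rewrite addrK.
Qed.

End bounded_partial_integral.

Section bounded_fubini.
Context d1 d2 (T1 : measurableType d1) (T2 : measurableType d2) {R : realType}
  (m1 : {sigma_finite_measure set T1 -> \bar R})
  (m2 : {sigma_finite_measure set T2 -> \bar R}).
Hypotheses (m11 : m1 setT = 1%E) (m21 : m2 setT = 1%E).

Lemma bounded_fubini (f : T1 * T2 -> R) : bmf f ->
  \int[m1]_x \int[m2]_y f (x, y) = \int[m2]_y \int[m1]_x f (x, y).
Proof.
move=> bf; have [M fM0] := bmf_shift_ge0 bf.
have mfM : measurable_fun setT (fun z => (f z + M)%:E).
  by apply/measurable_EFinP; apply: measurable_funD => //; case: bf.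
have := @fubini_tonelli _ _ _ _ R m1 m2 (fun z => (f z + M)%:E) mfM (fun z => fM0 z).
have bs := bmf_swap bf.
under eq_integral do rewrite (integral1D m21)//.
under [X in _ = X -> _]eq_integral do rewrite (integral1D m11 _ _ bs).
have b1 := bmf_integral1 m21 bf; have b2 := bmf_integral1 m11 bs.
rewrite /= in b2 *.
rewrite (EFin_E m11 (bmfD b1 (bmf_cst M))) (ED m11 b1 (bmf_cst M)).
rewrite (EFin_E m21 (bmfD b2 (bmf_cst M))) (ED m21 b2 (bmf_cst M)).
by rewrite (Ecst m11) (Ecst m21) => -[] /addIr.
Qed.

End bounded_fubini.

(** * Gaussian vectors *)

Lemma integral_mdensity d (T : measurableType d) (R : realType)
  (mu : {measure set T -> \bar R}) (h : T -> R) (mh : measurable_fun setT h)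
  (h0 : forall x, 0 <= h x) (F : T -> \bar R) : measurable_fun setT F ->
  (\int[density_measure mu mh h0]_x F x = \int[mu]_x (F x * (h x)%:E))%E.
Proof.
move=> mF; rewrite integralE [RHS]integralE.
rewrite !ge0_integral_mdensity//; last 2 first.
- exact: measurable_funeneg.
- exact: measurable_funepos.
congr (_ - _)%E; apply: eq_integral => x _.
  by rewrite !funeposE maxe_pMl ?lee_fin// mul0e.
by rewrite !funenegE -mulNe maxe_pMl ?lee_fin// mul0e.
Qed.

Section gaussian.
Context {R : realType}.
Local Notation mu := (@lebesgue_measure R).
Local Notation pdf := (@normal_pdf R 0 1).

Definition gauss : {sigma_finite_measure set (measurableTypeR R) -> \bar R} :=
  @normal_prob R 0 1.

Lemma gauss_setT : gauss setT = 1%E.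
Proof. exact: integral_normal_pdf. Qed.

Lemma integral_gauss (F : measurableTypeR R -> \bar R) : measurable_fun setT F ->
  (\int[gauss]_x F x = \int[mu]_x (F x * (pdf x)%:E))%E.
Proof.
move=> mF.
have mp : @measurable_fun _ _ (measurableTypeR R) R setT pdf by exact: measurable_normal_pdf.
have p0 (x : measurableTypeR R) : 0 <= pdf x by exact: normal_pdf_ge0.
exact: (integral_mdensity mu mp p0).
Qed.

Lemma normal_pdf01E x : pdf x = normal_peak 1 * expR (- x ^+ 2 / 2).
Proof. by rewrite normal_pdfE ?oner_eq0// /normal_fun subr0 expr1n. Qed.

Let peak_gt0 : 0 < normal_peak 1 :> R.
Proof. by apply: normal_peak_gt0; exact: oner_neq0. Qed.

Lemma integrable_gauss (f g : measurableTypeR R -> R) : measurable_fun setT f ->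
  (forall x, `|f x| <= g x) -> mu.-integrable setT (fun x => (g x * pdf x)%:E) ->
  gauss.-integrable setT (EFin \o f).
Proof.
move=> mf fg ig; apply/integrableP; split; first exact/measurable_EFinP.
rewrite integral_gauss; last by apply/measurable_EFinP; exact: measurableT_comp.
case/integrableP: ig => mg; apply: le_lt_trans; apply: ge0_le_integral => //.
- by move=> x _; rewrite lee_fin mulr_ge0// normal_pdf_ge0.
- apply/measurable_EFinP; apply: measurable_funM; last exact: measurable_normal_pdf.
  exact: measurableT_comp.
- exact: measurableT_comp.
move=> x _; rewrite /= lee_fin (le_trans _ (ler_norm _))// ler_wpM2r ?normal_pdf_ge0//.
Qed.

(** The Gaussian density of variance 2 dominates: c + |x| <= (c + 1) e^(x^2/4), and the e^(-x^2/4)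
    that remains is that density up to a constant. *)
Lemma integrable_gauss_affine (c : R) : 0 <= c ->
  mu.-integrable setT (fun x => ((c + `|x|) * pdf x)%:E).
Proof.
move=> c0.
have i2 := integrable_normal_pdf (0 : R) (Num.sqrt 2).
have s0 : Num.sqrt 2 != 0 :> R by rewrite gt_eqF// sqrtr_gt0.
pose K : R := (c + 1) * normal_peak 1 / normal_peak (Num.sqrt 2).
have p2 : 0 < normal_peak (Num.sqrt 2) :> R by exact: normal_peak_gt0.
have i3 : mu.-integrable setT (fun x => (K * normal_pdf 0 (Num.sqrt 2) x)%:E).
  under eq_fun do rewrite EFinM.
  exact: integrableZl.
apply: (le_integrable _ _ _ i3) => //.
  apply/measurable_EFinP; apply: measurable_funM; last exact: measurable_normal_pdf.
  by apply: measurable_funD => //; exact: measurableT_comp.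
move=> x _; rewrite /= lee_fin ger0_norm ?mulr_ge0 ?normal_pdf_ge0 ?addr_ge0//.
rewrite (le_trans _ (ler_norm _))// normal_pdf01E (normal_pdfE _ s0)/= /normal_fun subr0.
rewrite sqr_sqrtr// /K.
rewrite [leRHS](_ : _ = ((c + 1) * expR (- x ^+ 2 / (2 *+ 2))) * normal_peak 1); last first.
  by field; rewrite gt_eqF.
rewrite [leLHS](_ : _ = ((c + `|x|) * expR (- x ^+ 2 / 2)) * normal_peak 1); last by ring.
rewrite ler_pM2r//.
have -> : - x ^+ 2 / 2 = - (x ^+ 2 / 4) + - x ^+ 2 / (2 *+ 2) by rewrite -mulr_natl; field.
rewrite expRD mulrA ler_wpM2r ?expR_ge0//.
rewrite expRN ler_pdivrMr ?expR_gt0//.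
have h1 : 1 + x ^+ 2 / 4 <= expR (x ^+ 2 / 4) by exact: expR_ge1Dx.
have h2 : `|x| <= 1 + x ^+ 2 / 4 by have := sqr_ge0 (`|x| / 2 - 1); rewrite -(real_normK (num_real x)); nra.
have h3 : 0 <= `|x| by [].
by nra.
Qed.

(* Stein's identity, from which the characteristic function follows by solving
   the differential equation c' = - t c. *)
Let bound_n (n : nat) : pdf n%:R <= 2 * normal_peak 1 / n.+1%:R.
Proof.
rewrite normal_pdf01E mulrAC [leRHS]mulrC ler_pM2l// mulNr expRN.
have h1 : 1 + n%:R ^+ 2 / 2 <= expR (n%:R ^+ 2 / 2) :> R by exact: expR_ge1Dx.
rewrite ler_pdivlMr ?ltr0n// mulrC ler_pdivrMr ?expR_gt0//.
have : n.+1%:R = n%:R + 1 :> R by rewrite -natr1.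
by nra.
Qed.

Lemma gauss_stein (s : R) :
  (\int[gauss]_x ((s * cos (s * x) - x * sin (s * x))%R%:E) = 0)%E.
Proof.
pose k (x : R) := (s * cos (s * x) - x * sin (s * x)) * pdf x.
(* The integrand times the density is the derivative of [F], which vanishes at both infinities; the
   whole line is reached from the intervals [-(n + 1), n + 1] by dominated convergence. *)
pose F (x : R) := sin (s * x) * pdf x.
have sq (x : R) : is_derive x (1 : R) (fun x => s * x) s.
  by apply: is_derive_eq; rewrite /GRing.scale/=; ring.
have dF (x : R) : is_derive x (1 : R) F (k x).
  have d1 := @is_derive1_comp R (@sin R) _ x _ _ (is_derive_sin _) (sq x).
  have dp : is_derive x (1 : R) pdf (- x * pdf x).
    rewrite (_ : pdf = fun y => normal_peak 1 * expR (- y ^+ 2 / 2)); last first.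
      by apply/funext => y; exact: normal_pdf01E.
    have dq : is_derive x (1 : R) (fun y : R => - y ^+ 2 / 2) (- x).
      apply: is_derive_eq.
      by rewrite /GRing.scale/=; field.
    have de := @is_derive1_comp R (@expR R) _ x _ _ (is_derive_expR _) dq.
    apply: (is_derive_eq (is_deriveM (is_derive_cst (normal_peak 1) x (1 : R)) de)).
    by rewrite /GRing.scale/=; ring.
  apply: (is_derive_eq (is_deriveM d1 dp)); rewrite /GRing.scale/= /k; ring.
have msx : measurable_fun setT (fun x : R => s * x) by exact: measurable_funM.
have mg : measurable_fun setT (fun x : R => s * cos (s * x) - x * sin (s * x)).
  apply: measurable_funB; apply: measurable_funM => //.
  - by have [] := bmf_cos msx.
  - by have [] := bmf_sin msx.
have mk : measurable_fun setT k.
  by apply: measurable_funM => //; exact: measurable_normal_pdf.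
have ck : continuous k.
  move=> x; apply: cvgM; last by apply: continuous_normal_pdf; exact: oner_neq0.
  have cs : s * y @[y --> x] --> s * x by apply: cvgM; [exact: cvg_cst|exact: cvg_id].
  apply: cvgB; apply: cvgM.
  - exact: cvg_cst.
  - by apply: (cvg_comp _ _ cs); exact: continuous_cos.
  - exact: cvg_id.
  - by apply: (cvg_comp _ _ cs); exact: continuous_sin.
rewrite integral_gauss; last exact/measurable_EFinP.
under eq_integral do rewrite -EFinM.
rewrite -/k.
pose D n : set (measurableTypeR R) := `[- n.+1%:R, n.+1%:R]%classic.
pose f_ n (x : measurableTypeR R) : \bar R := (k x * \1_(D n) x)%:E.
have mf n : measurable_fun setT (f_ n).
  apply/measurable_EFinP; apply: measurable_funM; first exact: mk.
  apply: measurable_indic; exact: measurable_itv.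
have ff (x : measurableTypeR R) : setT x -> f_ n x @[n --> \oo] --> (k x)%:E.
  move=> _; apply: cvg_near_cst; near=> n.
  rewrite /f_ indicE mem_set ?mulr1// /D /= in_itv/= -ler_norml.
  rewrite ltW//; near: n.
  exists (Num.bound `|x|) => // n /= xn.
  rewrite (lt_le_trans (archi_boundP _))// ler_nat.
  exact: leq_trans xn _.
have ig := integrable_gauss_affine (normr_ge0 s).
have fg n (x : measurableTypeR R) : setT x ->
    (`|f_ n x| <= ((`|s| + `|x|) * pdf x)%:E)%E.
  move=> _; rewrite lee_fin normrM (@le_trans _ _ `|k x|)//.
    rewrite ler_piMr// indicE; case: (_ \in _); rewrite ?normr1 ?normr0//.
  rewrite normrM (ger0_norm (normal_pdf_ge0 _ _ _)) ler_wpM2r ?normal_pdf_ge0//.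
  rewrite (le_trans (ler_normB _ _))// !normrM lerD// ler_piMr// ?cos_max ?sin_max//.
pose gb (x : measurableTypeR R) : \bar R := ((`|s| + `|x|) * pdf x)%:E.
have gbf (x : measurableTypeR R) : setT x -> gb x \is a fin_num by [].
have cv := @dominated_cvg _ (measurableTypeR R) R mu setT measurableT f_
  (fun x => (k x)%:E) gb mf ff gbf ig fg.
have cv0 : (\int[mu]_x f_ n x)%E @[n --> \oo] --> (0 : \bar R)%E.
  have e n : (\int[mu]_x f_ n x = (2 * sin (s * n.+1%:R) * pdf n.+1%:R)%:E)%E.
    have nn : - n.+1%:R < n.+1%:R :> R by rewrite -subr_gt0 opprK addr_gt0.
    transitivity (\int[mu]_(x in D n) (k x)%:E)%E.
      rewrite [RHS]integral_mkcond; apply: eq_integral => x _.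
      by rewrite /f_ patchE indicE; case: (x \in D n); rewrite ?mulr1 ?mulr0.
    rewrite (FTC_is_derive nn (fun x _ => dF x) (fun x _ => ck x)) /F.
    rewrite mulrN sinN !normal_pdf01E sqrrN; congr (_%:E); ring.
  rewrite (_ : (fun _ => _) = (fun n => (2 * sin (s * n.+1%:R) * pdf n.+1%:R)%:E)); last first.
    by apply/funext => n; exact: e.
  apply: cvg_EFin; first by apply: nearW => n.
  apply: norm_cvg0.
  have h0 : (fun n : nat => 4 * normal_peak 1 / n.+1%:R) @ \oo --> (0 : R).
    rewrite -[X in _ --> X](mulr0 (4 * normal_peak 1)); apply: cvgM.
      exact: cvg_cst.
    exact: cvg_harmonic.
  apply: (squeeze_cvgr _ (cvg_cst (0 : R)) h0); apply: nearW => n.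
  rewrite normr_ge0/= !normrM (ger0_norm (normal_pdf_ge0 _ _ _)).
  rewrite (@le_trans _ _ (2 * 1 * (2 * normal_peak 1 / n.+2%:R)))//.
    by rewrite !ler_pM// ?normr_ge0 ?normal_pdf_ge0 ?mulr_ge0 ?sin_max// ger0_norm.
  rewrite (_ : 2 * 1 * _ = 4 * normal_peak 1 / n.+2%:R); last by ring.
  by rewrite ler_pM2l ?mulr_gt0// lef_pV2 ?posrE// ler_nat.
exact: (cvg_unique (@ereal_hausdorff R) cv cv0).
Unshelve. all: by end_near. Qed.

End gaussian.

Section gaussian_characteristic_function.
Context {R : realType}.
Local Notation mu := (@lebesgue_measure R).
Local Notation gauss := (@gauss R).

Let h (s : R) : R := \int[gauss]_x cos (s * x).

Let msx (s : R) : measurable_fun setT (fun x : R => s * x).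
Proof. exact: measurable_funM. Qed.

Let is_derive_cosM (s x : R) : is_derive s (1 : R) (fun s => cos (s * x)) (- (x * sin (s * x))).
Proof.
have sq : is_derive s (1 : R) (fun s => s * x) x.
  by apply: is_derive_eq; rewrite /GRing.scale/=; ring.
have d1 := @is_derive1_comp R (@cos R) _ s _ _ (is_derive_cos _) sq.
apply: (is_derive_eq d1); rewrite /GRing.scale/=; ring.
Qed.

Let integrable_cos (s : R) : gauss.-integrable setT (fun x => (cos (s * x))%:E).
Proof.
apply: (bmf_integrable gauss_setT); exact: bmf_cos (msx s).
Qed.

Let integrable_xsin (s : R) : gauss.-integrable setT (fun x => (x * sin (s * x))%:E).
Proof.
apply: (@integrable_gauss _ _ (fun x => 0 + `|x|)).
- by apply: measurable_funM => //; have [] := bmf_sin (msx s).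
- by move=> x; rewrite add0r normrM ler_piMr// sin_max.
- exact: integrable_gauss_affine.
Qed.

(** Differentiation under the integral sign, with |x| dominating for all parameters; Stein's
    identity then rewrites the derivative as a multiple of [h]. *)
Let is_derive_h (s : R) : is_derive s (1 : R) h (- s * h s).
Proof.
have su : `](s - 1), (s + 1)[%classic s by rewrite /= in_itv/=; apply/andP; split; lra.
have df (a : R) (x : measurableTypeR R) : (`](s - 1), (s + 1)[%classic : set R) a ->
    (setT : set (measurableTypeR R)) x -> derivable ((fun s x : R => cos (s * x))^~ x) a 1.
  by move=> _ _; have [] := is_derive_cosM a x.
have pE (a : R) (x : measurableTypeR R) : partial1of2 (fun s x : R => cos (s * x)) a x =
    - (x * sin (a * x)).
  rewrite partial1of2E; have h1 := is_derive_cosM a x; exact: derive_val.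
have ig : gauss.-integrable setT (fun x => `|x|%:E).
  apply: (@integrable_gauss _ _ (fun x => 0 + `|x|)).
  - exact: normr_measurable.
  - by move=> x; rewrite add0r normr_id.
  - exact: integrable_gauss_affine.
have gb (a : R) (x : measurableTypeR R) : (`](s - 1), (s + 1)[%classic : set R) a ->
    (setT : set (measurableTypeR R)) x ->
    `|partial1of2 (fun s x : R => cos (s * x)) a x| <= `|x|.
  by move=> _ _; rewrite pE normrN normrM ler_piMr// sin_max.
have ic (a : R) : (`](s - 1), (s + 1)[%classic : set R) a ->
  gauss.-integrable setT (EFin \o (fun x => cos (a * x))) by move=> _; exact: integrable_cos.
have dh := @derivable_under_integral R _ _ gauss (fun s x : R => cos (s * x)) setT
  measurableT s _ _ su ic df (fun x => `|x|) (fun x => normr_ge0 x) ig gb.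
have eh := @differentiation_under_integral R _ _ gauss (fun s x : R => cos (s * x)) setT
  measurableT s _ _ su ic df (fun x => `|x|) (fun x => normr_ge0 x) ig gb.
apply: DeriveDef; first exact: dh.
rewrite -derive1E eh.
transitivity (\int[gauss]_x ((-1) * (x * sin (s * x)))).
  by apply: eq_Rintegral => x _; rewrite pE mulN1r.
rewrite RintegralZl//; last exact: integrable_xsin.
suff : \int[gauss]_x (s * cos (s * x) - x * sin (s * x)) = 0.
  rewrite RintegralB//; last 2 first.
  - by have := integrableZl measurableT s (integrable_cos s).
  - exact: integrable_xsin.
  rewrite RintegralZl//; last exact: integrable_cos.
  by rewrite /h => /eqP; rewrite subr_eq0 => /eqP <-; rewrite mulN1r mulNr.
by rewrite /Rintegral gauss_stein.
Qed.

Lemma gauss_cos (s : R) : \int[gauss]_x cos (s * x) = expR (- s ^+ 2 / 2).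
Proof.
pose H s := h s * expR (s ^+ 2 / 2).
have dH (x : R) : is_derive x (1 : R) H 0.
  have dq : is_derive x (1 : R) (fun y : R => y ^+ 2 / 2) x.
    by apply: is_derive_eq; rewrite /GRing.scale/=; field.
  have de := @is_derive1_comp R (@expR R) _ x _ _ (is_derive_expR _) dq.
  apply: (is_derive_eq (is_deriveM (is_derive_h x) de)).
  by rewrite /GRing.scale/=; ring.
have := is_derive_0_is_cst s 0 dH; rewrite /H expr0n/= mul0r expR0 mulr1.
have -> : h 0 = 1.
  rewrite /h -[RHS](@Ecst _ _ R gauss gauss_setT 1).
  by apply: eq_Rintegral => x _; rewrite mul0r cos0.
move=> e; apply: (mulIf (lt0r_neq0 (expR_gt0 (s ^+ 2 / 2)))).
by rewrite -/(h s) e -expRD mulNr addNr expR0.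
Qed.

(** The density is even. Invariance under x -> -x is available for nonnegative integrands, so 1 is
    added to the sine: the equation 1 - I = 1 + I for the integral I gives I = 0. *)
Lemma gauss_sin (s : R) : \int[gauss]_x sin (s * x) = 0.
Proof.
have bs := bmf_sin (msx s).
pose F (x : measurableTypeR R) : \bar R := ((1 + sin (s * x)) * normal_pdf 0 1 x)%:E.
have mF : measurable_fun setT F.
  apply/measurable_EFinP; apply: measurable_funM; last exact: measurable_normal_pdf.
  by apply: measurable_funD => //; case: bs.
have F0 x : (0 <= F x)%E.
  by rewrite lee_fin mulr_ge0 ?normal_pdf_ge0.
have := ge0_integral_lebesgue_opp mF F0.
have e (c : R) : (\int[mu]_x ((1 + c * sin (s * x)) * normal_pdf 0 1 x)%:E)%E =
    (1 + c * \int[gauss]_x sin (s * x))%:E.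
  have b1 := @bmf_cst _ (measurableTypeR R) R 1.
  have b2 := bmfZ c bs; have b3 := bmfD b1 b2.
  have e1 := ED gauss_setT b1 b2; rewrite /= (Ecst gauss_setT) in e1.
  rewrite -(EZ gauss_setT c bs) -e1.
  rewrite -(EFin_E gauss_setT b3) integral_gauss//.
  by apply/measurable_EFinP; case: b3.
rewrite [X in _ = X -> _](_ : _ = (1 + 1 * \int[gauss]_x sin (s * x))%:E); last first.
  by rewrite -e; apply: eq_integral => x _; rewrite mul1r.
rewrite [X in X = _ -> _](_ : _ = (1 + (-1) * \int[gauss]_x sin (s * x))%:E); last first.
  by rewrite -e; apply: eq_integral => x _; rewrite /F !normal_pdf01E mulrN sinN sqrrN mulN1r.
by move=> -[] ?; lra.
Qed.

End gaussian_characteristic_function.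

Section standard_normal_vector.
Context {R : realType}.
Local Notation gauss := (@gauss R).

Definition stdn p : {sigma_finite_measure set (borel 'cV[R]_p) -> \bar R} :=
  mpower gauss p.

Lemma std_normalE p (A : set (borel 'cV[R]_p)) : measurable A ->
  std_normal A = stdn p A.
Proof. exact: power_measureE. Qed.

Lemma stdn_setT p : stdn p setT = 1%E.
Proof.
have := @ge0_integral_mpower_prod R gauss p (cst 1) (@measurable_cst _ _ R R setT 1) (fun _ => ler01).
rewrite [X in _ = (X ^+ p)%E -> _](_ : _ = 1%E); last first.
  have := @integral_cst _ (measurableTypeR R) R gauss setT measurableT 1%E.
  by rewrite mul1e => ->; exact: gauss_setT.
rewrite -EFin_expe expr1n => <-; transitivity (\int[stdn p]_x cst 1%E x)%E.
  by rewrite (integral_cst (stdn p) measurableT 1%E) mul1e.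
by apply: eq_integral => x _; rewrite big1.
Qed.

Lemma E_stdnS p (f : borel 'cV[R]_p.+1 -> R) : bmf f ->
  \int[stdn p.+1]_x f x =
  \int[gauss]_t \int[stdn p]_v f (col_mx (t%:M : 'cV[R]_1) (v : 'cV[R]_p)).
Proof.
move=> bf; have [M fM0] := bmf_shift_ge0 bf.
have mfM : measurable_fun setT (fun z => (f z + M)%:E).
  by apply/measurable_EFinP; apply: measurable_funD => //; case: bf.
have := ge0_integral_mpowerS gauss mfM (fun z => fM0 z).
have b2 : bmf (fun tv : measurableTypeR R * borel 'cV[R]_p =>
    f (col_mx (tv.1%:M : 'cV[R]_1) (tv.2 : 'cV[R]_p))).
  exact: (bmf_comp bf (@measurable_col_mx R p)).
rewrite (EFin_E (stdn_setT _) (bmfD bf (bmf_cst M))) (ED (stdn_setT _) bf (bmf_cst M)).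
under [X in _ = X -> _]eq_integral do rewrite (integral1D (stdn_setT _) _ _ b2).
have b1 := bmf_integral1 (stdn_setT _) b2.
rewrite /= in b1 *.
rewrite (EFin_E gauss_setT (bmfD b1 (bmf_cst M))) (ED gauss_setT b1 (bmf_cst M)).
by rewrite (Ecst gauss_setT) (Ecst (stdn_setT _)) => -[] /addIr.
Qed.

Lemma measurable_dotl d (T : measurableType d) p (t : 'cV[R]_p) (X : T -> borel 'cV[R]_p) :
  measurable_fun setT X -> measurable_fun setT (fun w => dot t (X w)).
Proof. by move=> mX; apply: measurable_dot => //; exact: measurable_cst. Qed.

(** Cosine and sine are handled together, because the addition formulas that peel off the first
    coordinate mix them. *)
Lemma stdn_cos_sin p (t : 'cV[R]_p) :
  \int[stdn p]_z cos (dot t z) = expR (- dot t t / 2) /\ \int[stdn p]_z sin (dot t z) = 0.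
Proof.
elim: p t => [|p IHp] t.
  have t0 (z : 'cV[R]_0) : dot t z = 0 by rewrite dotE big_ord0.
  split; rewrite ?t0.
    rewrite oppr0 mul0r expR0 -[RHS](Ecst (stdn_setT 0) 1).
    by apply: eq_Rintegral => z _; rewrite t0 cos0.
  rewrite -[RHS](Ecst (stdn_setT 0) 0).
  by apply: eq_Rintegral => z _; rewrite t0 sin0.
pose t0 := t 0 0; pose t' : 'cV[R]_p := dsubmx (t : 'cV[R]_(1 + p)).
have dE x (v : 'cV[R]_p) : dot t (col_mx (x%:M : 'cV[R]_1) v) = t0 * x + dot t' v.
  rewrite !dotE big_ord_recl cons_mx0; congr (_ + _).
  by apply: eq_bigr => i _; rewrite cons_mxS mxE; congr (t _ _ * _); apply/val_inj.
have dtt : dot t t = t0 ^+ 2 + dot t' t'.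
  rewrite !dotE big_ord_recl -expr2; congr (_ + _).
  by apply: eq_bigr => i _; rewrite mxE; congr (t _ _ * t _ _); apply/val_inj.
have mt q (u : 'cV[R]_q) : measurable_fun setT (fun z : borel 'cV[R]_q => dot u z).
  by apply: measurable_dotl; exact: measurable_id.
have [IHc IHs] := IHp t'.
have bc := bmf_cos (mt _ t'); have bs := bmf_sin (mt _ t').
have m1 : measurable_fun setT (fun x : measurableTypeR R => t0 * x) by exact: measurable_funM.
split.
  rewrite E_stdnS; last exact: bmf_cos.
  transitivity (\int[gauss]_x (expR (- dot t' t' / 2) * cos (t0 * x))).
    apply: eq_Rintegral => x _.
    transitivity (\int[stdn p]_v (cos (t0 * x) * cos (dot t' v) - sin (t0 * x) * sin (dot t' v))).
      by apply: eq_Rintegral => v _; rewrite dE cosD.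
    rewrite (EB (stdn_setT p) (bmfZ _ bc) (bmfZ _ bs)) !(EZ (stdn_setT p))// IHc IHs.
    by rewrite mulr0 subr0 mulrC.
  rewrite (EZ gauss_setT _ (bmf_cos m1)) gauss_cos -expRD dtt; congr expR; ring.
rewrite E_stdnS; last exact: bmf_sin.
transitivity (\int[gauss]_x (expR (- dot t' t' / 2) * sin (t0 * x))).
  apply: eq_Rintegral => x _.
  transitivity (\int[stdn p]_v (sin (t0 * x) * cos (dot t' v) + cos (t0 * x) * sin (dot t' v))).
    by apply: eq_Rintegral => v _; rewrite dE sinD.
  rewrite (ED (stdn_setT p) (bmfZ _ bc) (bmfZ _ bs)) !(EZ (stdn_setT p))// IHc IHs.
  by rewrite mulr0 addr0 mulrC.
by rewrite (EZ gauss_setT _ (bmf_sin m1)) gauss_sin mulr0.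
Qed.

End standard_normal_vector.

Section gaussian_kernel.
Context {R : realType} (p : nat).
Local Notation V := (borel 'cV[R]_p).
Implicit Types x y z : 'cV[R]_p.

Definition gauss_density x : R := normal_peak 1 ^+ p * expR (- dot x x / 2).

Lemma gauss_density_ge0 x : 0 <= gauss_density x.
Proof. by rewrite mulr_ge0 ?expR_ge0// exprn_ge0// normal_peak_ge0. Qed.

Lemma measurable_gauss_density d (T : measurableType d) (X : T -> V) :
  measurable_fun setT X -> measurable_fun setT (fun w => gauss_density (X w)).
Proof.
move=> mX; apply: measurable_funM => //.
apply: (measurableT_comp (@measurable_expR R)); apply: measurable_funM => //.
by apply: measurable_funN; exact: measurable_dot.
Qed.

Lemma bmf_gauss_density : bmf (gauss_density : V -> R).
Proof.
split; first by apply: measurable_gauss_density; exact: measurable_id.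
exists (normal_peak 1 ^+ p) => x; rewrite ger0_norm ?gauss_density_ge0//.
rewrite ler_piMr ?exprn_ge0 ?normal_peak_ge0//.
by rewrite -[leRHS]expR0 ler_expR mulNr oppr_le0 divr_ge0// dot_ge0.
Qed.

End gaussian_kernel.

Lemma dot_col_mx {R : realType} p (s t : R) (v w : 'cV[R]_p) :
  @dot R p.+1 (col_mx (s%:M : 'cV[R]_1) v) (col_mx (t%:M : 'cV[R]_1) w) = s * t + dot v w.
Proof.
rewrite [LHS]dotE big_ord_recl !cons_mx0 [dot v w]dotE; congr (_ + _).
by apply: eq_bigr => i _; rewrite !cons_mxS.
Qed.

Lemma ge0_integral_stdn {R : realType} p (F : borel 'cV[R]_p -> \bar R) :
  measurable_fun setT F -> (forall x, 0 <= F x)%E ->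
  (\int[stdn p]_x F x = \int[lebp p]_x (F x * (gauss_density (x : 'cV[R]_p))%:E))%E.
Proof.
have md q : measurable_fun setT (fun x : borel 'cV[R]_q => (gauss_density (x : 'cV[R]_q))%:E).
  by apply/measurable_EFinP; apply: measurable_gauss_density; exact: measurable_id.
elim: p F => [|p IHp] F mF F0.
  rewrite !ge0_integral_mpower0//; last exact: emeasurable_funM.
  by rewrite /gauss_density dot0l oppr0 mul0r expR0 expr0 mulr1 mule1.
rewrite ge0_integral_mpowerS// ge0_integral_lebpS; last 2 first.
- exact: emeasurable_funM.
- by move=> x; rewrite mule_ge0// lee_fin gauss_density_ge0.
have mc (t : R) : measurable_fun setT
    (fun v : borel 'cV[R]_p => F (col_mx (t%:M : 'cV[R]_1) (v : 'cV[R]_p))).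
  exact: (measurableT_comp mF (@measurable_cons R p t)).
rewrite integral_gauss; last exact: (measurable_integral_col_mx (@gauss R) mF F0).
apply: eq_integral => t _.
rewrite IHp// muleC -ge0_integralZlT ?normal_pdf_ge0//; last 2 first.
- exact: emeasurable_funM.
- by move=> v; rewrite mule_ge0// lee_fin gauss_density_ge0.
apply: eq_integral => v _; rewrite muleCA; congr (_ * _)%E.
rewrite -EFinM normal_pdf01E /gauss_density [_ ^+ p.+1]exprS; congr (_%:E).
rewrite mulrACA -expRD; congr (_ * expR _).
rewrite dot_col_mx; ring.
Qed.

(** * Gaussian smoothing of a law *)

Section smoothing.
Context {R : realType} (p : nat) (a : R) (a0 : 0 < a).
Local Notation V := (borel 'cV[R]_p).
Implicit Types x y z : 'cV[R]_p.

(* Density of the centred Gaussian vector of covariance a^-2 I. Being itself a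
   Gaussian characteristic function (kernE), it turns the density of the smoothed
   law into an average of the characteristic function of X. *)
Definition kern x : R := a ^+ p * gauss_density (a *: x).

Lemma kern_ge0 x : 0 <= kern x.
Proof. by rewrite mulr_ge0 ?gauss_density_ge0// exprn_ge0// ltW. Qed.

Lemma bmf_kern d (T : measurableType d) (X : T -> V) :
  measurable_fun setT X -> bmf (fun w => kern (X w)).
Proof.
move=> mX; apply: bmfZ; apply: (bmf_comp (@bmf_gauss_density R p)).
by apply: measurable_cVZ => //; exact: measurable_cst.
Qed.

Lemma ge0_integral_kern (F : V -> \bar R) y : measurable_fun setT F ->
  (forall x, 0 <= F x)%E ->
  (\int[stdn p]_z F (y + a^-1 *: (z : 'cV[R]_p))%R =
   \int[lebp p]_x (F x * (kern ((x : 'cV[R]_p) - y))%:E))%E.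
Proof.
move=> mF F0.
have ap : 0 < a ^+ p by rewrite exprn_gt0.
have ma : measurable_fun setT (fun z : V => y + a^-1 *: (z : 'cV[R]_p) : V).
  apply: measurable_cVD; first exact: measurable_cst.
  apply: measurable_cVZ; [exact: measurable_cst|exact: measurable_id].
have mG : measurable_fun setT (fun z : V => F (y + a^-1 *: (z : 'cV[R]_p))%R).
  exact: (measurableT_comp mF ma).
rewrite ge0_integral_stdn//.
pose H (z : V) : \bar R := (F (y + a^-1 *: (z : 'cV[R]_p))%R *
  (gauss_density (z : 'cV[R]_p))%:E)%E.
have mH : measurable_fun setT H.
  apply: emeasurable_funM => //; apply/measurable_EFinP.
  by apply: measurable_gauss_density; exact: measurable_id.
have H0 z : (0 <= H z)%E by rewrite mule_ge0// lee_fin gauss_density_ge0.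
pose G (x : V) : \bar R := (F x * (kern ((x : 'cV[R]_p) - y))%:E)%E.
have mG' : measurable_fun setT G.
  apply: emeasurable_funM => //; apply/measurable_EFinP.
  by have [] := @bmf_kern _ _ _ (@measurable_shift R p (- y)).
have G0 z : (0 <= G z)%E by rewrite mule_ge0// lee_fin kern_ge0.
rewrite -/H -/G -(ge0_integral_lebp_shift y mG' G0).
transitivity (\int[lebp p]_x ((a ^+ p)%:E * H (a *: (x : 'cV[R]_p))%R))%E.
  rewrite ge0_integralZlT//; last 2 first.
  - exact: (measurableT_comp mH (@measurable_scale R p a)).
  - exact: ltW.
  by rewrite (ge0_integral_lebp_scale a0)// muleA -EFinM divff ?mul1e// gt_eqF.
apply: eq_integral => x _; rewrite /H /G /kern addrK scalerA mulVf ?gt_eqF//.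
by rewrite scale1r muleCA addrC EFinM.
Qed.

Lemma kernE x : kern x = (a * normal_peak 1) ^+ p * \int[stdn p]_z cos (dot (a *: x) z).
Proof. by rewrite (stdn_cos_sin _).1 /kern /gauss_density mulrA -exprMn. Qed.

Section smoothed_law.
Context d (T : measurableType d) (m : {sigma_finite_measure set T -> \bar R}).
Hypothesis m1 : m setT = 1%E.
Variables (X : T -> V) (mX : measurable_fun setT X).

(** The Lebesgue density of X + Z / a, where Z is a standard Gaussian vector independent of X;
    [integral_smooth_density] says so. *)
Definition smooth_density x : R := \int[m]_w kern (x - X w).

Lemma smooth_density_ge0 x : 0 <= smooth_density x.
Proof. by apply: E_ge0 => w; exact: kern_ge0. Qed.

Let mXB d' (S : measurableType d') (f : S -> V) (g : S -> T) :
  measurable_fun setT f -> measurable_fun setT g ->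
  measurable_fun setT (fun s => f s - X (g s) : V).
Proof.
move=> mf mg; apply: (@measurable_cVD R _ _ p f (fun s => - X (g s))) => //.
exact: (measurableT_comp (@measurable_opp R p) (measurableT_comp mX mg)).
Qed.

Let bmf_kernXB : bmf (fun xw : V * T => kern ((xw.1 : 'cV[R]_p) - X xw.2)).
Proof. by apply: bmf_kern; apply: mXB; [exact: measurable_fst|exact: measurable_snd]. Qed.

Lemma bmf_smooth_density : bmf (smooth_density : V -> R).
Proof. exact: (bmf_integral1 m1 bmf_kernXB). Qed.

Lemma integral_smooth_density (h : V -> R) : bmf h -> (forall x, 0 <= h x) ->
  (\int[lebp p]_x (h x * smooth_density x)%:E =
   (\int[m]_w \int[stdn p]_z h ((X w : 'cV[R]_p) + a^-1 *: (z : 'cV[R]_p)))%:E)%E.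
Proof.
move=> bh h0; have mh := bh.1.
pose F (xw : V * T) : R := h xw.1 * kern ((xw.1 : 'cV[R]_p) - X xw.2).
have bF : bmf F by apply: bmfM bmf_kernXB; exact: (bmf_comp bh measurable_fst).
have F0 xw : (0 <= (F xw)%:E)%E by rewrite lee_fin mulr_ge0// kern_ge0.
have mF : measurable_fun setT (EFin \o F) by apply/measurable_EFinP; case: bF.
have := @fubini_tonelli _ _ _ _ R (lebp p) m _ mF F0.
have -> : (\int[lebp p]_x \int[m]_y (EFin \o F) (x, y) =
    \int[lebp p]_x (h x * smooth_density x)%:E)%E.
  apply: eq_integral => x _; rewrite /= (EFin_E m1 (bmf_section1 x bF)).
  by congr (_%:E); rewrite /F/= (EZ m1)//; exact: (bmf_section1 x bmf_kernXB).
move=> ->.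
have bs : bmf (fun wz : T * V => h ((X wz.1 : 'cV[R]_p) + a^-1 *: (wz.2 : 'cV[R]_p))).
  apply: (bmf_comp bh); apply: measurable_cVD.
    exact: (measurableT_comp mX measurable_fst).
  by apply: measurable_cVZ; [exact: measurable_cst|exact: measurable_snd].
rewrite -(EFin_E m1 (bmf_integral1 (stdn_setT p) bs)).
apply: eq_integral => w _.
rewrite -(EFin_E (stdn_setT p) (bmf_section1 w bs)) /F/=.
by rewrite (@ge0_integral_kern (EFin \o h) (X w))//; exact/measurable_EFinP.
Qed.

(** Obtained from [kernE], Fubini and the cosine of a difference. In this form pointwise convergence
    of the densities follows from that of the characteristic functions by bounded convergence. *)
Lemma smooth_densityE x : smooth_density x =
  (a * normal_peak 1) ^+ p * \int[stdn p]_z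
    (cos (dot (a *: x) z) * (\int[m]_w cos (dot (a *: (z : 'cV[R]_p)) (X w))) +
     sin (dot (a *: x) z) * (\int[m]_w sin (dot (a *: (z : 'cV[R]_p)) (X w)))).
Proof.
have mz (f : T * V -> V) : measurable_fun setT f ->
    measurable_fun setT (fun wz : T * V => dot (f wz : 'cV[R]_p) (wz.2 : 'cV[R]_p)).
  by move=> mf; apply: measurable_dot => //; exact: measurable_snd.
pose F (wz : T * V) : R := cos (dot (a *: (x - X wz.1)) wz.2).
have bF : bmf F.
  apply: bmf_cos; apply: mz; apply: measurable_cVZ; first exact: measurable_cst.
  by apply: mXB; [exact: measurable_cst|exact: measurable_fst].
transitivity ((a * normal_peak 1) ^+ p * \int[m]_w \int[stdn p]_z F (w, z)).
  rewrite -(EZ m1)//; last exact: (bmf_integral1 (stdn_setT p) bF).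
  by apply: eq_Rintegral => w _; rewrite kernE.
rewrite (bounded_fubini m1 (stdn_setT p) bF); congr (_ * _).
apply: eq_Rintegral => z _.
have mzX : measurable_fun setT (fun w => dot (a *: (z : 'cV[R]_p)) (X w)).
  exact: measurable_dotl.
rewrite -!(EZ m1); [|exact: bmf_sin|exact: bmf_cos].
rewrite -(ED m1); [|by apply: bmfZ; exact: bmf_cos|by apply: bmfZ; exact: bmf_sin].
apply: eq_Rintegral => w _; rewrite /F/= -cosB; congr cos.
by rewrite !dotZl dotBl mulrBr (dotC z).
Qed.

End smoothed_law.
End smoothing.

(** * Convergence of characteristic functions *)

Lemma limn_einf_near {R : realType} (u : (\bar R) ^nat) (l e : R) : 0 < e ->
  (l%:E <= limn_einf u)%E -> \forall n \near \oo, ((l - e)%:E <= u n)%E.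
Proof.
move=> e0 lu.
have : (limn (einfs u) = ereal_sup (range (einfs u)))%E.
  by apply/cvg_lim => //; apply: ereal_nondecreasing_cvgn; exact: nondecreasing_einfs.
rewrite -limn_einf_lim => E; rewrite {}E in lu.
have : ((l - e)%:E < ereal_sup (range (einfs u)))%E.
  by apply: lt_le_trans lu; rewrite lte_fin ltrBlDr ltrDl.
move=> /ereal_sup_gt[_ [N _ <-] lN]; exists N => // n /= Nn.
rewrite (le_trans (ltW lN))//; apply: ereal_inf_lbound; exists n => //=.
Qed.

Lemma bounded_cvg d (T : measurableType d) (R : realType)
  (m : {measure set T -> \bar R}) (F : nat -> T -> R) (f : T -> R) (M : R) :
  m setT = 1%E -> (forall n, measurable_fun setT (F n)) -> bmf f ->
  (forall n x, `|F n x| <= M) -> (forall x, F n x @[n --> \oo] --> f x) ->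
  \int[m]_x F n x @[n --> \oo] --> \int[m]_x f x.
Proof.
move=> m1 mF bf FM Ff.
have bF n : bmf (F n) by split => //; exists M.
have i1 := bmf_integrable m1 (@bmf_cst _ T R M).
have mF' n : measurable_fun setT (EFin \o F n) by exact/measurable_EFinP.
have Ff' x : setT x -> (EFin \o F n) x @[n --> \oo] --> (EFin \o f) x.
  by move=> _; apply: cvg_EFin; [exact: nearW|exact: Ff].
have := @dominated_cvg _ T R m setT measurableT (fun n => EFin \o F n) (EFin \o f)
  (fun _ => M%:E) mF' Ff' (fun _ _ => isT) i1 (fun n x _ => FM n x).
rewrite (EFin_E m1 bf) => /fine_cvg.
by under eq_fun do rewrite (EFin_E m1 (bF _)).
Qed.

Section levy_continuity.
Context {R : realType} (p : nat).
Local Notation V := (borel 'cV[R]_p).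
Context (d : nat -> measure_display) (T : forall n, measurableType (d n))
  (P : forall n, probability (T n) R) (Y : forall n, T n -> V).
Local Arguments Y : clear implicits.
Context d0 (T0 : measurableType d0) (m0 : {sigma_finite_measure set T0 -> \bar R})
  (X0 : T0 -> V).
Hypotheses (m01 : m0 setT = 1%E) (mY : forall n, measurable_fun setT (Y n))
  (mX0 : measurable_fun setT X0).
Hypothesis cos_cvg : forall t : 'cV[R]_p,
  \int[P n]_w cos (dot t (Y n w)) @[n --> \oo] --> \int[m0]_w cos (dot t (X0 w)).
Hypothesis sin_cvg : forall t : 'cV[R]_p,
  \int[P n]_w sin (dot t (Y n w)) @[n --> \oo] --> \int[m0]_w sin (dot t (X0 w)).

Let P1 n : P n setT = 1%E. Proof. exact: probability_setT. Qed.

Let bmf_char d' (S : measurableType d') (m : {sigma_finite_measure set S -> \bar R})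
  (X : S -> V) (a : R) (g : R -> R) : m setT = 1%E -> measurable_fun setT X ->
  bmf (fun zw : V * S => g (dot (a *: (zw.1 : 'cV[R]_p)) (X zw.2))) ->
  bmf (fun z : V => \int[m]_w g (dot (a *: (z : 'cV[R]_p)) (X w))).
Proof. by move=> m1 mX bg; exact: (bmf_integral1 m1 bg). Qed.

Let measurable_char d' (S : measurableType d') (X : S -> V) (a : R) :
  measurable_fun setT X ->
  measurable_fun setT (fun zw : V * S => dot (a *: (zw.1 : 'cV[R]_p)) (X zw.2)).
Proof.
move=> mX; apply: measurable_dot; last exact: (measurableT_comp mX measurable_snd).
by apply: measurable_cVZ; [exact: measurable_cst|exact: measurable_fst].
Qed.

Let measurable_scaled (a : R) (x : 'cV[R]_p) :
  measurable_fun setT (fun z : V => dot (a *: x) z).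
Proof. by apply: measurable_dotl; exact: measurable_id. Qed.

Let smooth_density_cvg (a : R) (x : 'cV[R]_p) :
  smooth_density a (P n) (Y n) x @[n --> \oo] --> smooth_density a m0 X0 x.
Proof.
rewrite (smooth_densityE a m01 mX0).
under eq_fun do rewrite (smooth_densityE a (P1 _) (@mY _)).
apply: cvgM; first exact: cvg_cst.
have bc n := bmf_char (P1 n) (@mY n) (bmf_cos (measurable_char a (@mY n))).
have bs n := bmf_char (P1 n) (@mY n) (bmf_sin (measurable_char a (@mY n))).
have bc0 := bmf_char m01 mX0 (bmf_cos (measurable_char a mX0)).
have bs0 := bmf_char m01 mX0 (bmf_sin (measurable_char a mX0)).
have b1 := bmf_cos (measurable_scaled a x); have b2 := bmf_sin (measurable_scaled a x).
apply: (@bounded_cvg _ V R (stdn p) _ _ 2 (stdn_setT p)).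
- by move=> n; have [] := bmfD (bmfM b1 (bc n)) (bmfM b2 (bs n)).
- exact: (bmfD (bmfM b1 bc0) (bmfM b2 bs0)).
- move=> n z; rewrite (le_trans (ler_normD _ _))// !normrM -[leRHS](_ : 1 * 1 + 1 * 1 = 2); last first.
    by rewrite mulr1.
  apply: lerD; apply: ler_pM => //; rewrite ?cos_max ?sin_max//.
    apply: (E_bound (P1 n)); last by move=> w; exact: cos_max.
    by apply: bmf_cos; exact: measurable_dotl.
  apply: (E_bound (P1 n)); last by move=> w; exact: sin_max.
  by apply: bmf_sin; exact: measurable_dotl.
- move=> z; apply: cvgD; apply: cvgM; [exact: cvg_cst|exact: cos_cvg|
    exact: cvg_cst|exact: sin_cvg].
Qed.

Let smoothed d' (S : measurableType d') (m : {sigma_finite_measure set S -> \bar R})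
    (X : S -> V) (a : R) (h : V -> R) : R :=
  \int[m]_w \int[stdn p]_z h ((X w : 'cV[R]_p) + a^-1 *: (z : 'cV[R]_p)).

(* Fatou's lemma for the densities; the matching upper bound comes from applying
   this to K - h. *)
Let smoothed_ge (a : R) (h : V -> R) (e : R) : 0 < a -> bmf h -> (forall x, 0 <= h x) ->
  0 < e -> \forall n \near \oo, smoothed m0 X0 a h - e <= smoothed (P n) (Y n) a h.
Proof.
move=> a0 bh h0 e0.
pose F n (x : V) : \bar R := (h x * smooth_density a (P n) (Y n) (x : 'cV[R]_p))%:E.
have mF n : measurable_fun setT (F n).
  by apply/measurable_EFinP; have [] := bmfM bh (bmf_smooth_density a (P1 n) (@mY n)).
have F0 n x : setT x -> (0 <= F n x)%E.
  by move=> _; rewrite lee_fin mulr_ge0// smooth_density_ge0.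
have := fatou (lebp p) measurableT mF F0.
rewrite (_ : (\int[lebp p]_x _)%E = (smoothed m0 X0 a h)%:E); last first.
  rewrite -(integral_smooth_density a0 m01 mX0 bh h0); apply: eq_integral => x _.
  have cv : F n x @[n --> \oo] --> (h x * smooth_density a m0 X0 (x : 'cV[R]_p))%:E.
    apply: cvg_EFin; first exact: nearW.
    by apply: cvgM; [exact: cvg_cst|exact: smooth_density_cvg].
  by have [-> _] := cvg_limn_einf_sup cv.
move=> /(limn_einf_near e0); apply: filterS => n.
by rewrite (integral_smooth_density a0 (P1 n) (@mY n) bh h0) lee_fin.
Qed.

Let bmf_smoothed d' (S : measurableType d') (X : S -> V) (a : R) (h : V -> R) :
  measurable_fun setT X -> bmf h ->
  bmf (fun wz : S * V => h ((X wz.1 : 'cV[R]_p) + a^-1 *: (wz.2 : 'cV[R]_p))).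
Proof.
move=> mX bh; apply: (bmf_comp bh); apply: measurable_cVD.
  exact: (measurableT_comp mX measurable_fst).
by apply: measurable_cVZ; [exact: measurable_cst|exact: measurable_snd].
Qed.

Let smoothedD d' (S : measurableType d') (m : {sigma_finite_measure set S -> \bar R})
    (X : S -> V) (a : R) (h : V -> R) (c K : R) : m setT = 1%E -> measurable_fun setT X ->
  bmf h -> smoothed m X a (fun x => K + c * h x) = K + c * smoothed m X a h.
Proof.
move=> m1 mX bh; have b2 := bmf_smoothed a mX bh.
have b1 := bmf_integral1 (stdn_setT p) b2.
rewrite /smoothed -(EZ m1 c b1) -[in RHS](Ecst m1 K) -(ED m1 (bmf_cst K) (bmfZ c b1)).
apply: eq_Rintegral => w _.
have bw := bmf_section1 w b2.
by rewrite (ED (stdn_setT p) (bmf_cst K) (bmfZ c bw)) (Ecst (stdn_setT p)) (EZ (stdn_setT p) c bw).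
Qed.

Let smoothed_cvg (a : R) (h : V -> R) : 0 < a -> bmf h ->
  smoothed (P n) (Y n) a h @[n --> \oo] --> smoothed m0 X0 a h.
Proof.
move=> a0 bh; have [mh [K hK]] := bh.
(* The values c = 1 and c = -1 make the one-sided bound of [smoothed_ge] two-sided; adding [K] makes
   the integrand nonnegative. *)
have lower (c : R) : `|c| = 1 -> forall e, 0 < e ->
    \forall n \near \oo, c * smoothed m0 X0 a h - e <= c * smoothed (P n) (Y n) a h.
  move=> c1 e e0.
  have bg : bmf (fun x => K + c * h x) by apply: bmfD; [exact: bmf_cst|exact: bmfZ].
  have g0 x : 0 <= K + c * h x.
    have : `|c * h x| <= K by rewrite normrM c1 mul1r.
    by rewrite ler_norml => /andP[? _]; lra.
  have := smoothed_ge a0 bg g0 e0; apply: filterS => n.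
  by rewrite (smoothedD a c K m01 mX0 bh) (smoothedD a c K (P1 n) (@mY n) bh); lra.
apply/cvgrPdist_le => e e0.
have l1 := lower 1 (normr1 _) e e0; have l2 := lower (-1) (normrN1 _) e e0.
near=> n.
have h1 : 1 * smoothed m0 X0 a h - e <= 1 * smoothed (P n) (Y n) a h by near: n; exact: l1.
have h2 : -1 * smoothed m0 X0 a h - e <= -1 * smoothed (P n) (Y n) a h by near: n; exact: l2.
by rewrite ler_norml; apply/andP; split; lra.
Unshelve. all: by end_near. Qed.

(** The Lipschitz condition makes the smoothing error uniform: it is at most the Gaussian mean of
    min (2 K, |L| |z| / (k + 1)), whatever the law. One large k therefore serves all n and the
    limit, and for that k the smoothed expectations converge. *)
Lemma levy_lipschitz (h : V -> R) (L : R) : bmf h ->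
  (forall x y : 'cV[R]_p, `|h x - h y| <= L * enorm (x - y)) ->
  \int[P n]_w h (Y n w) @[n --> \oo] --> \int[m0]_w h (X0 w).
Proof.
move=> bh hL; have [mh [K hK]] := bh.
have L0 : 0 <= `|L| by [].
have K0 : 0 <= K := le_trans (normr_ge0 _) (hK 0).
pose rho (k : nat) (z : V) : R := Num.min (2 * K) (`|L| * enorm (k.+1%:R^-1 *: (z : 'cV[R]_p))).
have mrho k : measurable_fun setT (rho k).
  apply: measurable_minr; first exact: measurable_cst.
  apply: measurable_funM; first exact: measurable_cst.
  by apply: measurable_enorm; exact: measurable_scale.
have rho0 k z : 0 <= rho k z by rewrite le_min mulr_ge0//= mulr_ge0// enorm_ge0.
have rhoK k z : `|rho k z| <= 2 * K by rewrite ger0_norm// ge_min lexx.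
have brho k : bmf (rho k) by split => //; exists (2 * K).
have rho_cvg : \int[stdn p]_z rho k z @[k --> \oo] --> (0 : R).
  rewrite -[X in _ --> X](Ecst (stdn_setT p) 0).
  apply: (@bounded_cvg _ V R (stdn p) _ _ (2 * K) (stdn_setT p)) => //.
    exact: bmf_cst.
  move=> z; pose C := `|L| * enorm (z : 'cV[R]_p).
  have Ch : C / k.+1%:R @[k --> \oo] --> (0 : R).
    rewrite -[X in _ --> X](mulr0 C).
    by apply: cvgM; [exact: cvg_cst|exact: cvg_harmonic].
  apply: (squeeze_cvgr _ (cvg_cst (0 : R)) Ch); apply: nearW => k.
  have kV : 0 <= k.+1%:R^-1 :> R by rewrite invr_ge0.
  rewrite rho0/= /rho ge_min; apply/orP; right.
  by rewrite enormZ (ger0_norm kV) /C mulrCA mulrC.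
have approx d' (S : measurableType d') (m : {sigma_finite_measure set S -> \bar R})
    (X : S -> V) k : m setT = 1%E -> measurable_fun setT X ->
    `|\int[m]_w h (X w) - smoothed m X k.+1%:R h| <= \int[stdn p]_z rho k z.
  move=> m1 mX; have bX := bmf_comp bh mX.
  have b2 := bmf_smoothed (k.+1%:R) mX bh.
  have b1 := bmf_integral1 (stdn_setT p) b2.
  rewrite -(EB m1 bX b1); apply: (E_bound m1); first exact: bmfB.
  move=> w; have bw := bmf_section1 w b2.
  rewrite -[X in X - _](Ecst (stdn_setT p) (h (X w))) -(EB (stdn_setT p) (bmf_cst _) bw).
  have bd := bmfB (bmf_cst (h (X w))) bw.
  apply: le_trans (E_norm (stdn_setT p) bd) _.
  apply: (E_le (stdn_setT p) (bmf_norm bd)) => // z.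
  rewrite le_min; apply/andP; split.
    by rewrite (le_trans (ler_normB _ _))// mulrDl mul1r lerD.
  apply: le_trans (hL _ _) _; rewrite opprD addNKr enormN.
  by rewrite ler_wpM2r ?enorm_ge0// ler_norm.
apply/cvgrPdist_le => e e0.
have e3 : 0 < e / 3 by rewrite divr_gt0.
have /cvgrPdist_le/(_ _ e3)[k _ /(_ k (leqnn k))/=] := rho_cvg.
rewrite sub0r normrN ger0_norm; last by apply: E_ge0.
move=> rk.
have k0 : 0 < k.+1%:R :> R by rewrite ltr0n.
have /cvgrPdist_le/(_ _ e3) := smoothed_cvg k0 bh.
apply: filterS => n.
have := approx _ _ _ _ k m01 mX0; have := approx _ _ _ _ k (P1 n) (@mY n).
set u := \int[m0]_w _; set v := \int[P n]_w _; move=> h1 h2 h3.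
rewrite (_ : u - v = (u - smoothed m0 X0 k.+1%:R h) +
  (smoothed m0 X0 k.+1%:R h - smoothed (P n) (Y n) k.+1%:R h) -
  (v - smoothed (P n) (Y n) k.+1%:R h)); last by ring.
rewrite (le_trans (ler_normB _ _))//.
have := ler_normD (u - smoothed m0 X0 k.+1%:R h)
  (smoothed m0 X0 k.+1%:R h - smoothed (P n) (Y n) k.+1%:R h).
by lra.
Qed.

End levy_continuity.

(** * From Lipschitz to continuous test functions *)

Section lipschitz_approximation.
Context {R : realType} (p : nat).
Local Notation V := (borel 'cV[R]_p).
Implicit Types x y : 'cV[R]_p.

(** The topology of matrices is that of the sup norm; the factor p + 1 passes to the Euclidean norm
    through the sum of the coordinates. *)
Lemma near_enorm x (e : R) : 0 < e -> \forall y \near x, enorm (x - y) < e.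
Proof.
move=> e0; have p0 : 0 < p.+1%:R :> R by rewrite ltr0n.
have d0 : 0 < e / p.+1%:R by rewrite divr_gt0.
apply: filterS (nbhsx_ballx x (PosNum d0)%:num d0) => y xy.
apply: (le_lt_trans (enorm_le_sum _)).
apply: (@le_lt_trans _ _ (\sum_(i < p) (e / p.+1%:R))).
  apply: ler_sum => i _; have := xy.2 i 0; rewrite /ball/= => /ltW.
  by rewrite !mxE.
rewrite sumr_const card_ord -[X in X < _]mulr_natr -mulrA gtr_pMr//.
by rewrite mulrC ltr_pdivrMr ?mul1r ?ltr_nat.
Qed.

Lemma nbhs_enorm x (U : set 'cV[R]_p) : nbhs x U ->
  exists2 e : R, 0 < e & forall y, enorm (x - y) < e -> U y.
Proof.
move=> /nbhs_ballP[e e0 xU]; exists e => // y xy; apply: xU; split=> // i j.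
rewrite (ord1 j) /ball/= (le_lt_trans _ xy)//.
by have := normr_coord_enorm (x - y) i; rewrite !mxE.
Qed.

Lemma lipschitz_continuous (h : 'cV[R]_p -> R) (L : R) :
  (forall x y, `|h x - h y| <= L * enorm (x - y)) -> continuous h.
Proof.
move=> hL x; apply/(@cvgrPdist_lt _ _ _ (nbhs x) (nbhs_filter x)) => e e0.
have L1 : 0 < `|L| + 1 by rewrite ltr_wpDl.
have d0 : 0 < e / (`|L| + 1) by rewrite divr_gt0.
apply: filterS (near_enorm x d0) => y xy.
apply: le_lt_trans (hL x y) _.
apply: (@le_lt_trans _ _ ((`|L| + 1) * enorm (x - y))).
  by rewrite ler_wpM2r ?enorm_ge0// (le_trans (ler_norm _))// lerDl.
by rewrite mulrC -ltr_pdivlMr.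
Qed.

Section inf_convolution.
Variables (g : V -> R) (K : R).
Hypotheses (gc : continuous (g : 'cV[R]_p -> R)) (gK : forall x, `|g x| <= K).

(* j-Lipschitz minorants of g, converging to g pointwise. *)
Definition inf_conv (j : nat) x : R :=
  inf (range (fun y => g y + j%:R * enorm (x - y))).

Let lower x j : lbound (range (fun y => g y + j%:R * enorm (x - y))) (- K).
Proof.
move=> _ [y _ <-]; have := gK y; rewrite ler_norml => /andP[h _].
by rewrite (le_trans h)// lerDl mulr_ge0 ?enorm_ge0.
Qed.

Let has_inf_conv x j : has_inf (range (fun y => g y + j%:R * enorm (x - y))).
Proof. by split; [exists (g x + j%:R * enorm (x - x)), x|exists (- K); exact: lower]. Qed.

Lemma inf_conv_le j x y : inf_conv j x <= g y + j%:R * enorm (x - y).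
Proof. by apply: ge_inf; [exact: (has_inf_conv x j).2|exists y]. Qed.

Lemma inf_conv_le_id j x : inf_conv j x <= g x.
Proof. by rewrite (le_trans (inf_conv_le j x x))// subrr enorm0 mulr0 addr0. Qed.

Lemma inf_conv_bound j x : `|inf_conv j x| <= K.
Proof.
rewrite ler_norml; apply/andP; split.
  by apply: lb_le_inf; [exact: (has_inf_conv x j).1|exact: lower].
by rewrite (le_trans (inf_conv_le_id j x))// (le_trans (ler_norm _) (gK x)).
Qed.

Lemma inf_conv_lipschitz j x y : `|inf_conv j x - inf_conv j y| <= j%:R * enorm (x - y).
Proof.
have half x' y' : inf_conv j x' - inf_conv j y' <= j%:R * enorm (x' - y').
  rewrite lerBlDr -lerBlDl; apply: lb_le_inf; first exact: (has_inf_conv y' j).1.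
  move=> _ [z _ <-]; rewrite lerBlDl (le_trans (inf_conv_le j x' z))//.
  rewrite addrCA lerD2l -mulrDr ler_wpM2l//.
  by have := enormD (x' - y') (y' - z); rewrite addrA subrK.
rewrite ler_norml half andbT lerNl opprB.
by apply: le_trans (half _ _) _; rewrite -enormN opprB.
Qed.

(** For y within r of x, continuity keeps g y above g x - e. Farther away the penalty j |x - y| is
    at least 2 K once j >= 2 K / r, which outweighs any drop of g. *)
Lemma inf_conv_cvg x : inf_conv j x @[j --> \oo] --> g x.
Proof.
apply/cvgrPdist_le => e e0.
have /(@cvgrPdist_lt _ _ _ (nbhs x) (nbhs_filter x))/(_ _ e0)/nbhs_enorm[r r0 gr] := @gc x.
have K0 : 0 <= K := le_trans (normr_ge0 _) (gK x).
exists (Num.bound (2 * K / r)) => // j /= nj.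
have jr : 2 * K <= j%:R * r.
  rewrite -ler_pdivrMr// ltW// (lt_le_trans (archi_boundP _))// ?ler_nat//.
  by rewrite (divr_ge0 (mulr_ge0 _ K0) (ltW r0)).
rewrite ger0_norm ?subr_ge0 ?inf_conv_le_id// lerBlDl -lerBlDr.
apply: lb_le_inf; first exact: (has_inf_conv x j).1.
move=> _ [y _ <-]; have [xy|xy] := ltP (enorm (x - y)) r.
  have := gr y xy; rewrite ltr_norml => /andP[_ h].
  have := enorm_ge0 (x - y); have j0 : 0 <= j%:R :> R by [].
  by nra.
have := gK x; have := gK y; rewrite !ler_norml => /andP[h1 h2] /andP[h3 h4].
have j0 : 0 <= j%:R :> R by [].
have : j%:R * r <= j%:R * enorm (x - y) by rewrite ler_wpM2l.
by lra.
Qed.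

Lemma bmf_inf_conv j : bmf (inf_conv j : V -> R).
Proof.
split; last by exists K => x; exact: inf_conv_bound.
apply: continuous_borel_measurableR.
exact: (lipschitz_continuous (inf_conv_lipschitz j)).
Qed.

End inf_convolution.
End lipschitz_approximation.

Section portmanteau.
Context {R : realType} (p : nat).
Local Notation V := (borel 'cV[R]_p).
Context (d : nat -> measure_display) (T : forall n, measurableType (d n))
  (P : forall n, probability (T n) R) (Y : forall n, T n -> V).
Local Arguments Y : clear implicits.
Context d0 (T0 : measurableType d0) (m0 : {measure set T0 -> \bar R})
  (X0 : T0 -> V).
Hypotheses (m01 : m0 setT = 1%E) (mY : forall n, measurable_fun setT (Y n))
  (mX0 : measurable_fun setT X0).
Hypothesis lipschitz_cvg : forall (h : V -> R) (L : R), bmf h ->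
  (forall x y : 'cV[R]_p, `|h x - h y| <= L * enorm (x - y)) ->
  \int[P n]_w h (Y n w) @[n --> \oo] --> \int[m0]_w h (X0 w).

(** Lipschitz minorants of g bound the limit inferior from below; the same for -g, which is the case
    c = -1, bounds the limit superior from above. *)
Lemma continuous_bounded_cvg (g : V -> R) (K : R) : continuous (g : 'cV[R]_p -> R) ->
  (forall x, `|g x| <= K) ->
  \int[P n]_w g (Y n w) @[n --> \oo] --> \int[m0]_w g (X0 w).
Proof.
move=> gc gK; have bg : bmf g.
  by split; [exact: continuous_borel_measurableR|exists K].
have P1 n : P n setT = 1%E by exact: probability_setT.
have lower (c : R) : `|c| = 1 -> forall e, 0 < e ->
    \forall n \near \oo, c * \int[m0]_w g (X0 w) - e <= c * \int[P n]_w g (Y n w).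
  move=> c1 e e0.
  pose h (x : V) := c * g x.
  have hK x : `|h x| <= K by rewrite normrM c1 mul1r.
  have hc : continuous (h : 'cV[R]_p -> R).
    by move=> x; apply: (@cvgM _ _ (nbhs x)); [exact: cvg_cst|exact: gc].
  have bh : bmf h by exact: bmfZ.
  have bj j := bmf_inf_conv hK j.
  have e2 : 0 < e / 2 by rewrite divr_gt0.
  have := @bounded_cvg _ T0 R m0 (fun j w => inf_conv h j (X0 w)) (fun w => h (X0 w)) K m01
    (fun j => (bmf_comp (bj j) mX0).1) (bmf_comp bh mX0)
    (fun j w => inf_conv_bound hK j (X0 w)) (fun w => @inf_conv_cvg _ _ _ _ hc hK (X0 w)).
  move=> /cvgrPdist_le/(_ _ e2)[j _ /(_ j (leqnn j))/=].
  rewrite ler_norml => /andP[_ hj].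
  have /cvgrPdist_le/(_ _ e2) := lipschitz_cvg (bj j) (inf_conv_lipschitz hK j).
  apply: filterS => n; rewrite ler_norml => /andP[_ hn].
  rewrite -(EZ m01 c (bmf_comp bg mX0)) -(EZ (P1 n) c (bmf_comp bg (@mY n))).
  have : \int[P n]_w inf_conv h j (Y n w) <= \int[P n]_w h (Y n w).
    apply: (E_le (P1 n)); [exact: (bmf_comp (bj j) (@mY n))|exact: (bmf_comp bh (@mY n))|].
    by move=> w; exact: (inf_conv_le_id hK).
  by rewrite /h in hj *; lra.
apply/cvgrPdist_le => e e0.
have l1 := lower 1 (normr1 _) e e0; have l2 := lower (-1) (normrN1 _) e e0.
near=> n.
have h1 : 1 * \int[m0]_w g (X0 w) - e <= 1 * \int[P n]_w g (Y n w) by near: n; exact: l1.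
have h2 : -1 * \int[m0]_w g (X0 w) - e <= -1 * \int[P n]_w g (Y n w) by near: n; exact: l2.
by rewrite ler_norml; apply/andP; split; lra.
Unshelve. all: by end_near. Qed.

End portmanteau.

(** * Rotationally symmetric vectors *)

Section eq_integral_set_function.
Import HBNNSimple.

(* The laws in the definitions are bare set functions, pinned down on measurable
   sets only; the integral does not look at other sets. *)
Lemma eq_integral_set_function d (T : measurableType d) (R : realType)
  (m1 m2 : set T -> \bar R) (D : set T) (f : T -> \bar R) :
  (forall A, measurable A -> m1 A = m2 A) ->
  (\int[m1]_(x in D) f x = \int[m2]_(x in D) f x)%E.
Proof.
move=> m12; have e (h : {nnsfun T >-> R}) : sintegral m1 h = sintegral m2 h.
  rewrite !sintegralET; apply: eq_fsbigr => x _.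
  by rewrite m12.
rewrite /integral; congr (ereal_sup _ - ereal_sup _)%E;
  by apply/seteqP; split => _ [h hf <-]; exists h.
Qed.

End eq_integral_set_function.

Section direction_law.
Context {R : realType} (p : nat).
Local Notation V := (borel 'cV[R]_p).

Definition direction (x : 'cV[R]_p) : 'cV[R]_p := (enorm x)^-1 *: x.

Lemma measurable_direction : measurable_fun setT (direction : V -> V).
Proof.
apply: measurable_cVZ; last exact: measurable_id.
by apply: measurable_enormV; exact: measurable_id.
Qed.

Let ball_weight (x : V) : R := p%:R * \1_(@punctured_ball R p) x.

Let measurable_ball_weight : measurable_fun setT ball_weight.
Proof.
apply: measurable_funM => //.
by apply: measurable_indic; exact: measurable_punctured_ball.
Qed.

Let ball_weight_ge0 x : 0 <= ball_weight x.
Proof. by rewrite mulr_ge0. Qed.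

(** The cone formula of [surface_measure] as a genuine measure: p times Lebesgue measure on the
    punctured ball, carried to the sphere by [direction]. *)
Let surface : {measure set V -> \bar R} :=
  pushforward_measure (density_measure (lebp p) measurable_ball_weight ball_weight_ge0)
    measurable_direction.

Let surfaceE (A : set V) : measurable A -> surface_measure A = surface A.
Proof.
move=> mA; have mnA : measurable ((direction : V -> V) @^-1` A).
  by rewrite -[X in measurable X]setTI; exact: measurable_direction.
rewrite /surface_measure.
have mB := @measurable_punctured_ball R p.
rewrite (_ : [set x | _] = punctured_ball (p:=p) `&` (direction : V -> V) @^-1` A); last first.
  by apply/seteqP; split => [x [? ? ?]|x [[? ?] ?]].
rewrite power_measureE; last exact: measurableI.
rewrite /surface /= /pushforward /= /mdensity integral_mkcond.
transitivity (\int[lebp p]_x (p%:R%:E *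
    (\1_(punctured_ball (p:=p) `&` (direction : V -> V) @^-1` A) x)%:E))%E.
  rewrite ge0_integralZlT//; last first.
    by apply/measurable_EFinP/measurable_indic; exact: measurableI.
  by rewrite integral_indic ?setIT//; exact: measurableI.
apply: eq_integral => x _; rewrite patchE /ball_weight indicI/= -EFinM.
rewrite [X in (_ * (_ * X))%:E]indicE.
by case: (x \in direction @^-1` A); rewrite ?mulr1 ?mulr0.
Qed.

Variables (theta : 'cV[R]_p) (kappa : R) (f : R -> R).
Hypotheses (mf : measurable_fun setT f) (f0 : forall x, 0 <= f x).

Definition rot_sym_cst : R := norm_cst p kappa f * Gamma ((p%:R - 1) / 2)
  / (2 * pi `^ ((p%:R - 1) / 2)).

Lemma rot_sym_cst_ge0 : 0 <= rot_sym_cst.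
Proof.
rewrite divr_ge0 ?mulr_ge0 ?powR_ge0//.
  rewrite invr_ge0; apply: Rintegral_ge0 => s _.
  by rewrite mulr_ge0// powR_ge0.
by apply: Rintegral_ge0 => s _; rewrite mulr_ge0 ?powR_ge0// expR_ge0.
Qed.

Let dens : V -> R := rot_sym_density theta kappa f.

Let densE x : dens x = rot_sym_cst * f (kappa * dot x theta).
Proof. by []. Qed.

Let dens_ge0 x : 0 <= dens x.
Proof. by rewrite densE mulr_ge0 ?rot_sym_cst_ge0. Qed.

Let measurable_angular (g : V -> V) : measurable_fun setT g ->
  measurable_fun setT (fun x => f (kappa * dot (g x : 'cV[R]_p) theta)).
Proof.
move=> mg; apply: (measurableT_comp mf); apply: measurable_funM => //.
by apply: measurable_dot => //; exact: measurable_cst.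
Qed.

Let measurable_dens : measurable_fun setT dens.
Proof. by apply: measurable_funM => //; apply: measurable_angular; exact: measurable_id. Qed.

Context d (T : measurableType d) (P : {measure set T -> \bar R}) (X : T -> V).
Hypothesis mX : measurable_fun setT X.
Hypothesis lawX : forall B : set V, measurable B ->
  P (X @^-1` B) = (\int[@surface_measure R p]_(x in B)
    (rot_sym_density theta kappa f x)%:E)%E.

(** Expectations over the sphere become Lebesgue integrals over the ball of functions of the
    direction, to which orthogonal invariance and the polar formula apply. *)
Lemma ge0_integral_rot_sym (G : V -> \bar R) : measurable_fun setT G ->
  (forall x, 0 <= G x)%E ->
  (\int[P]_w G (X w) = (p%:R * rot_sym_cst)%:E * \int[lebp p]_x (G (direction x) *
    (f (kappa * dot (direction x) theta) * \1_(@punctured_ball R p) x)%:E))%E.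
Proof.
move=> mG G0.
rewrite -(ge0_integral_pushforwardT P mX mG G0).
transitivity (\int[density_measure surface measurable_dens dens_ge0]_x G x)%E.
  apply: eq_measure_integral => A mA _.
  rewrite [LHS]lawX//; exact: eq_integral_set_function surfaceE.
rewrite ge0_integral_mdensity//.
have mGd : measurable_fun setT (fun x => (G x * (dens x)%:E)%E).
  by apply: emeasurable_funM => //; exact/measurable_EFinP.
have Gd0 x : (0 <= G x * (dens x)%:E)%E by rewrite mule_ge0// lee_fin.
rewrite ge0_integral_pushforwardT//.
rewrite ge0_integral_mdensity//; last exact: (measurableT_comp mGd measurable_direction).
have mGn := measurableT_comp mG measurable_direction.
rewrite -ge0_integralZlT.
- apply: eq_integral => x _; rewrite /= densE /ball_weight muleCA -muleA; congr (_ * _)%E.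
  by rewrite -!EFinM; congr (_%:E); ring.
- apply: emeasurable_funM => //; apply/measurable_EFinP; apply: measurable_funM.
    exact: (measurable_angular measurable_direction).
  by apply: measurable_indic; exact: measurable_punctured_ball.
- by move=> x; rewrite mule_ge0// lee_fin mulr_ge0.
- by rewrite mulr_ge0// rot_sym_cst_ge0.
Qed.

End direction_law.

(** * Reflections and orthonormal frames *)

Section reflection.
Context {R : realType} (p : nat).
Implicit Types u x y : 'cV[R]_p.

(* Householder reflection: it carries x to y when u = x - y and |x| = |y|. *)
Definition refl u : 'M[R]_p := 1%:M - (2 / dot u u) *: (u *m u^T).

Lemma mulmx_tr_dot u x : u *m (u^T *m x) = dot u x *: u.
Proof. by rewrite [u^T *m x]mx11_scalar mul_mx_scalar. Qed.

Lemma reflE u x : refl u *m x = x - (2 * dot u x / dot u u) *: u.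
Proof.
by rewrite mulmxBl mul1mx -scalemxAl -mulmxA mulmx_tr_dot scalerA mulrAC.
Qed.

Lemma tr_refl u : (refl u)^T = refl u.
Proof. by rewrite linearB/= linearZ/= trmx1 trmx_mul trmxK. Qed.

Lemma refl_involutive u x : u != 0 -> refl u *m (refl u *m x) = x.
Proof.
move=> /dot_gt0/lt0r_neq0 u0; rewrite !reflE dotBr dotZr -addrA -opprD -scalerDl.
set a := dot u x; set b := dot u u in u0 *.
have -> : 2 * a / b + 2 * (a - 2 * a / b * b) / b = 0 by field.
by rewrite scale0r subr0.
Qed.

Lemma orth_refl u : u != 0 -> (refl u)^T *m refl u = 1%:M.
Proof.
move=> u0; rewrite tr_refl; apply/matrixP => i j.
have := refl_involutive (delta_mx j 0) u0; rewrite mulmxA -colE => /matrixP/(_ i 0).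
by rewrite [LHS]mxE => ->; rewrite !mxE andbT.
Qed.

Lemma refl_swap x y : dot x x = dot y y -> x != y -> refl (x - y) *m x = y.
Proof.
move=> xy; rewrite -subr_eq0 => /dot_gt0/lt0r_neq0 u0; rewrite reflE.
have e : dot (x - y) (x - y) = 2 * dot (x - y) x.
  by rewrite !dotBl !dotBr -xy (dotC y x); ring.
by rewrite -e divff// scale1r subKr.
Qed.

Lemma orth_transitive x y : dot x x = dot y y ->
  exists2 S : 'M[R]_p, S^T *m S = 1%:M & S *m x = y.
Proof.
move=> xy; have [->|nxy] := eqVneq x y.
  by exists 1%:M; rewrite ?trmx1 mul1mx.
exists (refl (x - y)); last exact: refl_swap.
by rewrite orth_refl// subr_eq0.
Qed.

End reflection.

(** An orthogonal matrix that sends the first basis vector to theta has theta as its first column;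
    the remaining columns form Q. *)
Lemma orthonormal_complement {R : realType} q (theta : 'cV[R]_q.+1) : dot theta theta = 1 ->
  exists Q : 'M[R]_(q.+1, q), [/\ Q^T *m Q = 1%:M,
    Q *m Q^T = 1%:M - theta *m theta^T & Q^T *m theta = 0].
Proof.
move=> t1; pose e1 : 'cV[R]_(1 + q) := delta_mx 0 0.
have e11 : dot e1 e1 = 1.
  rewrite dotE (bigD1 0)//= big1 ?addr0 ?mxE ?eqxx ?mulr1// => i i0.
  by rewrite mxE (negbTE i0) mul0r.
have [S SS Se] := @orth_transitive R (1 + q) e1 theta (etrans e11 (esym t1)).
have e1E : e1 = col_mx 1%:M 0.
  apply/matrixP => i j; rewrite (ord1 j) !mxE; case: splitP => k ik; rewrite !mxE.
    by rewrite (ord1 k) eqxx andbT -val_eqE/= ik (ord1 k).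
  by rewrite -val_eqE/= ik.
have Sl : lsubmx S = theta.
  by rewrite -Se e1E -[in RHS](hsubmxK S) mul_row_col mulmx1 mulmx0 addr0.
have SE : S = row_mx theta (rsubmx S) by rewrite -Sl hsubmxK.
exists (rsubmx S); move: SS (mulmx1C SS); rewrite SE; set Q := rsubmx S.
rewrite tr_row_mx mul_col_row mul_row_col row_mxKr => h1 h2.
have : block_mx (theta^T *m theta) (theta^T *m Q) (Q^T *m theta) (Q^T *m Q) =
    block_mx 1%:M 0 0 1%:M by rewrite h1 scalar_mx_block.
move=> /eq_block_mx[_ _ h3 h4]; split => //.
by apply/eqP; rewrite eq_sym subr_eq addrC; apply/eqP; rewrite h2.
Qed.

Section rot_sym_law.
Context {R : realType} (q : nat) (q0 : (0 < q)%N).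
Local Notation p := q.+1.
Local Notation V := (borel 'cV[R]_p).
Local Notation mu := (@lebesgue_measure R).
Variables (theta : 'cV[R]_p) (theta1 : dot theta theta = 1).
Variables (Q : 'M[R]_(p, q)).
Hypotheses (QTQ : Q^T *m Q = 1%:M) (QQT : Q *m Q^T = 1%:M - theta *m theta^T)
  (QTtheta : Q^T *m theta = 0).
Variables (kappa : R) (f : R -> R).
Hypotheses (mf : measurable_fun setT f) (f0 : forall s : R, 0 <= f s).

Let thetaTQ : theta^T *m Q = 0.
Proof. by rewrite -[Q]trmxK -trmx_mul QTtheta trmx0. Qed.

Lemma decomposition (x : 'cV[R]_p) : x = dot theta x *: theta + Q *m (Q^T *m x).
Proof. by rewrite mulmxA QQT mulmxBl mul1mx -mulmxA mulmx_tr_dot addrC subrK. Qed.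

Lemma dot_decomposition (x : 'cV[R]_p) :
  dot x x = dot theta x ^+ 2 + dot (Q^T *m x) (Q^T *m x).
Proof.
transitivity (dot (dot theta x *: theta + Q *m (Q^T *m x)) x).
  by rewrite -decomposition.
by rewrite dotDl dotZl dot_mulmxl expr2.
Qed.

(** The extension of S to the whole space that fixes theta: it acts as S on the complement, in the
    coordinates given by Q. *)
Let rotation (S : 'M[R]_q) : 'M[R]_p := theta *m theta^T + Q *m S *m Q^T.

Let thetaT_theta : theta^T *m theta = 1%:M.
Proof. by rewrite [LHS]mx11_scalar -[X in X%:M]/(dot theta theta) theta1. Qed.

Let rotation_theta S : rotation S *m theta = theta.
Proof. by rewrite mulmxDl -!mulmxA QTtheta !mulmx0 addr0 thetaT_theta mulmx1. Qed.

Let rotation_Q S (x : 'cV[R]_p) : Q^T *m (rotation S *m x) = S *m (Q^T *m x).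
Proof.
by rewrite /rotation mulmxA mulmxDr !mulmxA QTtheta mul0mx add0r QTQ mul1mx.
Qed.

Let orth_rotation S : S^T *m S = 1%:M -> (rotation S)^T *m rotation S = 1%:M.
Proof.
move=> SS; have trD (A B : 'M[R]_p) : (A + B)^T = A^T + B^T by apply/matrixP => i j; rewrite !mxE.
rewrite /rotation trD !trmx_mul !trmxK mulmxDl !mulmxDr.
rewrite -!mulmxA (mulmxA theta^T theta) thetaT_theta mul1mx.
rewrite (mulmxA theta^T Q) thetaTQ mul0mx mulmx0 addr0.
rewrite (mulmxA Q^T theta) QTtheta mul0mx !mulmx0 add0r.
by rewrite (mulmxA Q^T Q) QTQ mul1mx (mulmxA S^T) SS mul1mx QQT addrC subrK.
Qed.

(** An orthogonal matrix with first row theta': it turns X'theta into the first coordinate, as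
    [ge0_integral_polar] requires. *)
Let frame : 'M[R]_p := col_mx theta^T Q^T.

Let orth_frame : frame^T *m frame = 1%:M.
Proof. have := @mul_row_col R p 1 q p theta Q theta^T Q^T; rewrite QQT addrC subrK => <-.
by rewrite /frame (@tr_col_mx _ 1 q p) !trmxK.
Qed.

Let frame0 (x : 'cV[R]_p) : (frame *m x) 0 0 = dot theta x.
Proof.
rewrite mxE dotE; apply: eq_bigr => j _; congr (_ * _); rewrite /frame mxE.
case: splitP => [k _|k /=]; last by rewrite add1n.
by rewrite mxE (ord1 k).
Qed.

Section one_variable.
Context d (T : measurableType d) (P : {measure set T -> \bar R}) (X : T -> V).
Hypotheses (P1 : P setT = 1%E) (mX : measurable_fun setT X).
Hypothesis sX : forall w, dot (X w) (X w) = 1.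
Hypothesis lawX : forall B : set V, measurable B ->
  P (X @^-1` B) = (\int[@surface_measure R p]_(x in B)
    (rot_sym_density theta kappa f x)%:E)%E.

Let u w := dot theta (X w).
Let xi w : 'cV[R]_q := Q^T *m (X w : 'cV[R]_p).

Let weightF (x : V) : R := f (kappa * dot (direction x) theta) * \1_(@punctured_ball R p) x.

Let weightF_ge0 x : 0 <= weightF x.
Proof. by rewrite mulr_ge0. Qed.

Let measurable_weightF : measurable_fun setT weightF.
Proof.
apply: measurable_funM.
  apply: (measurableT_comp mf); apply: measurable_funM => //.
  by apply: measurable_dot; [exact: measurable_direction|exact: measurable_cst].
by apply: measurable_indic; exact: measurable_punctured_ball.
Qed.

Let direction_orth (H : 'M[R]_p) x : H^T *m H = 1%:M -> direction (H *m x) = H *m direction x.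
Proof. by move=> HH; rewrite /direction orth_enorm// scalemxAr. Qed.

Let indic_orth (H : 'M[R]_p) (x : 'cV[R]_p) : H^T *m H = 1%:M ->
  \1_(@punctured_ball R p) (H *m x) = \1_(@punctured_ball R p) x :> R.
Proof.
move=> HH; rewrite !indicE; congr (_%:R); congr nat_of_bool.
have e : (H *m x != 0) = (x != 0) by rewrite -!enorm_gt0 orth_enorm.
by apply/idP/idP; rewrite !inE /punctured_ball /= orth_enorm// e.
Qed.

Let ge0_rot_invariant (G : V -> \bar R) (S : 'M[R]_p) : measurable_fun setT G ->
  (forall x, 0 <= G x)%E -> S^T *m S = 1%:M -> S *m theta = theta ->
  (\int[P]_w G (S *m (X w : 'cV[R]_p)) = \int[P]_w G (X w))%E.
Proof.
move=> mG G0 SS St.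
have mS : measurable_fun setT (fun x : V => S *m (x : 'cV[R]_p) : V).
  by apply: measurable_cV_mulmx; exact: measurable_id.
have mGS : measurable_fun setT (fun x : V => G (S *m (x : 'cV[R]_p))).
  exact: (measurableT_comp mG mS).
rewrite (ge0_integral_rot_sym mf f0 mX lawX mGS)// (ge0_integral_rot_sym mf f0 mX lawX mG)//.
congr (_ * _)%E.
pose F (x : V) : \bar R := (G (direction x) * (weightF x)%:E)%E.
have mF : measurable_fun setT F.
  apply: emeasurable_funM; last exact/measurable_EFinP.
  exact: (measurableT_comp mG (@measurable_direction R p)).
have F0 x : (0 <= F x)%E by rewrite mule_ge0// lee_fin.
rewrite -[RHS](ge0_integral_lebp_orth SS mF F0); apply: eq_integral => x _.
rewrite /F /weightF direction_orth// indic_orth//; congr (_ * (f (_ * _) * _)%:E)%E.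
by rewrite -{2}St orth_dot.
Qed.

(** The matrix [rotation S] preserves Lebesgue measure, the ball and, as it fixes theta, the
    density; hence it preserves the law of X. *)
Lemma rot_invariant (g : V -> R) (S : 'M[R]_q) : bmf g -> S^T *m S = 1%:M ->
  \int[P]_w g (u w *: theta + Q *m (S *m xi w)) = \int[P]_w g (X w).
Proof.
move=> bg SS; have [M gM0] := bmf_shift_ge0 bg.
have mg : measurable_fun setT (fun x => (g x + M)%:E).
  by apply/measurable_EFinP; apply: measurable_funD => //; case: bg.
have := ge0_rot_invariant mg (fun x => gM0 x) (orth_rotation SS) (rotation_theta S).
have mS : measurable_fun setT (fun w => rotation S *m (X w : 'cV[R]_p) : V).
  exact: measurable_cV_mulmx.
have b1 := bmf_comp bg mS; have b2 := bmf_comp bg mX; have bM := @bmf_cst _ T R M.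
rewrite (EFin_E P1 (bmfD b1 bM)) (EFin_E P1 (bmfD b2 bM)).
rewrite (ED P1 b1 bM) (ED P1 b2 bM) => -[] /addIr <-.
apply: E_eq => w; congr g; rewrite [in RHS](decomposition (rotation S *m _)).
rewrite rotation_Q; congr (_ *: _ + _).
by rewrite /u -{2}(rotation_theta S) orth_dot//; exact: orth_rotation.
Qed.

(** Turning theta into the first axis reduces this to the polar formula; the exponent (q - 2)/2 is
    (p - 3)/2. *)
Lemma ge0_integral_cosine_law (g : R -> R) : measurable_fun setT g -> (forall s, 0 <= g s) ->
  (\int[P]_w (g (u w))%:E = (p%:R * rot_sym_cst p kappa f)%:E * polar_const q *
   \int[mu]_(s in `](-1)%R, 1%R[) (g s * f (kappa * s) * (1 - s ^+ 2) `^ ((q%:R - 2) / 2))%:E)%E.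
Proof.
move=> mg g0.
pose G (x : V) : \bar R := (g (dot theta (x : 'cV[R]_p)))%:E.
have mG : measurable_fun setT G.
  apply/measurable_EFinP; apply: (measurableT_comp mg).
  by apply: measurable_dotl; exact: measurable_id.
have G0 x : (0 <= G x)%E by rewrite lee_fin.
rewrite -/(G _) [LHS](ge0_integral_rot_sym mf f0 mX lawX mG G0) -muleA; congr (_ * _)%E.
pose g' (s : measurableTypeR R) : \bar R := (g s * f (kappa * s))%:E.
have mg' : measurable_fun setT g'.
  apply/measurable_EFinP; apply: measurable_funM => //.
  by apply: (measurableT_comp mf); exact: measurable_funM.
have g'0 s : (0 <= g' s)%E by rewrite lee_fin mulr_ge0.
have := ge0_integral_polar q0 mg' g'0.
rewrite [X in _ = (_ * X)%E -> _](_ : _ = \int[mu]_(s in `](-1)%R, 1%R[)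
  (g s * f (kappa * s) * (1 - s ^+ 2) `^ ((q%:R - 2) / 2))%:E)%E; last first.
  by apply: eq_integral => s _; rewrite -EFinM.
move=> <-.
pose F (x : V) : \bar R := (g' ((x : 'cV[R]_p) 0 0 / enorm (x : 'cV[R]_p))%R *
      (\1_(@punctured_ball R p) x)%:E)%E.
have mF : measurable_fun setT F.
  apply: emeasurable_funM; last first.
    by apply/measurable_EFinP/measurable_indic; exact: measurable_punctured_ball.
  apply: (measurableT_comp mg'); apply: measurable_funM; first exact: measurable_coord.
  exact: (@measurable_enormV R _ V p id (@measurable_id _ _ _)).
have F0 x : (0 <= F x)%E by rewrite mule_ge0// lee_fin.
rewrite -[RHS](ge0_integral_lebp_orth orth_frame mF F0); apply: eq_integral => x _.
rewrite /F indic_orth// frame0 orth_enorm// /G /g' -!EFinM /direction dotZl dotZr.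
rewrite -[in RHS]mulrA [dot (x : 'cV[R]_p) theta]dotC.
by congr (g _ * (f (_ * _) * _))%:E; rewrite mulrC.
Qed.

End one_variable.
End rot_sym_law.

Section rot_sym_moments.
Context {R : realType} (q : nat) (q0 : (0 < q)%N).
Local Notation p := q.+1.
Local Notation V := (borel 'cV[R]_p).
Variables (theta : 'cV[R]_p) (theta1 : dot theta theta = 1).
Variables (Q : 'M[R]_(p, q)).
Hypotheses (QTQ : Q^T *m Q = 1%:M) (QQT : Q *m Q^T = 1%:M - theta *m theta^T)
  (QTtheta : Q^T *m theta = 0).
Variables (f : R -> R) (Ff : class_F f).

Let mf := measurable_class_F Ff.
Let f0 := class_F_ge0 Ff.

Definition rot_sym_variable (kappa : R) d (T : measurableType d)
    (P : {measure set T -> \bar R}) (X : T -> V) : Prop :=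
  [/\ P setT = 1%E, measurable_fun setT X, (forall w, dot (X w) (X w) = 1)
    & forall B : set V, measurable B ->
      P (X @^-1` B) = (\int[@surface_measure R p]_(x in B)
        (rot_sym_density theta kappa f x)%:E)%E].

Section one_variable.
Variables (kappa : R).
Context d (T : measurableType d) (P : {measure set T -> \bar R}) (X : T -> V).
Hypothesis rX : rot_sym_variable kappa P X.

Let P1 : P setT = 1%E. Proof. by case: rX. Qed.
Let mX : measurable_fun setT X. Proof. by case: rX. Qed.
Let sX w : dot (X w) (X w) = 1. Proof. by case: rX. Qed.

Let u w := dot theta (X w).
Let xi w : 'cV[R]_q := Q^T *m (X w : 'cV[R]_p).

Lemma dot_xi w : dot (xi w) (xi w) = 1 - u w ^+ 2.
Proof. by have := dot_decomposition QQT (X w); rewrite sX => ->; rewrite addrC addKr. Qed.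

Let dot_theta_mix (s : R) (y : 'cV[R]_q) : dot theta (s *: theta + Q *m y) = s.
Proof. by rewrite dotDr dotZr theta1 mulr1 dot_mulmxr QTtheta dot0l addr0. Qed.

Let QT_mix (s : R) (y : 'cV[R]_q) : Q^T *m (s *: theta + Q *m y) = y.
Proof. by rewrite mulmxDr -scalemxAr QTtheta scaler0 add0r mulmxA QTQ mul1mx. Qed.

(** Meant for g that are bounded on the sphere only, such as linear forms; the rotated vector stays
    on the sphere, so truncating g changes neither side. *)
Lemma rot_invariant_sphere (g : V -> R) (M : R) (S : 'M[R]_q) : measurable_fun setT g ->
  (forall x : 'cV[R]_p, dot x x = 1 -> `|g x| <= M) -> S^T *m S = 1%:M ->
  \int[P]_w g (u w *: theta + Q *m (S *m xi w)) = \int[P]_w g (X w).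
Proof.
move=> mg gM SS; have [_ _ _ lawX] := rX.
have M0 : 0 <= M := le_trans (normr_ge0 _) (gM _ theta1).
pose g' := clip M g; have bg : bmf g' := bmf_clip M0 mg.
have g'E (x : 'cV[R]_p) : dot x x = 1 -> g' x = g x by move=> /gM; exact: clipE.
have sSX w : dot (u w *: theta + Q *m (S *m xi w)) (u w *: theta + Q *m (S *m xi w)) = 1.
  rewrite (dot_decomposition QQT) dot_theta_mix QT_mix orth_dot//.
  by rewrite dot_xi addrC subrK.
have h := rot_invariant theta1 QTQ QQT QTtheta mf f0 P1 mX lawX bg SS.
transitivity (\int[P]_w g' (X w)); last by apply: E_eq => w; rewrite g'E.
by rewrite -h; apply: E_eq => w; exact/esym/g'E/sSX.
Qed.

Let orthN1 : (- 1%:M : 'M[R]_q)^T *m - 1%:M = 1%:M.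
Proof.
have -> : (- 1%:M)^T = - 1%:M :> 'M[R]_q by apply/matrixP => i j; rewrite !mxE eq_sym.
by rewrite mulNmx mul1mx opprK.
Qed.

(** The choice S = -1 flips the tangential part, so the expectation equals its own opposite. *)
Lemma E_odd (g : V -> R) (M : R) : measurable_fun setT g ->
  (forall x : 'cV[R]_p, dot x x = 1 -> `|g x| <= M) ->
  (forall w, g (u w *: theta - Q *m xi w) = - g (X w)) -> \int[P]_w g (X w) = 0.
Proof.
move=> mg gM go; have := rot_invariant_sphere mg gM orthN1.
have bg : bmf (fun w => g (X w)).
  by split; [exact: (measurableT_comp mg mX)|exists M => w; exact: gM].
rewrite (_ : \int[P]_w _ = \int[P]_w (-1 * g (X w))); last first.
  by apply: E_eq => w; rewrite mulNmx mul1mx mulmxN go mulN1r.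
by rewrite (EZ P1 _ bg) => ?; lra.
Qed.

Let mQT (t : 'cV[R]_q) : measurable_fun setT (fun x : V => dot t (Q^T *m (x : 'cV[R]_p))).
Proof. by apply: measurable_dotl; apply: measurable_cV_mulmx; exact: measurable_id. Qed.

Let mtheta : measurable_fun setT (fun x : V => dot theta (x : 'cV[R]_p)).
Proof. by apply: measurable_dotl; exact: measurable_id. Qed.

Let normr_dotQ (t : 'cV[R]_q) (x : 'cV[R]_p) : dot x x = 1 -> `|dot t (Q^T *m x)| <= enorm t.
Proof.
move=> x1; apply: le_trans (normr_dot _ _) _; rewrite ler_piMr ?enorm_ge0//.
rewrite /enorm -[leRHS]sqrtr1 ler_wsqrtr// -x1 (dot_decomposition QQT x) lerDr.
exact: sqr_ge0.
Qed.

Let normr_dot_theta (x : 'cV[R]_p) : dot x x = 1 -> `|dot theta x| <= 1.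
Proof.
by move=> x1; apply: le_trans (normr_dot _ _) _; rewrite /enorm theta1 x1 sqrtr1 mulr1.
Qed.

Let QT_flip w : Q^T *m (u w *: theta - Q *m xi w) = - xi w.
Proof. by rewrite -mulmxN QT_mix. Qed.

Let theta_flip w : dot theta (u w *: theta - Q *m xi w) = u w.
Proof. by rewrite -mulmxN dot_theta_mix. Qed.

Lemma normr_u w : `|u w| <= 1. Proof. exact: normr_dot_theta. Qed.

Lemma bmf_u : bmf u.
Proof. by split; [exact: (measurableT_comp mtheta mX)|exists 1; exact: normr_u]. Qed.

Lemma bmf_xi t : bmf (fun w => dot t (xi w)).
Proof.
by split; [exact: (measurableT_comp (mQT t) mX)|exists (enorm t) => w; exact: normr_dotQ].
Qed.

Lemma E_sin_xi t : \int[P]_w sin (dot t (xi w)) = 0.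
Proof.
apply: (@E_odd (fun x => sin (dot t (Q^T *m (x : 'cV[R]_p)))) 1).
- by have [] := bmf_sin (mQT t).
- by move=> x _; exact: sin_max.
- by move=> w; rewrite QT_flip dotNr sinN.
Qed.

Lemma E_dot_xi t : \int[P]_w dot t (xi w) = 0.
Proof.
apply: (@E_odd (fun x => dot t (Q^T *m (x : 'cV[R]_p))) (enorm t)).
- exact: mQT.
- by move=> x; exact: normr_dotQ.
- by move=> w; rewrite QT_flip dotNr.
Qed.

Lemma E_u_dot_xi t : \int[P]_w (u w * dot t (xi w)) = 0.
Proof.
apply: (@E_odd (fun x => dot theta (x : 'cV[R]_p) * dot t (Q^T *m (x : 'cV[R]_p)))
  (1 * enorm t)).
- exact: measurable_funM.
- by move=> x x1; rewrite normrM ler_pM ?normr_dotQ ?normr_dot_theta.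
- by move=> w; rewrite QT_flip theta_flip dotNr mulrN.
Qed.

Let E_sqr_xi_eq (s t : 'cV[R]_q) : dot s s = dot t t ->
  \int[P]_w dot s (xi w) ^+ 2 = \int[P]_w dot t (xi w) ^+ 2.
Proof.
move=> /orth_transitive[S SS St].
have STS : S^T^T *m S^T = 1%:M by rewrite trmxK; exact: mulmx1C.
have := @rot_invariant_sphere (fun x => dot s (Q^T *m (x : 'cV[R]_p)) ^+ 2) (enorm s ^+ 2) S^T _ _ STS.
rewrite /= => <- //.
- by apply: E_eq => w; rewrite QT_mix dot_mulmxr trmxK St.
- exact: measurable_funX.
- by move=> x x1; rewrite normrX lerXn2r ?nnegrE ?enorm_ge0// normr_dotQ.
Qed.

(** By isotropy the second moment of t'xi depends on |t| only. Summed over an orthonormal basis it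
    gives E |xi|^2 = E (1 - u^2), so each direction receives a share 1/q. *)
Lemma E_sqr_dot_xi t :
  \int[P]_w dot t (xi w) ^+ 2 = dot t t * \int[P]_w (1 - u w ^+ 2) / q%:R.
Proof.
pose e (i : 'I_q) : 'cV[R]_q := delta_mx i 0.
have dot_e i (x : 'cV[R]_q) : dot (e i) x = x i 0 := dot_delta i x.
have h i : \int[P]_w dot t (xi w) ^+ 2 = dot t t * \int[P]_w (xi w i 0) ^+ 2.
  rewrite (@E_sqr_xi_eq t (enorm t *: e i)); last first.
    by rewrite dotZl dotZr dot_e mxE !eqxx mulr1 -expr2 enorm_sqr.
  have be : bmf (fun w => dot (e i) (xi w) ^+ 2) by apply: bmfX; exact: bmf_xi.
  rewrite -enorm_sqr; transitivity (enorm t ^+ 2 * \int[P]_w dot (e i) (xi w) ^+ 2).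
    by rewrite -(EZ P1 _ be); apply: E_eq => w; rewrite dotZl exprMn.
  by congr (_ * _); apply: E_eq => w; rewrite dot_e.
have bi (i : 'I_q) : bmf (fun w => (xi w i 0) ^+ 2).
  by under [X in bmf X]funext do rewrite -dot_e; apply: bmfX; exact: bmf_xi.
have -> : \int[P]_w (1 - u w ^+ 2) = \sum_i \int[P]_w (xi w i 0) ^+ 2.
  rewrite -(E_sum P1)//; apply: E_eq => w; rewrite -dot_xi dotE.
  by apply: eq_bigr => i _; rewrite expr2.
rewrite mulr_sumr; under eq_bigr do rewrite -h.
by rewrite sumr_const card_ord -[X in X / _]mulr_natr mulfK// pnatr_eq0 -lt0n.
Qed.

End one_variable.

(** A ratio of two moments, with exponents raised by a and b in the numerator and plain in the
    denominator, in which the powers of the rate combine to -a. The quantifier over spaces stands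
    inside the filter, so that one threshold on k serves all n and all i. *)
Lemma cosine_moment_bounds (a b : nat) : exists c : R * R, 0 < c.1 /\
  \forall k \near +oo, forall d (T : measurableType d) (P : {measure set T -> \bar R})
    (X : T -> V), rot_sym_variable k P X ->
  c.1 / (k * phi f k) ^+ a <=
    \int[P]_w ((1 - dot theta (X w)) ^+ a * (1 + dot theta (X w)) ^+ b) <=
  c.2 / (k * phi f k) ^+ a.
Proof.
pose eta : R := (q%:R - 2) / 2.
have q1 : 1 <= q%:R :> R by rewrite ler1n.
have eta1 : -1 < eta by rewrite /eta; lra.
have etan (n : nat) : -1 < eta + n%:R by rewrite ltr_wpDr.
have [[c C]/= [c0 cC]] := moment_bounds Ff eta1 eta1.
have [[c' C']/= [c'0 cC']] := moment_bounds Ff (etan a) (etan b).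
have rate1 : \forall k \near +oo, 1 <= k * phi f k by have /cvgryPge := rate_cvg Ff; exact.
(* Not stated by [moment_bounds], but forced by its positive lower bound at one large k. *)
have C0 : 0 < C.
  have [k [k1 k2 _]] : exists k : R, [/\ 1 <= k * phi f k, ((c / (k * phi f k) `^ (eta + 1))%:E <=
      (C / (k * phi f k) `^ (eta + 1))%:E)%E & True].
    near +oo_R => k; exists k; split=> //; first by near: k.
    have /andP[] : ((c / (k * phi f k) `^ (eta + 1))%:E <= moment f eta eta k <=
      (C / (k * phi f k) `^ (eta + 1))%:E)%E by near: k; exact: cC.
    exact: le_trans.
  have k0 : 0 < (k * phi f k) `^ (eta + 1) by rewrite powR_gt0// (lt_le_trans _ k1).
  by move: k2; rewrite lee_fin ler_pM2r ?invr_gt0//; apply: lt_le_trans.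
exists (c' / C, C' / c); split => /=; first by rewrite divr_gt0.
near=> k.
have k0 : 0 < k by near: k; exact: nbhs_pinfty_gt.
have A1 : 1 <= k * phi f k by near: k; exact: rate1.
have /andP[l1 l2] : ((c / (k * phi f k) `^ (eta + 1))%:E <= moment f eta eta k <=
  (C / (k * phi f k) `^ (eta + 1))%:E)%E by near: k; exact: cC.
have /andP[l3 l4] : ((c' / (k * phi f k) `^ (eta + a%:R + 1))%:E <=
    moment f (eta + a%:R) (eta + b%:R) k <=
  (C' / (k * phi f k) `^ (eta + a%:R + 1))%:E)%E by near: k; exact: cC'.
set A := k * phi f k in A1 l1 l2 l3 l4 *.
have A0 : 0 < A by exact: lt_le_trans A1.
move=> d T P X rX; have [P1 mX sX lawX] := rX.
have fk := class_F_gt0 Ff k0.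
pose u w := dot theta (X w).
have bu : bmf u by exact: bmf_u rX.
(* All the constants that are not computed, the same for every pair of exponents; the pair (0, 0)
   determines their product, since [P] has mass 1. *)
pose K : \bar R := ((p%:R * rot_sym_cst p k f)%:E * polar_const q * (f k)%:E)%E.
have key (n m : nat) : (\int[P]_w ((1 - u w) ^+ n * (1 + u w) ^+ m)%:E =
    K * moment f (eta + n%:R) (eta + m%:R) k)%E.
  pose g s : R := `|1 - s| ^+ n * `|1 + s| ^+ m.
  have mg : measurable_fun setT g.
    apply: measurable_funM; apply: measurable_funX; apply: measurableT_comp => //.
      exact: measurable_funB.
    exact: measurable_funD.
  have g0 s : 0 <= g s by rewrite mulr_ge0.
  have mfk : measurable_fun setT (fun s : R => f (k * s)).
    by apply: (measurableT_comp mf); exact: measurable_funM.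
  transitivity (\int[P]_w (g (u w))%:E)%E.
    apply: eq_integral => w _; rewrite /g !ger0_norm//.
      by have := normr_u rX w; rewrite ler_norml => /andP[? _]; rewrite /u; lra.
    by have := normr_u rX w; rewrite ler_norml => /andP[_ ?]; rewrite /u; lra.
  rewrite [LHS](ge0_integral_cosine_law q0 QQT mf f0 mX lawX mg g0) /K -[RHS]muleA.
  congr (_ * _)%E; rewrite /moment.
  pose h (s : measurableTypeR R) : \bar R :=
    (weight (eta + n%:R) (eta + m%:R) s * (f (k * s) / f k))%:E.
  have mh : measurable_fun setT h.
    apply/measurable_EFinP; apply: measurable_funM; first exact: measurable_weight.
    exact: measurable_funM.
  have h0 s : (0 <= h s)%E.
    by rewrite lee_fin mulr_ge0 ?weight_ge0// divr_ge0.
  rewrite -/h (@integral_itv_bndoo _ (-1) 1 _ true false); last exact: measurable_funTS.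
  rewrite -ge0_integralZl//; last 3 first.
  - exact: measurable_funTS.
  - by move=> s _; exact: h0.
  - by rewrite lee_fin ltW.
  apply: eq_integral => s; rewrite inE/= in_itv/= => /andP[s1 s2].
  rewrite /h -EFinM /g /weight; congr (_%:E).
  have p1 : 0 < 1 - s by lra.
  have p2 : 0 < 1 + s by lra.
  rewrite !powRD ?(gt_eqF p1) ?(gt_eqF p2) ?implybT// !powR_mulrn ?(ltW p1) ?(ltW p2)//.
  rewrite (ger0_norm (ltW p1)) (ger0_norm (ltW p2)).
  have -> : 1 - s ^+ 2 = (1 - s) * (1 + s) by ring.
  rewrite powRM ?(ltW p1) ?(ltW p2)// -/eta.
  by field; rewrite gt_eqF.
have K0 : (0 <= K)%E.
  rewrite mule_ge0// ?lee_fin ?(ltW fk)// mule_ge0// ?lee_fin ?(mulr_ge0 _ (rot_sym_cst_ge0 p k f0))//.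
  by apply: integral_ge0 => v _; rewrite lee_fin mulr_ge0// enorm_ge0.
have Aeta : 0 < A `^ (eta + 1) by rewrite powR_gt0.
have one : (K * moment f eta eta k = 1)%E.
  have := key 0%N 0%N; rewrite !addr0 => <-.
  under eq_integral do rewrite !expr0 mulr1.
  by rewrite (integral_cst P measurableT 1%E) mul1e.
(* The factor [polar_const] is an extended real; the value +oo is excluded because [K] times a
   positive moment is 1. *)
have [r KE] : exists r, K = r%:E.
  move: one K0; case: (K) => [r _ _|one _|]//; first by exists r.
  exfalso; move: one; rewrite gt0_mulye//.
  by apply: lt_le_trans l1; rewrite lte_fin divr_gt0.
have [m0 m0E] : exists m0, moment f eta eta k = m0%:E.
  by move: l1 l2; case: (moment _ _ _ _) => [m0 _ _|_|]//; exists m0.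
have [m1 m1E] : exists m1, moment f (eta + a%:R) (eta + b%:R) k = m1%:E.
  by move: l3 l4; case: (moment _ _ _ _) => [m1 _ _|_|]//; exists m1.
have -> : \int[P]_w ((1 - u w) ^+ a * (1 + u w) ^+ b) = r * m1.
  by rewrite /Rintegral key KE m1E.
move: one K0; rewrite KE m0E -EFinM lee_fin => -[one] r0.
move: l1 l2 l3 l4; rewrite m0E m1E !lee_fin => l1 l2 l3 l4.
have BE : A `^ (eta + a%:R + 1) = A `^ (eta + 1) * A ^+ a.
  have -> : eta + a%:R + 1 = (eta + 1) + a%:R by ring.
  by rewrite (@powRD _ A (eta + 1) a%:R) ?(gt_eqF A0) ?implybT// powR_mulrn// ltW.
rewrite BE in l3 l4; set B := A `^ (eta + 1) in Aeta l1 l2 l3 l4.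
have Aa : 0 < A ^+ a by rewrite exprn_gt0.
have BA : 0 < B * A ^+ a by rewrite mulr_gt0.
have r1 : r <= B / c.
  by have := ler_wpM2l r0 l1; rewrite one mulrA ler_pdivrMr// mul1r => h; rewrite ler_pdivlMr.
have r2 : B / C <= r.
  by have := ler_wpM2l r0 l2; rewrite one mulrA ler_pdivlMr// mul1r => h; rewrite ler_pdivrMr.
apply/andP; split.
  apply: (@le_trans _ _ (B / C * (c' / (B * A ^+ a)))).
    by rewrite le_eqVlt; apply/orP; left; apply/eqP; field; rewrite !gt_eqF.
  by rewrite ler_pM// divr_ge0// ltW.
apply: (@le_trans _ _ (B / c * (C' / (B * A ^+ a)))).
  by rewrite ler_pM// (le_trans _ l3)// divr_ge0// ltW.
by rewrite le_eqVlt; apply/orP; left; apply/eqP; field; rewrite !gt_eqF.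
Unshelve. all: by end_near. Qed.

End rot_sym_moments.

(** * Independent sums *)

Section independence.
Context d (T : measurableType d) {R : realType} (P : {measure set T -> \bar R}).
Hypothesis P1 : P setT = 1%E.
Context d' (S : measurableType d').

(** Two image measures under X, with densities W and c, agree on measurable sets and hence integrate
    g alike. Densities must be nonnegative, so constants are added to g and W and removed by
    linearity; c is the mean of W, as the case B = setT shows. *)
Lemma E_indic_mul_cst (X : T -> S) (W : T -> R) (c : R) : measurable_fun setT X -> bmf W ->
  (forall B, measurable B -> \int[P]_w (\1_B (X w) * W w) = \int[P]_w \1_B (X w) * c) ->
  forall g : S -> R, bmf g -> \int[P]_w (g (X w) * W w) = \int[P]_w g (X w) * c.
Proof.
move=> mX.
have b1 B : measurable B -> bmf (fun w => \1_B (X w) : R).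
  by move=> mB; exact: (bmf_comp (bmf_indic mB) mX).
have nonneg W' c' (g : S -> R) : bmf W' -> (forall w, 0 <= W' w) -> 0 <= c' -> bmf g ->
    (forall x, 0 <= g x) ->
    (forall B, measurable B -> \int[P]_w (\1_B (X w) * W' w) = \int[P]_w \1_B (X w) * c') ->
    \int[P]_w (g (X w) * W' w) = \int[P]_w g (X w) * c'.
  move=> bW W0 c0 bg g0 H.
  have mW : measurable_fun setT W' by case: bW.
  have mc : measurable_fun setT (fun _ : T => c') by exact: measurable_cst.
  have mg : measurable_fun setT (EFin \o g) by apply/measurable_EFinP; case: bg.
  pose m1 := pushforward_measure (density_measure P mW W0) mX.
  pose m2 := pushforward_measure (density_measure P mc (fun _ => c0)) mX.
  have m12 A : measurable A -> A `<=` setT -> m1 A = m2 A.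
    move=> mA _; rewrite /m1 /m2 /= /pushforward /= /mdensity.
    rewrite integral_mkcond [RHS]integral_mkcond.
    transitivity (\int[P]_w (\1_A (X w) * W' w)%:E)%E.
      apply: eq_integral => w _; rewrite patchE indicE.
      rewrite (_ : (w \in X @^-1` A) = (X w \in A)); last first.
        by apply/idP/idP; rewrite !inE.
      by case: (X w \in A); rewrite ?mul1r ?mul0r.
    transitivity (\int[P]_w (c' * \1_A (X w))%:E)%E; last first.
      apply: eq_integral => w _; rewrite patchE indicE.
      rewrite (_ : (w \in X @^-1` A) = (X w \in A)); last first.
        by apply/idP/idP; rewrite !inE.
      by case: (X w \in A); rewrite ?mulr1 ?mulr0.
    rewrite (EFin_E P1 (bmfM (b1 _ mA) bW)) (EFin_E P1 (bmfZ c' (b1 _ mA))).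
    by rewrite (EZ P1 _ (b1 _ mA)) H// mulrC.
  have := @eq_measure_integral _ S R setT m2 m1 (EFin \o g) m12.
  rewrite !ge0_integral_pushforwardT//; try by move=> x; rewrite lee_fin.
  have mgX := measurableT_comp mg mX.
  have gX0 w : (0 <= (g (X w))%:E)%E by rewrite lee_fin.
  rewrite (ge0_integral_mdensity P mW W0 mgX gX0).
  rewrite (ge0_integral_mdensity P mc (fun _ => c0) mgX gX0).
  have bgX := bmf_comp bg mX.
  rewrite /= (EFin_E P1 (bmfM bgX bW)) (EFin_E P1 (bmfM bgX (bmf_cst c'))) => -[->].
  by rewrite mulrC -(EZ P1 _ bgX); apply: E_eq => w; rewrite mulrC.
move=> bW H g bg.
have [M WM] := bmf_shift_ge0 bW; have [N gN] := bmf_shift_ge0 bg.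
have cE : c = \int[P]_w W w.
  have := H setT measurableT.
  rewrite (_ : \int[P]_w _ = \int[P]_w W w); last first.
    by apply: E_eq => w; rewrite indicT mul1r.
  rewrite (_ : \int[P]_w \1__ _ = 1) ?mul1r//.
  by rewrite -[RHS](Ecst P1 1); apply: E_eq => w; rewrite indicT.
have bM := @bmf_cst _ T R M; have bN := @bmf_cst _ T R N; have bgX := bmf_comp bg mX.
have cM : 0 <= c + M.
  by rewrite cE -(Ecst P1 M) -(ED P1 bW bM); apply: E_ge0.
have := nonneg _ _ _ (bmfD bW bM) WM cM (bmfD bg (bmf_cst N)) gN.
have HM B : measurable B ->
    \int[P]_w (\1_B (X w) * (W w + M)) = \int[P]_w \1_B (X w) * (c + M).
  move=> mB; have bB := b1 _ mB.
  rewrite mulrDr -H// [X in _ + X]mulrC -(EZ P1 _ bB) -(ED P1 (bmfM bB bW) (bmfZ M bB)).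
  by apply: E_eq => w; ring.
move=> /(_ HM).
have e1 : \int[P]_w ((g (X w) + N) * (W w + M)) =
    \int[P]_w (g (X w) * W w) + M * \int[P]_w g (X w) + N * c + N * M.
  rewrite cE -(EZ P1 _ bgX) -(EZ P1 _ bW) -(Ecst P1 (N * M)).
  rewrite -(ED P1 (bmfM bgX bW) (bmfZ _ bgX)).
  have b12 := bmfD (bmfM bgX bW) (bmfZ M bgX).
  rewrite -(ED P1 b12 (bmfZ _ bW)).
  rewrite -(ED P1 (bmfD b12 (bmfZ _ bW)) (bmf_cst _)).
  by apply: E_eq => w; ring.
rewrite e1 (ED P1 bgX bN) (Ecst P1) => ?; lra.
Qed.

Variables (n : nat) (X : 'I_n -> T -> S).
Hypothesis mX : forall i, measurable_fun setT (X i).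
Hypothesis indX : forall B : 'I_n -> set S, (forall i, measurable (B i)) ->
  P (\bigcap_(i : 'I_n) (X i @^-1` B i)) = (\prod_(i < n) P (X i @^-1` B i))%E.

(** Indicators are replaced by bounded functions one index at a time: k counts the indices whose
    factor is already arbitrary, and [E_indic_mul_cst] performs one replacement. *)
Lemma E_prod_indep (G : 'I_n -> S -> R) : (forall i, bmf (G i)) ->
  \int[P]_w (\prod_i G i (X i w)) = \prod_i \int[P]_w G i (X i w).
Proof.
suff H k : forall G : 'I_n -> S -> R, (forall i, bmf (G i)) ->
    (forall i : 'I_n, (k <= i)%N -> exists2 B, measurable B & G i = \1_B) ->
    \int[P]_w (\prod_i G i (X i w)) = \prod_i \int[P]_w G i (X i w).
  by move=> bG; apply: (H n) => // i; rewrite leqNgt ltn_ord.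
elim: k => {G} [|k IHk] G bG GB.
  have /choice[B BP] : forall i : 'I_n, exists B, measurable B /\ G i = \1_B.
    by move=> i; have [B ? ?] := GB i (leq0n _); exists B.
  have mXB i : measurable (X i @^-1` B i).
    by rewrite -[X in measurable X]setTI; apply: mX => //; exact: (BP i).1.
  have mcap : measurable (\bigcap_(i : 'I_n) (X i @^-1` B i)).
    exact: fin_bigcap_measurable.
  have EB i : \int[P]_w G i (X i w) = fine (P (X i @^-1` B i)).
    rewrite -(E_indic P (mXB i)); apply: E_eq => w; rewrite (BP i).2 !indicE.
    by congr (_%:R); congr nat_of_bool; apply/idP/idP; rewrite !inE.
  transitivity (fine (P (\bigcap_(i : 'I_n) (X i @^-1` B i)))).
    rewrite -(E_indic P mcap); apply: E_eq => w; rewrite indicE.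
    case: (boolP (_ \in _)) => [|].
      rewrite inE => wB; apply: big1 => i _; rewrite (BP i).2 indicE mem_set//.
      exact: wB.
    rewrite notin_setE => /existsNP[i /not_implyP[_ wB]].
    rewrite (bigD1 i)//= (BP i).2 indicE memNset ?mul0r//.
  rewrite indX; last by move=> i; exact: (BP i).1.
  under [RHS]eq_bigr do rewrite EB.
  have Pfin i : P (X i @^-1` B i) \is a fin_num.
    rewrite ge0_fin_numE// (le_lt_trans _ (ltry 1))// -P1; apply: le_measure => //;
      by rewrite inE.
  rewrite (eq_bigr (fun i => (fine (P (X i @^-1` B i)))%:E)); last first.
    by move=> i _; rewrite fineK.
  by rewrite (_ : (\prod_i _)%E = (\prod_i fine (P (X i @^-1` B i)))%:E)//; apply: (big_ind2 (fun x y => x = y%:E)) => // _ x _ y -> ->.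
have [nk|kn] := leqP n k.
  by apply: IHk => // i ki; have := ltn_ord i; rewrite ltnNge (leq_trans nk ki).
pose i0 := Ordinal kn.
pose W w := \prod_(i | i != i0) G i (X i w).
have bW : bmf W by apply: bmf_prod => i; exact: bmf_comp.
transitivity (\int[P]_w (G i0 (X i0 w) * W w)).
  by apply: E_eq => w; rewrite (bigD1 i0).
rewrite [RHS](bigD1 i0)//=.
apply: (E_indic_mul_cst (mX i0) bW) => // B mB.
have := IHk (fun i => if i == i0 then \1_B else G i).
rewrite (bigD1 i0)//= eqxx (eq_bigr (fun i => \int[P]_w G i (X i w))); last first.
  by move=> i /negbTE ->.
move=> <-.
- apply: E_eq => w; rewrite [RHS](bigD1 i0)//= eqxx; congr (_ * _).
  by apply: eq_bigr => i /negbTE ->.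
- by move=> i; case: ifP => // _; exact: bmf_indic.
- move=> i ki; case: ifPn => [_|ii0]; first by exists B.
  apply: GB; rewrite ltn_neqAle ki andbT; apply: contra ii0 => /eqP ki'.
  by apply/eqP/val_inj; rewrite /= -ki'.
Qed.

Lemma E_mul_indep (g h : S -> R) i j : i != j -> bmf g -> bmf h ->
  \int[P]_w (g (X i w) * h (X j w)) = \int[P]_w g (X i w) * \int[P]_w h (X j w).
Proof.
move=> ij bg bh.
pose G k : S -> R := if k == i then g else if k == j then h else fun _ => 1.
have bG k : bmf (G k).
  by rewrite /G; case: ifP => // _; case: ifP => // _; exact: bmf_cst.
have split2 (F : 'I_n -> R) : (forall k, k != i -> k != j -> F k = 1) ->
    \prod_k F k = F i * F j.
  move=> F1; rewrite (bigD1 i)//= (bigD1 j)//=; last by rewrite eq_sym.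
  by rewrite big1 ?mulr1// => k /andP[ki kj]; rewrite F1.
have Gi : G i = g by rewrite /G eqxx.
have Gj : G j = h by rewrite /G eq_sym (negbTE ij) eqxx.
have Gk k : k != i -> k != j -> G k = fun _ => 1.
  by rewrite /G => /negbTE -> /negbTE ->.
have := E_prod_indep bG; rewrite split2 ?Gi ?Gj; last first.
  by move=> k ki kj; rewrite Gk//; exact: (Ecst P1).
by move=> <-; apply: E_eq => w; rewrite split2 ?Gi ?Gj// => k ki kj; rewrite Gk.
Qed.

(** Off-diagonal terms vanish by independence and centring. The bound M holds along the X i only, so
    g is truncated before independence is applied. *)
Lemma E_sqr_sum_indep (g : S -> R) (M : R) : measurable_fun setT g ->
  (forall i w, `|g (X i w)| <= M) -> (forall i, \int[P]_w g (X i w) = 0) ->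
  \int[P]_w (\sum_i g (X i w)) ^+ 2 = \sum_i \int[P]_w g (X i w) ^+ 2.
Proof.
move=> mg gM g0.
have bX i : bmf (fun w => g (X i w)).
  by split; [exact: (measurableT_comp mg (mX i))|exists M].
transitivity (\int[P]_w \sum_i \sum_j g (X i w) * g (X j w)).
  apply: E_eq => w; rewrite expr2 mulr_suml; apply: eq_bigr => i _.
  by rewrite mulr_sumr.
rewrite (E_sum P1); last by move=> i; apply: bmf_sum => j; exact: bmfM.
apply: eq_bigr => i _; rewrite (E_sum P1); last by move=> j; exact: bmfM.
rewrite (bigD1 i)//= big1 ?addr0; first by apply: E_eq => w; rewrite expr2.
move=> j ji; have bc := bmf_clip (normr_ge0 M) mg.
have cE k w : clip `|M| g (X k w) = g (X k w).
  by apply: clipE; apply: le_trans (gM k w) _; exact: ler_norm.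
rewrite eq_sym in ji; have := E_mul_indep ji bc bc.
rewrite (_ : \int[P]_w clip `|M| g (X i w) = 0) ?mul0r; last first.
  by rewrite -[RHS](g0 i); apply: E_eq => w; exact: cE.
by move=> <-; apply: E_eq => w; rewrite !cE.
Qed.

(** The product rule for characteristic functions in real form: when every factor has zero sine
    part, so does the product. *)
Lemma E_cos_sum_indep (a : S -> R) : measurable_fun setT a ->
  (forall i, \int[P]_w sin (a (X i w)) = 0) ->
  \int[P]_w cos (\sum_i a (X i w)) = \prod_i \int[P]_w cos (a (X i w)) /\
  \int[P]_w sin (\sum_i a (X i w)) = 0.
Proof.
move=> ma s0.
have bc : bmf (fun x => cos (a x)) by exact: bmf_cos.
have bs : bmf (fun x => sin (a x)) by exact: bmf_sin.
pose A k w := \sum_(i < n | (i < k)%N) a (X i w).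
have mA k : measurable_fun setT (A k).
  rewrite /A; under eq_fun do rewrite big_mkcond/=.
  have mi (i : 'I_n) : measurable_fun setT (fun w => if (i < k)%N then a (X i w) else 0).
    by case: (i < k)%N; [exact: (measurableT_comp ma (mX i))|exact: measurable_cst].
  exact: (measurable_sum _ mi).
(* Strengthened for the induction: the angle sums the first k indices, and the others carry
   arbitrary factors [G], into which the cosine or the sine of the next term is fed. *)
suff H k : (k <= n)%N -> forall G : 'I_n -> S -> R, (forall i, bmf (G i)) ->
    \int[P]_w (cos (A k w) * \prod_(i < n | (k <= i)%N) G i (X i w)) =
      \prod_(i < n | (i < k)%N) \int[P]_w cos (a (X i w)) *
      \prod_(i < n | (k <= i)%N) \int[P]_w G i (X i w) /\
    \int[P]_w (sin (A k w) * \prod_(i < n | (k <= i)%N) G i (X i w)) = 0.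
  have := H n (leqnn n) (fun _ _ => 1) (fun _ => bmf_cst _).
  have An w : A n w = \sum_i a (X i w) by apply: eq_bigl => i; rewrite ltn_ord.
  have n0 (F : 'I_n -> R) : \prod_(i < n | (n <= i)%N) F i = 1.
    by apply: big1 => i; rewrite leqNgt ltn_ord.
  rewrite [X in _ = _ * X]n0 mulr1 [in RHS](eq_bigl xpredT); last by move=> i; rewrite ltn_ord.
  move=> [<- h]; split; first by apply: E_eq => w; rewrite n0 mulr1 An.
  by rewrite -[RHS]h; apply: E_eq => w; rewrite n0 mulr1 An.
elim: k => [_|k IHk kn] G bG.
  have A0 w : A 0%N w = 0 by apply: big_pred0.
  split; last first.
    by rewrite -[RHS](Ecst P1 0); apply: E_eq => w; rewrite A0 sin0 mul0r.
  rewrite [X in X * _]big_pred0// mul1r -E_prod_indep//.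
  by apply: E_eq => w; rewrite A0 cos0 mul1r.
pose i0 := Ordinal kn.
pose Gc i := if i == i0 then (fun x => cos (a x)) else G i.
pose Gs i := if i == i0 then (fun x => sin (a x)) else G i.
have bGc i : bmf (Gc i) by rewrite /Gc; case: ifP.
have bGs i : bmf (Gs i) by rewrite /Gs; case: ifP.
have AS w : A k.+1 w = A k w + a (X i0 w).
  rewrite /A (bigD1 i0)//= addrC; congr (_ + _); apply: eq_bigl => i.
  by rewrite ltnS -val_eqE/= ltn_neqAle andbC.
have prodk (F F' : 'I_n -> R) : (forall i, i != i0 -> F i = F' i) ->
    \prod_(i < n | (k <= i)%N) F i = F i0 * \prod_(i < n | (k < i)%N) F' i.
  move=> FF; rewrite (bigD1 i0)//=; congr (_ * _); apply: eq_big => i.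
    by rewrite -val_eqE/= (ltn_neqAle k) eq_sym andbC.
  by move=> /andP[_]; exact: FF.
have [IHcc IHcs] := IHk (ltnW kn) Gc bGc.
have [IHsc IHss] := IHk (ltnW kn) Gs bGs.
have bA1 (H : T -> R) : measurable_fun setT H -> bmf (fun w => cos (H w)) by exact: bmf_cos.
have bA2 (H : T -> R) : measurable_fun setT H -> bmf (fun w => sin (H w)) by exact: bmf_sin.
have bp k' (F : 'I_n -> S -> R) : (forall i, bmf (F i)) ->
    bmf (fun w => \prod_(i < n | (k' <= i)%N) F i (X i w)).
  by move=> bF; apply: bmf_prod => i; exact: (bmf_comp (bF i) (mX i)).
have pc w : \prod_(i < n | (k <= i)%N) Gc i (X i w) =
    cos (a (X i0 w)) * \prod_(i < n | (k < i)%N) G i (X i w).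
  rewrite (prodk _ (fun i => G i (X i w))) /Gc ?eqxx// => i /negbTE ->//.
have ps w : \prod_(i < n | (k <= i)%N) Gs i (X i w) =
    sin (a (X i0 w)) * \prod_(i < n | (k < i)%N) G i (X i w).
  rewrite (prodk _ (fun i => G i (X i w))) /Gs ?eqxx// => i /negbTE ->//.
split.
  transitivity (\int[P]_w (cos (A k w) * \prod_(i < n | (k <= i)%N) Gc i (X i w) -
      sin (A k w) * \prod_(i < n | (k <= i)%N) Gs i (X i w))).
    by apply: E_eq => w; rewrite AS cosD pc ps; ring.
  rewrite (EB P1 (bmfM (bA1 _ (mA k)) (bp _ _ bGc)) (bmfM (bA2 _ (mA k)) (bp _ _ bGs))).
  rewrite IHcc IHss subr0 (prodk _ (fun i => \int[P]_w G i (X i w))); last first.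
    by move=> i /negbTE ii0; rewrite /Gc ii0.
  rewrite /Gc eqxx mulrA; congr (_ * _); rewrite [RHS](bigD1 i0)//= mulrC.
  congr (_ * _); apply: eq_bigl => i.
  by rewrite ltnS -val_eqE/= ltn_neqAle andbC.
transitivity (\int[P]_w (sin (A k w) * \prod_(i < n | (k <= i)%N) Gc i (X i w) +
    cos (A k w) * \prod_(i < n | (k <= i)%N) Gs i (X i w))).
  by apply: E_eq => w; rewrite AS sinD pc ps; ring.
rewrite (ED P1 (bmfM (bA2 _ (mA k)) (bp _ _ bGc)) (bmfM (bA1 _ (mA k)) (bp _ _ bGs))).
rewrite IHcs IHsc add0r (prodk _ (fun i => \int[P]_w G i (X i w))); last first.
  by move=> i /negbTE ii0; rewrite /Gs ii0.
by rewrite /Gs eqxx s0 mul0r mulr0.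
Qed.

End independence.

(** * Elementary expansions with explicit remainders *)

Section cosine_expansion.
Context {R : realType}.

Lemma derive_ge0_ge (F F' : R -> R) : (forall x, is_derive x (1 : R) F (F' x)) ->
  (forall x, 0 <= x -> 0 <= F' x) -> forall x, 0 <= x -> F 0 <= F x.
Proof.
move=> dF F'0 x; rewrite le_eqVlt => /predU1P[<-//|x0].
have cF : {within `[0, x], continuous F}.
  apply: continuous_subspaceT => y; apply: differentiable_continuous.
  by apply/derivable1_diffP; case: (dF y).
have [c /[!in_itv]/= /andP[c0 _] cE] := MVT x0 (fun y _ => dF y) cF.
by rewrite -subr_ge0 cE mulr_ge0 ?F'0 ?subr0 ?ltW.
Qed.

(** From here to [cos_le_pos], each bounded expression is the derivative of the next one, and all of
    them vanish at 0. *)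
Let sin_le (x : R) : 0 <= x -> 0 <= x - sin x.
Proof.
move=> x0.
have dF (y : R) : is_derive y (1 : R) (fun y => y - sin y) (1 - cos y) by apply: is_derive_eq.
have := derive_ge0_ge dF _ x0; rewrite sin0 subr0; apply=> y _.
by rewrite subr_ge0 (le_trans (ler_norm _))// cos_max.
Qed.

Let cos_ge_pos (x : R) : 0 <= x -> 0 <= cos x - 1 + x ^+ 2 / 2.
Proof.
move=> x0.
have dF (y : R) : is_derive y (1 : R) (fun y => cos y - 1 + y ^+ 2 / 2) (y - sin y).
  by apply: is_derive_eq; rewrite /GRing.scale/=; field.
have := derive_ge0_ge dF sin_le x0.
by rewrite cos0 expr0n/= mul0r subrr addr0.
Qed.

Let sin_ge_pos (x : R) : 0 <= x -> 0 <= sin x - x + x ^+ 3 / 6.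
Proof.
move=> x0.
have dF (y : R) : is_derive y (1 : R) (fun y => sin y - y + y ^+ 3 / 6)
    (cos y - 1 + y ^+ 2 / 2).
  by apply: is_derive_eq; rewrite /GRing.scale/=; field.
have := derive_ge0_ge dF cos_ge_pos x0.
by rewrite sin0 expr0n/= mul0r subrr addr0.
Qed.

Let cos_le_pos (x : R) : 0 <= x -> 0 <= 1 - x ^+ 2 / 2 + x ^+ 4 / 24 - cos x.
Proof.
move=> x0.
have dF (y : R) : is_derive y (1 : R) (fun y => 1 - y ^+ 2 / 2 + y ^+ 4 / 24 - cos y)
    (sin y - y + y ^+ 3 / 6).
  by apply: is_derive_eq; rewrite /GRing.scale/=; field.
have := derive_ge0_ge dF sin_ge_pos x0.
by rewrite cos0 !expr0n/= !mul0r subr0 addr0 subrr.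
Qed.

Lemma cos_expansion (x : R) : `|cos x - (1 - x ^+ 2 / 2)| <= x ^+ 4.
Proof.
wlog x0 : x / 0 <= x => [H|].
  have [/H//|/ltW x0] := leP 0 x.
  have := H (- x); rewrite oppr_ge0 cosN sqrrN => /(_ x0).
  by rewrite exprNn -signr_odd/= expr0 mul1r.
have := cos_ge_pos x0; have := cos_le_pos x0; have := exprn_ge0 4 x0 => h1 h2 h3.
by rewrite ler_norml; apply/andP; split; lra.
Qed.

Lemma expRN_expansion (h : R) : 0 <= h -> `|1 - h - expR (- h)| <= h ^+ 2.
Proof.
move=> h0; have h1 := expR_ge1Dx (- h).
have h2 : expR (- h) <= (1 + h)^-1.
  by rewrite expRN lef_pV2 ?posrE ?expR_gt0 ?ltr_pwDl// expR_ge1Dx.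
have h3 : (1 + h)^-1 <= 1 - h + h ^+ 2.
  rewrite -div1r ler_pdivrMr ?ltr_pwDl//.
  have := exprn_ge0 3 h0; rewrite (_ : (1 - h + h ^+ 2) * (1 + h) = 1 + h ^+ 3); last by ring.
  by lra.
by rewrite ler_norml; apply/andP; split; lra.
Qed.

(** Telescoping: factors are exchanged one by one, the others being at most 1 in absolute value. *)
Lemma prod_sub_expn n (x : 'I_n -> R) (y e : R) : (forall i, `|x i| <= 1) -> `|y| <= 1 ->
  (forall i, `|x i - y| <= e) -> `|\prod_i x i - y ^+ n| <= n%:R * e.
Proof.
elim: n x => [|n IHn] x x1 y1 xy.
  by rewrite big_ord0 expr0 subrr normr0 mul0r.
rewrite big_ord_recr/= exprSr.
set z := \prod_(i < n) _.
have z1 : `|z| <= 1.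
  by rewrite normr_prod; apply: prodr_ile1 => i; rewrite normr_ge0 x1.
have -> : z * x ord_max - y ^+ n * y = z * (x ord_max - y) + (z - y ^+ n) * y by ring.
rewrite (le_trans (ler_normD _ _))// !normrM -natr1 mulrDl mul1r addrC lerD//.
  rewrite (le_trans (ler_wpM2l (normr_ge0 _) y1))// mulr1.
  exact: (IHn (fun i => x (widen_ord (leqnSn n) i))).
by rewrite (le_trans (ler_wpM2r (normr_ge0 _) z1))// mul1r.
Qed.

End cosine_expansion.

Section rot_sym_rate.
Context {R : realType} (q : nat) (q0 : (0 < q)%N).
Local Notation p := q.+1.
Local Notation V := (borel 'cV[R]_p).
Local Notation mu := (@lebesgue_measure R).
Variables (theta : 'cV[R]_p) (theta1 : dot theta theta = 1).
Variables (f : R -> R) (Ff : class_F f).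

(* E (1 - (X'theta)^2), written as an integral over the cosine X'theta; the
   absolute value only makes the integrand nonnegative off [-1, 1]. *)
Definition rot_sym_var (k : R) : R := fine
  ((p%:R * rot_sym_cst p k f)%:E * polar_const q *
   \int[mu]_(s in `](-1)%R, 1%R[)
     (`|1 - s ^+ 2| * f (k * s) * (1 - s ^+ 2) `^ ((q%:R - 2) / 2))%:E)%E.

(** Shows that the expectation depends on neither the space nor the variable, so that a single
    number normalizes a whole row of the array. *)
Lemma E_rot_sym_var k d (T : measurableType d) (P : {measure set T -> \bar R}) (X : T -> V) :
  rot_sym_variable theta f k P X ->
  \int[P]_w (1 - dot theta (X w) ^+ 2) = rot_sym_var k.
Proof.
move=> rX; have [P1 mX sX lawX] := rX.
have [Q [QTQ QQT QTt]] := orthonormal_complement theta1.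
have mg : measurable_fun setT (fun s : R => `|1 - s ^+ 2|).
  by apply: measurableT_comp => //; apply: measurable_funB => //; exact: measurable_funX.
have := ge0_integral_cosine_law q0 QQT (measurable_class_F Ff) (class_F_ge0 Ff) mX lawX mg
  (fun s => normr_ge0 _).
move=> h; rewrite /rot_sym_var -h; congr fine; apply: eq_integral => w _.
by rewrite ger0_norm// -(dot_xi QQT rX w) dot_ge0.
Qed.

Definition rot_sym_var_bounded (C k : R) : Prop :=
  forall d (T : measurableType d) (P : {measure set T -> \bar R}) (X : T -> V),
  rot_sym_variable theta f k P X ->
  [/\ 0 < rot_sym_var k, \int[P]_w (1 - dot theta (X w) ^+ 2) ^+ 2 <= C * rot_sym_var k ^+ 2,
      \int[P]_w (1 - dot theta (X w)) <= C * rot_sym_var k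
    & rot_sym_var k <= C / (k * phi f k)].

(** Since 1 - u^2 = (1 - u)(1 + u), the exponents (1, 1), (2, 2) and (1, 0) cover the three
    expectations. The lower bound for (1, 1) converts powers of the rate into powers of the
    variance. *)
Lemma rot_sym_var_bounds : exists2 C : R, 0 < C &
  \forall k \near +oo, rot_sym_var_bounded C k.
Proof.
have [Q [QTQ QQT QTt]] := orthonormal_complement theta1.
have [c [c1 cH]] := cosine_moment_bounds q0 theta1 QQT Ff 1 1.
have [c' [c'1 cH']] := cosine_moment_bounds q0 theta1 QQT Ff 2 2.
have [c'' [c''1 cH'']] := cosine_moment_bounds q0 theta1 QQT Ff 1 0.
have rate1 : \forall k \near +oo, 1 <= k * phi f k by have /cvgryPge := rate_cvg Ff; exact.
pose C := `|c'.2| / c.1 ^+ 2 + `|c''.2| / c.1 + `|c.2| + 1.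
have C1 : `|c'.2| / c.1 ^+ 2 <= C.
  by rewrite /C -!addrA lerDl !addr_ge0// divr_ge0// ltW.
have C2 : `|c''.2| / c.1 <= C.
  rewrite /C [X in X + _ + _]addrC -!addrA lerDl !addr_ge0// divr_ge0// exprn_ge0// ltW//.
have C3 : `|c.2| <= C.
  by rewrite /C -addrA addrCA lerDl !addr_ge0// divr_ge0// ?exprn_ge0// ltW.
have C0 : 0 < C.
  by rewrite /C ltr_wpDl// !addr_ge0// divr_ge0// ?exprn_ge0// ltW.
exists C => //.
apply: filterS2 (filterI cH (filterI cH' cH'')) rate1 => k [h [h' h'']] A1 d T P X rX.
set A := k * phi f k in A1 h h' h'' *; have A0 : 0 < A by exact: lt_le_trans A1.
have e1 : \int[P]_w ((1 - dot theta (X w)) ^+ 1 * (1 + dot theta (X w)) ^+ 1) = rot_sym_var k.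
  by rewrite -(E_rot_sym_var rX); apply: E_eq => w; ring.
have e2 : \int[P]_w ((1 - dot theta (X w)) ^+ 2 * (1 + dot theta (X w)) ^+ 2) =
    \int[P]_w (1 - dot theta (X w) ^+ 2) ^+ 2 by apply: E_eq => w; ring.
have e3 : \int[P]_w ((1 - dot theta (X w)) ^+ 1 * (1 + dot theta (X w)) ^+ 0) =
    \int[P]_w (1 - dot theta (X w)) by apply: E_eq => w; ring.
have /andP[] := h _ _ _ _ rX; rewrite e1 expr1 => l1 l2.
have /andP[_] := h' _ _ _ _ rX; rewrite e2 => l3.
have /andP[_] := h'' _ _ _ _ rX; rewrite e3 expr1 => l4.
have b0 : 0 < rot_sym_var k by apply: lt_le_trans l1; rewrite divr_gt0.
split => //.
- apply: (@le_trans _ _ (`|c'.2| / c.1 ^+ 2 * rot_sym_var k ^+ 2)); last first.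
    by rewrite ler_wpM2r// exprn_ge0// ltW.
  apply: (@le_trans _ _ (`|c'.2| / c.1 ^+ 2 * (c.1 / A) ^+ 2)); last first.
    rewrite ler_wpM2l ?divr_ge0 ?exprn_ge0 ?(ltW c1)// lerXn2r ?nnegrE ?(ltW b0)//.
    by rewrite divr_ge0// ltW.
  apply: (le_trans l3); rewrite (_ : _ / _ * _ = `|c'.2| / A ^+ 2); last first.
    by field; rewrite !gt_eqF.
  by rewrite ler_wpM2r ?invr_ge0 ?exprn_ge0 ?(ltW A0)// ler_norm.
- apply: (@le_trans _ _ (`|c''.2| / c.1 * rot_sym_var k)); last first.
    by rewrite ler_wpM2r// ltW.
  apply: (@le_trans _ _ (`|c''.2| / c.1 * (c.1 / A))); last first.
    by rewrite ler_wpM2l ?divr_ge0 ?(ltW c1).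
  apply: (le_trans l4); rewrite (_ : _ / _ * _ = `|c''.2| / A); last first.
    by field; rewrite !gt_eqF.
  by rewrite ler_wpM2r ?invr_ge0 ?(ltW A0)// ler_norm.
- apply: (le_trans l2); rewrite ler_wpM2r ?invr_ge0 ?(ltW A0)//.
  by rewrite (le_trans _ C3)// ler_norm.
Qed.

End rot_sym_rate.

(** * Asymptotics of the spherical mean *)

Section studentization.
Context {R : realType} (q : nat).
Local Notation p := q.+1.
Variables (theta : 'cV[R]_p) (theta1 : dot theta theta = 1).
Variables (Q : 'M[R]_(p, q)).
Hypotheses (QTQ : Q^T *m Q = 1%:M) (QQT : Q *m Q^T = 1%:M - theta *m theta^T)
  (QTtheta : Q^T *m theta = 0).
Variables (n : nat) (n0 : (0 < n)%N) (x : 'I_n -> 'cV[R]_p).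
Hypothesis sx : forall i, dot (x i) (x i) = 1.

Let N : R := n%:R.
Let N0 : 0 < N. Proof. by rewrite ltr0n. Qed.

Let u i := dot theta (x i).
Let xi i : 'cV[R]_q := Q^T *m x i.
Definition mean_cosine : R := N^-1 * \sum_i u i.
Definition mean_tangent : 'cV[R]_q := N^-1 *: \sum_i xi i.
Definition mean_cross : 'cV[R]_q := N^-1 *: \sum_i u i *: xi i.
Definition mean_sine2 : R := N^-1 * \sum_i (1 - u i ^+ 2).

Definition studentized : 'cV[R]_p :=
  (Num.sqrt (n%:R * q%:R) / Num.sqrt (1 - e_hat2 x)) *: (spherical_mean x - theta).

Let xi2 i : dot (xi i) (xi i) = 1 - u i ^+ 2.
Proof. by have := dot_decomposition QQT (x i); rewrite sx => ->; rewrite addrC addKr. Qed.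

Lemma sample_meanE : sample_mean x = mean_cosine *: theta + Q *m mean_tangent.
Proof.
rewrite /sample_mean /mean_cosine /mean_tangent -scalemxAr -scalerA -scalerDr.
rewrite mulmx_sumr scaler_suml -big_split/=; congr (_ *: _).
by apply: eq_bigr => i _; exact: decomposition.
Qed.

Let theta_mix (s : R) (y : 'cV[R]_q) : dot theta (s *: theta + Q *m y) = s.
Proof. by rewrite dotDr dotZr theta1 mulr1 dot_mulmxr QTtheta dot0l addr0. Qed.

Let QT_mix (s : R) (y : 'cV[R]_q) : Q^T *m (s *: theta + Q *m y) = y.
Proof. by rewrite mulmxDr -scalemxAr QTtheta scaler0 add0r mulmxA QTQ mul1mx. Qed.

Let dot_mix (s : R) (y : 'cV[R]_q) (z : 'cV[R]_p) :
  dot z (s *: theta + Q *m y) = dot theta z * s + dot (Q^T *m z) y.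
Proof. by rewrite dotDr dotZr dot_mulmxr (dotC z theta) mulrC. Qed.

Local Notation ub := mean_cosine.
Local Notation xb := mean_tangent.

Lemma dot_sample_mean : dot (sample_mean x) (sample_mean x) = ub ^+ 2 + dot xb xb.
Proof. by rewrite {2}sample_meanE dot_mix sample_meanE theta_mix QT_mix -expr2. Qed.

Let A := dot (sample_mean x) (sample_mean x).

Let avg_sqr : R := N^-1 * \sum_i dot (xi i) xb ^+ 2.

(** Multiplying by |mean|^2 clears the normalization of the spherical mean, after which (u_i ub +
    xi_i'xb)^2 is expanded. The first term leads; the others are at most multiples of delta^2 b
    under the hypotheses below. *)
Let e_hat2E : A != 0 ->
  A * (1 - e_hat2 x) = ub ^+ 2 * mean_sine2 + dot xb xb - 2 * ub * dot mean_cross xb - avg_sqr.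
Proof.
move=> A0; have sA : enorm (sample_mean x) ^+ 2 = A by exact: enorm_sqr.
have e1 : A * e_hat2 x = N^-1 * \sum_i (u i * ub + dot (xi i) xb) ^+ 2.
  rewrite /e_hat2 mulrCA; congr (_ * _); rewrite mulr_sumr; apply: eq_bigr => i _.
  rewrite /spherical_mean dotZr exprMn exprVn sA mulrA divff// mul1r.
  by rewrite sample_meanE dot_mix.
have e2 : N^-1 * \sum_i (u i * ub + dot (xi i) xb) ^+ 2 =
    ub ^+ 2 * (1 - mean_sine2) + 2 * ub * dot mean_cross xb + avg_sqr.
  have -> : dot mean_cross xb = N^-1 * \sum_i u i * dot (xi i) xb.
    by rewrite dotZl dot_suml; congr (_ * _); apply: eq_bigr => i _; rewrite dotZl.
  have -> : 1 - mean_sine2 = N^-1 * \sum_i u i ^+ 2.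
    rewrite /mean_sine2 sumrB sumr_const card_ord mulrBr -[X in _ * X - _]/N.
    by rewrite mulVf ?gt_eqF// subKr.
  rewrite /avg_sqr mulrCA [2 * ub * _]mulrCA -!mulrDr; congr (_ * _).
  rewrite !mulr_sumr -!big_split/=; apply: eq_bigr => i _; ring.
rewrite mulrBr mulr1 e1 e2 {1}/A dot_sample_mean; ring.
Qed.

Let avg_sqr_bounds : 0 <= avg_sqr <= dot xb xb.
Proof.
rewrite mulr_ge0 ?invr_ge0 ?(ltW N0)//=; last by apply: sumr_ge0 => i _; exact: sqr_ge0.
rewrite ler_pdivrMl//; apply: (@le_trans _ _ (\sum_(i < n) dot xb xb)).
  apply: ler_sum => i _; apply: le_trans (Cauchy_Schwarz _ _) _.
  by rewrite ler_piMl ?dot_ge0// xi2 gerBl sqr_ge0.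
by rewrite sumr_const card_ord -[X in X <= _]mulr_natl.
Qed.

Let ub_le1 : ub <= 1.
Proof.
rewrite ler_pdivrMl// mulr1 (@le_trans _ _ (\sum_(i < n) 1))//.
  apply: ler_sum => i _; apply: le_trans (ler_norm _) _.
  by apply: le_trans (normr_dot _ _) _; rewrite /enorm theta1 sx sqrtr1 mulr1.
by rewrite sumr_const card_ord.
Qed.

(** In the application [b] is the variance E (1 - u^2) and [delta] a tolerance. Each of [H1] to [H4]
    fails with small probability by Markov's inequality; the first three are relative to [b], which
    itself tends to 0. *)
Variables (b delta : R).
Hypotheses (b0 : 0 < b) (b1 : b <= 1) (delta0 : 0 < delta) (delta8 : delta <= 1 / 8).
Hypotheses (H1 : (mean_sine2 - b) ^+ 2 <= delta ^+ 2 * b ^+ 2)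
  (H2 : dot xb xb <= delta ^+ 2 * b) (H3 : dot mean_cross mean_cross <= delta ^+ 2 * b)
  (H4 : 1 - ub <= delta).

Let A_ge : 1 / 2 <= A.
Proof.
have v78 : 7 / 8 <= ub by have := H4; have := delta8; lra.
have : 7 / 8 * (7 / 8) <= ub * ub by apply: ler_pM => //; lra.
by rewrite /A dot_sample_mean expr2; have := dot_ge0 xb; lra.
Qed.

Let A0 : A != 0. Proof. by rewrite gt_eqF// (lt_le_trans _ A_ge)//; lra. Qed.

Let W := 1 - e_hat2 x.

(** The leading term lies between (1 - 2 delta)(1 - delta) b and (1 + delta) b; the remaining ones
    add at most 3 delta^2 b, which is below delta b because delta <= 1/8. *)
Let AW_bound : `|A * W - b| <= 4 * delta * b.
Proof.
have h1 : `|mean_sine2 - b| <= delta * b.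
  rewrite -[X in _ <= X]ger0_norm; last by rewrite mulr_ge0// ltW.
  by rewrite -ler_sqr ?nnegrE// !real_normK ?num_real// exprMn.
have h3 : `|dot mean_cross xb| <= delta ^+ 2 * b.
  have db : 0 <= delta ^+ 2 * b by rewrite mulr_ge0 ?sqr_ge0// ltW.
  rewrite -[X in _ <= X]ger0_norm// -ler_sqr ?nnegrE// !real_normK ?num_real//.
  apply: le_trans (Cauchy_Schwarz _ _) _.
  by rewrite [leRHS]expr2 ler_pM ?dot_ge0.
rewrite e_hat2E//; have /andP[a1 a2] := avg_sqr_bounds.
move: h1 h3; rewrite !ler_norml => /andP[h1 h1'] /andP[h3 h3'].
move: h1 h1' h3 h3' a1 a2 H2 H4 ub_le1 (dot_ge0 xb).
move: (dot mean_cross xb) (avg_sqr) (dot xb xb) (mean_sine2) (ub) => c t y s v.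
move=> h1 h1' h3 h3' a1 a2 y2 v4 v1' y0.
have d8 := delta8; have d0 := delta0; have bb := b0.
have v0 : 0 <= v by lra.
have vv : 1 - 2 * delta <= v ^+ 2 <= 1 by apply/andP; split; nra.
have db : 0 <= delta * b by rewrite mulr_ge0// ltW.
have vc : - (delta ^+ 2 * b) <= v * c <= delta ^+ 2 * b by apply/andP; split; nra.
have vs : (1 - 2 * delta) * ((1 - delta) * b) <= v ^+ 2 * s <= (1 + delta) * b.
  move: vv => /andP[v1 v2]; apply/andP; split.
    apply: ler_pM => //; [lra| |lra].
    by rewrite mulr_ge0 ?(ltW bb)//; lra.
  rewrite -[leRHS]mul1r; apply: ler_pM => //; [exact: sqr_ge0| |lra].
  have db8 : delta * b <= 1 / 8 * b by rewrite ler_wpM2r// ltW.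
  by lra.
move: vc vs => /andP[c1 c2] /andP[s1 s2].
have dd : delta ^+ 2 * b <= delta * b / 8 by nra.
by apply/andP; split; nra.
Qed.

(** Up to the factor g / sqrt b, the difference is r (ub - |mean|) theta + (r - 1) Q xb, with r =
    sqrt b / (sqrt W |mean|) close to 1. The first part contributes 2 delta |xb| and the second 8
    delta |xb|, whence 10. *)
Lemma studentized_close : enorm (studentized -
  Q *m (Num.sqrt (q%:R / (n%:R * b)) *: \sum_i xi i)) <=
  10 * delta * enorm (Num.sqrt (q%:R / (n%:R * b)) *: \sum_i xi i).
Proof.
have A12 := A_ge; have Ap : 0 < A by apply: lt_le_trans A_ge; lra.
pose z := A * W / b.
have zb : `|z - 1| <= 4 * delta.
  rewrite (_ : z - 1 = (A * W - b) / b); last by rewrite /z; field; rewrite gt_eqF.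
  by rewrite normrM [ `|b^-1|]gtr0_norm ?invr_gt0// ler_pdivrMr//; exact: AW_bound.
have z12 : 1 / 2 <= z by have := delta8; move: zb; rewrite ler_norml => /andP[]; lra.
have Wp : 0 < W.
  have : 0 < z by apply: lt_le_trans z12; lra.
  by rewrite /z pmulr_lgt0 ?invr_gt0// pmulr_rgt0.
pose sA := enorm (sample_mean x); pose sW := Num.sqrt W; pose sb := Num.sqrt b.
pose g := Num.sqrt (n%:R * q%:R) : R.
have g0 : 0 <= g by exact: sqrtr_ge0.
have sAp : 0 < sA by rewrite sqrtr_gt0.
have sWp : 0 < sW by rewrite sqrtr_gt0.
have sbp : 0 < sb by rewrite sqrtr_gt0.
have sA2 : sA ^+ 2 = A by exact: enorm_sqr.
have sW2 : sW ^+ 2 = W by rewrite sqr_sqrtr// ltW.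
have sb2 : sb ^+ 2 = b by rewrite sqr_sqrtr// ltW.
have g2 : g ^+ 2 = N * q%:R by rewrite sqr_sqrtr// mulr_ge0.
have se : Num.sqrt (q%:R / (n%:R * b)) = g / (N * sb).
  rewrite (_ : q%:R / (n%:R * b) = (g / (N * sb)) ^+ 2).
    by rewrite sqrtr_sqr ger0_norm// divr_ge0// mulr_ge0// ltW.
  by rewrite expr_div_n exprMn g2 sb2 -/N; field; rewrite !gt_eqF.
have YE : Num.sqrt (q%:R / (n%:R * b)) *: \sum_i xi i = (g / sb) *: xb.
  rewrite se /mean_tangent scalerA; congr (_ *: _).
  by field; rewrite !gt_eqF.
rewrite YE.
pose r := sb / (sW * sA).
have rp : 0 < r by rewrite divr_gt0// mulr_gt0.
have rz : r ^+ 2 * z = 1.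
  rewrite /r /z expr_div_n exprMn sA2 sW2 sb2; field.
  by rewrite !gt_eqF.
have r2 : r <= 2 by nra.
have r1 : `|r - 1| <= 8 * delta.
  have rr2 : r ^+ 2 <= 2 by have := ler_wpM2l (sqr_ge0 r) z12; lra.
  have e : (r - 1) * (r + 1) = r ^+ 2 * (1 - z) by rewrite [RHS]mulrBr rz mulr1; ring.
  have : `|(r - 1) * (r + 1)| <= 2 * (4 * delta).
    by rewrite e normrM distrC (ger0_norm (sqr_ge0 r)) ler_pM// sqr_ge0.
  rewrite normrM (ger0_norm (_ : 0 <= r + 1)) ?addr_ge0 ?(ltW rp)// => h.
  apply: (@le_trans _ _ (`|r - 1| * (r + 1))); last by lra.
  by rewrite ler_peMr// lerDr ltW.
have xbd : enorm xb <= delta.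
  rewrite -[leRHS]ger0_norm ?(ltW delta0)// -sqrtr_sqr ler_wsqrtr//.
  by apply: le_trans H2 _; rewrite ler_piMr ?sqr_ge0.
(* The identity |mean|^2 - ub^2 = |xb|^2 makes this difference of second order in xb. *)
have ubA : `|ub - sA| <= delta * enorm xb.
  have h : (sA - ub) * (sA + ub) = enorm xb ^+ 2.
    by rewrite enorm_sqr; have := dot_sample_mean; rewrite -/A -sA2 => h; nra.
  have v78 : 7 / 8 <= ub by have := H4; have := delta8; lra.
  have sA78 : 1 / 2 <= sA by rewrite -ler_sqr ?nnegrE ?(ltW sAp)// sA2; lra.
  have e0 := enorm_ge0 xb.
  have h2 : enorm xb ^+ 2 <= delta * enorm xb by rewrite expr2 ler_wpM2r.
  rewrite distrC ler_norml; apply/andP; split; nra.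
pose y : 'cV[R]_p := Q *m xb.
have ey : enorm y = enorm xb by rewrite /enorm dot_mulmxl mulmxA QTQ mul1mx.
rewrite (_ : _ - _ = (g / sb) *: ((r * (ub - sA)) *: theta + (r - 1) *: y)); last first.
  rewrite /studentized -/W -/g -/sW /spherical_mean -/sA sample_meanE -/y -scalemxAr -/y.
  apply/matrixP => i j; rewrite !mxE -/y /r.
  move: (theta i j) => ti; move: ((Q *m xb) i j) => yi.
  by field; rewrite !gt_eqF.
rewrite [enorm (_ *: (_ + _))]enormZ [enorm (_ *: xb)]enormZ (ger0_norm (divr_ge0 g0 (ltW sbp))) mulrCA ler_wpM2l ?divr_ge0 ?(ltW sbp)//.
apply: le_trans (enormD _ _) _; rewrite [enorm (_ *: theta)]enormZ [enorm (_ *: y)]enormZ ey normrM (gtr0_norm rp).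
rewrite [enorm theta](_ : _ = 1) ?mulr1; last by rewrite /enorm theta1 sqrtr1.
have e0 := enorm_ge0 xb.
have -> : 10 * delta * enorm xb = 2 * (delta * enorm xb) + 8 * delta * enorm xb by ring.
by apply: lerD; [rewrite ler_pM// ltW|rewrite ler_wpM2r].
Qed.

End studentization.

Section statistics.
Context {R : realType} (p n : nat).

Lemma mean_cosineE (theta : 'cV[R]_p.+1) (x : 'I_n -> 'cV[R]_p.+1) :
  dot theta (sample_mean x) = mean_cosine theta x.
Proof. by rewrite dotZr dot_sumr. Qed.

(** Also true when the sample mean is 0, where the spherical mean is 0 by the convention on
    inverses, and for an empty sample. It allows the square root in [studentized] to be squared
    back. *)
Lemma e_hat2_le1 (x : 'I_n -> 'cV[R]_p) : (forall i, dot (x i) (x i) = 1) -> e_hat2 x <= 1.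
Proof.
move=> sx; have s1 : dot (spherical_mean x) (spherical_mean x) <= 1.
  rewrite dotZl dotZr mulrA -expr2 exprVn enorm_sqr.
  by have [->|m] := eqVneq (dot (sample_mean x) (sample_mean x)) 0;
    rewrite ?mulr0// mulVf.
rewrite /e_hat2; case: n x sx s1 => [|m] x sx s1; first by rewrite big_ord0 mulr0.
rewrite ler_pdivrMl// mulr1.
apply: (@le_trans _ _ (\sum_(i < m.+1) 1)); last by rewrite sumr_const card_ord.
by apply: ler_sum => i _; rewrite (le_trans (Cauchy_Schwarz _ _))// sx mul1r.
Qed.

Context d (T : measurableType d) (X : 'I_n -> T -> borel 'cV[R]_p).
Hypothesis mX : forall i, measurable_fun setT (X i).

Lemma measurable_spherical_mean :
  measurable_fun setT (fun w => spherical_mean (fun i => X i w) : borel 'cV[R]_p).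
Proof.
have mS : measurable_fun setT (fun w => sample_mean (fun i => X i w) : borel 'cV[R]_p).
  apply: measurable_cVZ; first exact: measurable_cst.
  by apply: measurable_cV_sum => i; exact: mX.
by apply: measurable_cVZ => //; exact: measurable_enormV.
Qed.

Lemma measurable_one_sub_e_hat2 :
  measurable_fun setT (fun w => 1 - e_hat2 (fun i => X i w : 'cV[R]_p)).
Proof.
apply: measurable_funB => //; apply: measurable_funM => //.
apply: measurable_sum => i; apply: measurable_funX.
exact: (measurable_dot (@mX i) measurable_spherical_mean).
Qed.

End statistics.

Section studentized_statistics.
Context {R : realType} (q n : nat).
Local Notation p := q.+1.

Lemma measurable_studentized d (T : measurableType d) (X : 'I_n -> T -> borel 'cV[R]_p)
  (theta : 'cV[R]_p) : (forall i, measurable_fun setT (X i)) ->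
  measurable_fun setT (fun w => studentized theta (fun i => X i w) : borel 'cV[R]_p).
Proof.
move=> mX; apply: measurable_cVZ.
  apply: measurable_funM => //; apply: measurable_fun_inv.
  apply: (@measurableT_comp _ _ _ _ _ _ (@Num.sqrt R)); last exact: measurable_one_sub_e_hat2.
  by apply: continuous_measurable_fun; exact: sqrt_continuous.
apply: (@measurable_cVD R _ _ p _ (fun _ => - theta)) => //.
exact: measurable_spherical_mean.
Qed.

(** Unit vectors satisfy |x - y|^2 = 2 (1 - x'y), and 1 - c^2 = 2 (1 - c) - (1 - c)^2, so both
    statistics are exact functions of the studentized vector. If 1 - [e_hat2] is 0, all sides are 0
    by the convention on division. *)
Lemma sqr_studentized (theta : 'cV[R]_p) (x : 'I_n -> 'cV[R]_p) :
  dot theta theta = 1 -> (forall i, dot (x i) (x i) = 1) -> sample_mean x != 0 ->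
  let M := studentized theta x in let c := dot theta (spherical_mean x) in
  2 * n%:R * q%:R * (1 - c) / (1 - e_hat2 x) = dot M M /\
  n%:R * q%:R * (1 - c ^+ 2) / (1 - e_hat2 x) = dot M M - dot theta M ^+ 2.
Proof.
move=> theta1 sx x0 M c.
have s1 : dot (spherical_mean x) (spherical_mean x) = 1.
  by rewrite dotZl dotZr mulrA -expr2 exprVn enorm_sqr mulVf// dot_eq0.
have k2 : (Num.sqrt (n%:R * q%:R) / Num.sqrt (1 - e_hat2 x)) ^+ 2 =
    n%:R * q%:R / (1 - e_hat2 x).
  by rewrite exprMn exprVn !sqr_sqrtr// ?subr_ge0 ?e_hat2_le1// mulr_ge0.
have MM : dot M M = n%:R * q%:R / (1 - e_hat2 x) * (2 - 2 * c).
  rewrite dotZl dotZr mulrA -expr2 k2 dotBl !dotBr s1 theta1 (dotC _ theta) -/c.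
  by congr (_ * _); ring.
have tM : dot theta M ^+ 2 = n%:R * q%:R / (1 - e_hat2 x) * (c - 1) ^+ 2.
  by rewrite dotZr exprMn k2 dotBr theta1.
by rewrite tM MM; split; ring.
Qed.

End studentized_statistics.

(** * Central limit theorem for the triangular array *)

Section central_limit.
Context {R : realType} (q : nat) (q0 : (0 < q)%N).
Local Notation p := q.+1.
Local Notation V := (borel 'cV[R]_p).
Variables (theta : 'cV[R]_p) (theta1 : dot theta theta = 1).
Variables (Q : 'M[R]_(p, q)).
Hypotheses (QTQ : Q^T *m Q = 1%:M) (QQT : Q *m Q^T = 1%:M - theta *m theta^T)
  (QTtheta : Q^T *m theta = 0).
Variables (f : R -> R) (Ff : class_F f).
Variables (kappa : nat -> R) (kappay : kappa n @[n --> \oo] --> +oo).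
Context (d : nat -> measure_display) (T : forall n, measurableType (d n))
  (P : forall n, probability (T n) R) (X : forall n, 'I_n -> T n -> V).
Local Arguments X : clear implicits.
Hypothesis rX : forall n i, rot_sym_variable theta f (kappa n) (P n) (X n i).
Hypothesis indX : forall n (B : 'I_n -> set V), (forall i, measurable (B i)) ->
  P n (\bigcap_(i : 'I_n) (X n i @^-1` B i)) = (\prod_(i < n) P n (X n i @^-1` B i))%E.

Let P1 n : P n setT = 1%E. Proof. exact: probability_setT. Qed.
Let mX n i : measurable_fun setT (X n i). Proof. by case: (rX i). Qed.

Local Notation var n := (rot_sym_var q f (kappa n)).
Let u n i w := dot theta (X n i w).
Let xi n i w : 'cV[R]_q := Q^T *m (X n i w : 'cV[R]_p).
Local Arguments u : clear implicits.
Local Arguments xi : clear implicits.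
(* The tangent parts xi have covariance (var n / q) I, so this scaling gives
   their sum covariance I. *)
Let scale n : R := Num.sqrt (q%:R / (n%:R * var n)).

Definition tangent_sum n w : 'cV[R]_q := scale n *: \sum_i xi n i w.
Local Arguments tangent_sum : clear implicits.

Lemma dot_tangent_sum n t w :
  dot t (tangent_sum n w) = \sum_i scale n * dot t (xi n i w).
Proof. by rewrite dotZr dotC dot_suml mulr_sumr; apply: eq_bigr => i _; rewrite dotC. Qed.

Let measurable_term n t : measurable_fun setT
  (fun x : V => scale n * dot t (Q^T *m (x : 'cV[R]_p))).
Proof.
apply: measurable_funM; first exact: measurable_cst.
by apply: measurable_dotl; apply: measurable_cV_mulmx; exact: measurable_id.
Qed.

Let E_sin_term n i t : \int[P n]_w sin (scale n * dot t (xi n i w)) = 0.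
Proof.
rewrite -[RHS](E_sin_xi theta1 QTQ QQT QTtheta Ff (rX i) (scale n *: t)).
by apply: E_eq => w; rewrite dotZl.
Qed.

Lemma E_sin_tangent_sum n t : \int[P n]_w sin (dot t (tangent_sum n w)) = 0.
Proof.
have [_ h] := E_cos_sum_indep (P1 n) (@mX n) (@indX n) (measurable_term n t)
  (fun i => E_sin_term i t).
by rewrite -[RHS]h; apply: E_eq => w; rewrite dot_tangent_sum.
Qed.

(** For large n each factor is within K/n^2 of e^(-lam/n), so the product is within K/n of the
    limit. The quartic remainder of the cosine is of order [scale]^4 [var]^2, where the variance
    cancels: K depends on t, q and C, not on kappa. *)
Lemma E_cos_tangent_sum t :
  \int[P n]_w cos (dot t (tangent_sum n w)) @[n --> \oo] --> expR (- dot t t / 2).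
Proof.
have [C C0 HC] := rot_sym_var_bounds q0 theta1 Ff.
pose lam : R := dot t t / 2.
have lam0 : 0 <= lam by rewrite divr_ge0// dot_ge0.
pose K : R := (q%:R * dot t t) ^+ 2 * C + lam ^+ 2.
have cvK : (fun n : nat => K * n.+1%:R^-1) @ \oo --> (0 : R).
  by rewrite -[X in _ --> X](mulr0 K); apply: cvgM; [exact: cvg_cst|exact: cvg_harmonic].
(* The shift by one keeps the sample size positive. *)
rewrite -(cvg_shiftS (fun n => \int[P n]_w cos (dot t (tangent_sum n w)))).
apply/cvgrPdist_le => e e0.
have {}cvK : \forall m \near \oo, K / m.+1%:R <= e.
  move/cvgrPdist_le: cvK => /(_ e e0); apply: filterS => m.
  by rewrite sub0r normrN; apply: le_trans; exact: ler_norm.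
have HC' : \forall n \near \oo, rot_sym_var_bounded theta f C (kappa n.+1).
  have [N _ NH] : \forall n \near \oo, rot_sym_var_bounded theta f C (kappa n) := kappay HC.
  by exists N => // n /= Nn; apply: NH; exact: leqW.
apply: filterS2 cvK HC' => m Km Hn; rewrite distrC /=.
apply: (le_trans _ Km).
pose n := m.+1; have n0 : 0 < n%:R :> R by rewrite ltr0n.
rewrite -/n in Hn *.
have [b0 _ _ _] := Hn _ _ _ _ (rX (ord0 : 'I_n)).
have [h _] := E_cos_sum_indep (P1 n) (@mX n) (@indX n) (measurable_term n t)
  (fun i => E_sin_term i t).
have -> : \int[P n]_w cos (dot t (tangent_sum n w)) =
    \prod_i \int[P n]_w cos (scale n * dot t (xi n i w)).
  by rewrite -h; apply: E_eq => w; rewrite dot_tangent_sum.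
have s2 : scale n ^+ 2 = q%:R / (n%:R * var n).
  by rewrite sqr_sqrtr// divr_ge0// mulr_ge0// ltW.
have bterm i : bmf (fun w => scale n * dot t (xi n i w)).
  by apply: bmfZ; exact: (bmf_xi QQT (rX i)).
have term i : `|\int[P n]_w cos (scale n * dot t (xi n i w)) - expR (- (lam / n%:R))| <=
    K / n%:R ^+ 2.
  have [_ v2 _ _] := Hn _ _ _ _ (rX i).
  have bc := bmf_cos (bterm i).1.
  have e1 : \int[P n]_w (1 - (scale n * dot t (xi n i w)) ^+ 2 / 2) = 1 - lam / n%:R.
    have bq : bmf (fun w => dot t (xi n i w) ^+ 2).
      by apply: bmfX; exact: (bmf_xi QQT (rX i)).
    rewrite (_ : \int[P n]_w _ = \int[P n]_w (1 - scale n ^+ 2 / 2 * dot t (xi n i w) ^+ 2)); last first.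
      by apply: E_eq => w; rewrite exprMn; ring.
    rewrite (EB (P1 n) (bmf_cst 1) (bmfZ _ bq)) (Ecst (P1 n)) (EZ (P1 n) _ bq).
    rewrite (E_sqr_dot_xi q0 theta1 QTQ QQT QTtheta Ff (rX i)).
    rewrite (E_rot_sym_var q0 theta1 Ff (rX i)) s2 /lam; congr (1 - _).
    by field; rewrite !gt_eqF ?ltr0n.
  have be : bmf (fun w => 1 - (scale n * dot t (xi n i w)) ^+ 2 / 2).
    apply: bmfB; first exact: bmf_cst.
    by apply: bmfM; [exact: bmfX|exact: bmf_cst].
  have bv : bmf (fun w => (1 - u n i w ^+ 2) ^+ 2).
    by apply: bmfX; apply: bmfB; [exact: bmf_cst|apply: bmfX; exact: (bmf_u theta1 (rX i))].
  have h1 : `|\int[P n]_w cos (scale n * dot t (xi n i w)) - (1 - lam / n%:R)| <=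
      (q%:R * dot t t) ^+ 2 * C / n%:R ^+ 2.
    rewrite -e1 -(EB (P1 n) bc be); apply: le_trans (E_norm (P1 n) (bmfB bc be)) _.
    apply: (@le_trans _ _ (\int[P n]_w (scale n ^+ 4 * dot t t ^+ 2 * (1 - u n i w ^+ 2) ^+ 2))).
      apply: (E_le (P1 n) (bmf_norm (bmfB bc be)) (bmfZ _ bv)) => w.
      apply: le_trans (cos_expansion _) _.
      rewrite exprMn -mulrA ler_wpM2l ?exprn_even_ge0//.
      rewrite (_ : dot t (xi n i w) ^+ 4 = (dot t (xi n i w) ^+ 2) ^+ 2); last by rewrite -exprM.
      rewrite -exprMn lerXn2r ?nnegrE ?sqr_ge0//.
        by rewrite -(dot_xi QQT (rX i)) mulr_ge0 ?dot_ge0.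
      by rewrite -(dot_xi QQT (rX i)) Cauchy_Schwarz.
    rewrite (EZ (P1 n) _ bv).
    apply: (@le_trans _ _ (scale n ^+ 4 * dot t t ^+ 2 * (C * var n ^+ 2))).
      by rewrite ler_wpM2l// mulr_ge0 ?exprn_even_ge0.
    rewrite (_ : scale n ^+ 4 = (scale n ^+ 2) ^+ 2); last by rewrite -exprM.
    rewrite s2 le_eqVlt; apply/orP; left; apply/eqP.
    by field; rewrite !gt_eqF.
  have h2 := @expRN_expansion R (lam / n%:R) (divr_ge0 lam0 (ltW n0)).
  rewrite (_ : _ - expR _ = (\int[P n]_w cos (scale n * dot t (xi n i w)) - (1 - lam / n%:R)) +
    (1 - lam / n%:R - expR (- (lam / n%:R)))); last by ring.
  rewrite (le_trans (ler_normD _ _))// /K mulrDl lerD//.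
  by rewrite -expr_div_n.
have -> : expR (- dot t t / 2) = expR (- (lam / n%:R)) ^+ n.
  rewrite -expRM_natl; congr expR; rewrite /lam; field.
  by rewrite gt_eqF.
have y1 : `|expR (- (lam / n%:R))| <= 1.
  by rewrite ger0_norm ?expR_ge0// -[leRHS]expR0 ler_expR oppr_le0 divr_ge0// ltW.
have x1 i : `|\int[P n]_w cos (scale n * dot t (xi n i w))| <= 1.
  apply: (E_bound (P1 n)); first exact: bmf_cos (bterm i).1.
  by move=> w; exact: cos_max.
apply: le_trans (prod_sub_expn x1 y1 term) _.
by rewrite le_eqVlt; apply/orP; left; apply/eqP; field; rewrite gt_eqF.
Qed.

Let measurable_tangent_sum n : measurable_fun setT (tangent_sum n : T n -> borel 'cV[R]_q).
Proof.
apply: measurable_cVZ; first exact: measurable_cst.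
by apply: measurable_cV_sum => i; exact: measurable_cV_mulmx.
Qed.

(** The limit is any vector with the characteristic function of Q Z. It is left abstract because it
    occurs in two forms: A Z, with A the unspecified square root in [mvnormal], and Q Z itself for
    the chi-square limits. *)
Context d' (T0 : measurableType d') (m0 : {sigma_finite_measure set T0 -> \bar R}) (Z0 : T0 -> V).
Hypotheses (m01 : m0 setT = 1%E) (mZ0 : measurable_fun setT Z0).
Hypotheses
  (cosZ0 : forall t, \int[m0]_z cos (dot t (Z0 z)) = expR (- dot (Q^T *m t) (Q^T *m t) / 2))
  (sinZ0 : forall t, \int[m0]_z sin (dot t (Z0 z)) = 0).

Lemma tangent_sum_lipschitz_cvg (h : V -> R) (L : R) : bmf h ->
  (forall x y : 'cV[R]_p, `|h x - h y| <= L * enorm (x - y)) ->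
  \int[P n]_w h (Q *m tangent_sum n w) @[n --> \oo] --> \int[m0]_z h (Z0 z).
Proof.
have mQY n : measurable_fun setT (fun w => Q *m tangent_sum n w : V).
  by apply: measurable_cV_mulmx; exact: measurable_tangent_sum.
apply: (levy_lipschitz m01 mQY mZ0) => t.
  rewrite cosZ0; under eq_fun do under eq_Rintegral do rewrite dot_mulmxr.
  exact: E_cos_tangent_sum.
rewrite sinZ0; under eq_fun do under eq_Rintegral do rewrite dot_mulmxr.
under eq_fun do rewrite E_sin_tangent_sum.
exact: cvg_cst.
Qed.

Let bmf_term n i t : bmf (fun w => dot t (xi n i w)).
Proof. exact: (bmf_xi QQT (rX i)). Qed.

Let bmf_cosine n i : bmf (u n i).
Proof. exact: (bmf_u theta1 (rX i)). Qed.

Let sX n i w : dot (X n i w) (X n i w) = 1.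
Proof. by case: (rX i). Qed.

(** The scale gives each coordinate variance exactly 1, and there are q of them. *)
Lemma E_sqr_tangent_sum n : (0 < n)%N -> 0 < var n ->
  \int[P n]_w dot (tangent_sum n w) (tangent_sum n w) = q%:R.
Proof.
move=> n0 b0; have N0 : 0 < n%:R :> R by rewrite ltr0n.
have q1 : 0 < q%:R :> R by rewrite ltr0n.
have s2 : scale n ^+ 2 = q%:R / (n%:R * var n).
  by rewrite sqr_sqrtr// divr_ge0// mulr_ge0// ltW.
have coord (j : 'I_q) : \int[P n]_w dot (delta_mx j 0) (tangent_sum n w) ^+ 2 = 1.
  transitivity (\int[P n]_w (\sum_i scale n * dot (delta_mx j 0) (xi n i w)) ^+ 2).
    by apply: E_eq => w; rewrite dot_tangent_sum.
  rewrite (E_sqr_sum_indep (P1 n) (@mX n) (@indX n) (measurable_term n (delta_mx j 0))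
    (M := scale n * enorm (delta_mx j 0 : 'cV[R]_q))).
  - rewrite (eq_bigr (fun=> n%:R^-1)); last first.
      move=> i _; rewrite -/(xi n i _).
      transitivity (scale n ^+ 2 * \int[P n]_w dot (delta_mx j 0) (xi n i w) ^+ 2).
        rewrite -(EZ (P1 n)); last by apply: bmfX; exact: bmf_term.
        by apply: E_eq => w; rewrite exprMn.
      rewrite (E_sqr_dot_xi q0 theta1 QTQ QQT QTtheta Ff (rX i)).
      rewrite (E_rot_sym_var q0 theta1 Ff (rX i)) s2 dot_delta mxE !eqxx/=.
      by field; rewrite !gt_eqF.
    by rewrite sumr_const card_ord -[LHS]mulr_natl divff// gt_eqF.
  - move=> i w; rewrite normrM (ger0_norm (sqrtr_ge0 _)) ler_wpM2l ?sqrtr_ge0//.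
    apply: le_trans (normr_dot _ _) _; rewrite ler_piMr ?enorm_ge0//.
    rewrite /enorm -[leRHS]sqrtr1 ler_wsqrtr// (dot_xi QQT (rX i)).
    by rewrite gerBl sqr_ge0.
  - move=> i; rewrite (EZ (P1 n)); last exact: bmf_term.
    by rewrite (E_dot_xi theta1 QTQ QQT QTtheta Ff (rX i)) mulr0.
transitivity (\int[P n]_w \sum_j dot (delta_mx j 0) (tangent_sum n w) ^+ 2).
  by apply: E_eq => w; rewrite -dot_sum_delta.
rewrite (E_sum (P1 n)); last first.
  move=> j; apply: bmfX.
  under [X in bmf X]funext do rewrite dot_tangent_sum.
  by apply: bmf_sum => i; apply: bmfZ; exact: bmf_term.
by under eq_bigr do rewrite coord; rewrite sumr_const card_ord.
Qed.

Let bmf_tangent_sum n t : bmf (fun w => dot t (tangent_sum n w)).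
Proof.
under [X in bmf X]funext do rewrite dot_tangent_sum.
by apply: bmf_sum => i; apply: bmfZ; exact: bmf_term.
Qed.

Let bmf_sqr_tangent_sum n : bmf (fun w => dot (tangent_sum n w) (tangent_sum n w)).
Proof.
under [X in bmf X]funext do rewrite dot_sum_delta.
by apply: bmf_sum => j; apply: bmfX; exact: bmf_tangent_sum.
Qed.

Let cross n w := mean_cross theta Q (fun i => X n i w).
Let sine2 n w := mean_sine2 theta (fun i => X n i w).
Let cosine n w := mean_cosine theta (fun i => X n i w).
Let tangent n w := mean_tangent Q (fun i => X n i w).
Local Arguments cross : clear implicits.
Local Arguments sine2 : clear implicits.
Local Arguments cosine : clear implicits.
Local Arguments tangent : clear implicits.

Let dot_cross n t w : dot t (cross n w) = n%:R^-1 * \sum_i u n i w * dot t (xi n i w).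
Proof.
rewrite dotZr dotC dot_suml; congr (_ * _); apply: eq_bigr => i _.
by rewrite dotZl (dotC _ t).
Qed.

Let bmf_dot_cross n t : bmf (fun w => dot t (cross n w)).
Proof.
under [X in bmf X]funext do rewrite dot_cross.
by apply: bmfZ; apply: bmf_sum => i; apply: bmfM; [exact: bmf_cosine|exact: bmf_term].
Qed.

Let bmf_sqr_cross n : bmf (fun w => dot (cross n w) (cross n w)).
Proof.
under [X in bmf X]funext do rewrite dot_sum_delta.
by apply: bmf_sum => j; apply: bmfX; exact: bmf_dot_cross.
Qed.

(** The vector [cross] collects the mixed terms in the expansion of 1 - [e_hat2]. They are centred
    because u xi is odd in xi, and |u| <= 1 bounds their second moments by those of xi. *)
Lemma E_sqr_cross n : (0 < n)%N -> \int[P n]_w dot (cross n w) (cross n w) <= var n / n%:R.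
Proof.
move=> n0; have N0 : 0 < n%:R :> R by rewrite ltr0n.
have q1 : 0 < q%:R :> R by rewrite ltr0n.
have mg t : measurable_fun setT
    (fun x : V => dot theta (x : 'cV[R]_p) * dot t (Q^T *m (x : 'cV[R]_p))).
  apply: measurable_funM; apply: measurable_dotl; first exact: measurable_id.
  by apply: measurable_cV_mulmx; exact: measurable_id.
have u1 i w : u n i w ^+ 2 <= 1.
  have := normr_u theta1 (rX i) w; rewrite -/(u n i w) => h.
  by rewrite -real_normK ?num_real// expr_le1.
have coord (j : 'I_q) : \int[P n]_w dot (delta_mx j 0) (cross n w) ^+ 2 <=
    n%:R^-1 * (var n / q%:R).
  rewrite (_ : \int[P n]_w _ = n%:R^-1 ^+ 2 *
      \int[P n]_w (\sum_i u n i w * dot (delta_mx j 0) (xi n i w)) ^+ 2); last first.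
    rewrite -(EZ (P1 n)); first by apply: E_eq => w; rewrite dot_cross exprMn.
    by apply: bmfX; apply: bmf_sum => i; apply: bmfM; [exact: bmf_cosine|exact: bmf_term].
  rewrite (E_sqr_sum_indep (P1 n) (@mX n) (@indX n) (mg (delta_mx j 0))
    (M := 1 * enorm (delta_mx j 0 : 'cV[R]_q))).
  - apply: (@le_trans _ _ (n%:R^-1 ^+ 2 * (\sum_(i < n) (var n / q%:R)))); last first.
      rewrite sumr_const card_ord -[X in _ * X]mulr_natl le_eqVlt.
      by apply/orP; left; apply/eqP; field; rewrite !gt_eqF.
    rewrite ler_wpM2l ?exprn_ge0 ?invr_ge0 ?(ltW N0)//.
    apply: ler_sum => i _.
    apply: (@le_trans _ _ (\int[P n]_w dot (delta_mx j 0) (xi n i w) ^+ 2)).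
      apply: (E_le (P1 n)).
      + by apply: bmfX; apply: bmfM; [exact: bmf_cosine|exact: bmf_term].
      + by apply: bmfX; exact: bmf_term.
      + by move=> w; rewrite exprMn ler_piMl ?sqr_ge0//; exact: u1.
    rewrite (E_sqr_dot_xi q0 theta1 QTQ QQT QTtheta Ff (rX i)).
    by rewrite (E_rot_sym_var q0 theta1 Ff (rX i)) dot_delta mxE !eqxx mul1r.
  - move=> i w; rewrite normrM ler_pM//; first exact: (normr_u theta1 (rX i) w).
    apply: le_trans (normr_dot _ _) _; rewrite ler_piMr ?enorm_ge0//.
    rewrite /enorm -[leRHS]sqrtr1 ler_wsqrtr// (dot_xi QQT (rX i)).
    by rewrite gerBl sqr_ge0.
  - by move=> i; exact: (E_u_dot_xi theta1 QTQ QQT QTtheta Ff (rX i)).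
rewrite (_ : \int[P n]_w _ = \int[P n]_w \sum_j dot (delta_mx j 0) (cross n w) ^+ 2); last first.
  by apply: E_eq => w; rewrite -dot_sum_delta.
rewrite (E_sum (P1 n)); last by move=> j; apply: bmfX; exact: bmf_dot_cross.
apply: (@le_trans _ _ (\sum_(j < q) n%:R^-1 * (var n / q%:R))).
  by apply: ler_sum => j _; exact: coord.
rewrite sumr_const card_ord -[X in X <= _]mulr_natl le_eqVlt; apply/orP; left; apply/eqP.
by field; rewrite !gt_eqF.
Qed.

Let bmf_sine2 n : bmf (fun w => (sine2 n w - var n) ^+ 2).
Proof.
apply: bmfX; apply: bmfB; last exact: bmf_cst.
apply: bmfZ; apply: bmf_sum => i; apply: bmfB; first exact: bmf_cst.
by apply: bmfX; exact: bmf_cosine.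
Qed.

(** Variance of an average of independent terms; centring only lowers the second moment, so c may be
    taken for the uncentred one. *)
Lemma E_sqr_sine2 n (c : R) : (0 < n)%N ->
  (forall i, \int[P n]_w (1 - u n i w ^+ 2) ^+ 2 <= c) ->
  \int[P n]_w (sine2 n w - var n) ^+ 2 <= c / n%:R.
Proof.
move=> n0 Hc; have N0 : 0 < n%:R :> R by rewrite ltr0n.
pose g (x : V) : R := 1 - dot theta (x : 'cV[R]_p) ^+ 2 - var n.
have mg : measurable_fun setT g.
  apply: measurable_funB => //; apply: measurable_funB => //; apply: measurable_funX.
  by apply: measurable_dotl; exact: measurable_id.
have b1 i : bmf (fun w => 1 - u n i w ^+ 2).
  by apply: bmfB; [exact: bmf_cst|apply: bmfX; exact: bmf_cosine].
have Eb i : \int[P n]_w (1 - u n i w ^+ 2) = var n.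
  exact: (E_rot_sym_var q0 theta1 Ff (rX i)).
have bc := @bmf_cst _ (T n) R (var n).
rewrite (_ : \int[P n]_w _ = n%:R^-1 ^+ 2 * \int[P n]_w (\sum_i g (X n i w)) ^+ 2); last first.
  rewrite -(EZ (P1 n)).
    apply: E_eq => w; rewrite -exprMn; congr (_ ^+ 2).
    rewrite /g sumrB mulrBr sumr_const card_ord -[X in _ - _ * X]mulr_natl.
    by rewrite mulKf ?gt_eqF.
  by apply: bmfX; apply: bmf_sum => i; exact: bmfB (b1 i) bc.
rewrite (E_sqr_sum_indep (P1 n) (@mX n) (@indX n) mg (M := 1 + `|var n|)).
- apply: (@le_trans _ _ (n%:R^-1 ^+ 2 * (\sum_(i < n) c))); last first.
    rewrite sumr_const card_ord -[X in _ * X]mulr_natl le_eqVlt.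
    by apply/orP; left; apply/eqP; field; rewrite !gt_eqF.
  rewrite ler_wpM2l ?exprn_ge0 ?invr_ge0 ?(ltW N0)//.
  apply: ler_sum => i _; apply: le_trans (Hc i).
  rewrite (_ : \int[P n]_w _ = \int[P n]_w ((1 - u n i w ^+ 2) ^+ 2) +
      (- 2 * var n) * \int[P n]_w (1 - u n i w ^+ 2) + var n ^+ 2); last first.
    rewrite -(EZ (P1 n) _ (b1 i)) -(Ecst (P1 n) (var n ^+ 2)).
    rewrite -(ED (P1 n) (bmfX 2 (b1 i)) (bmfZ _ (b1 i))).
    rewrite -(ED (P1 n) (bmfD (bmfX 2 (b1 i)) (bmfZ _ (b1 i))) (bmf_cst _)).
    by apply: E_eq => w; rewrite /g -/(u n i w); ring.
  by rewrite Eb; have := sqr_ge0 (var n); lra.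
- move=> i w; rewrite /g (le_trans (ler_normB _ _))// lerD//.
  have := dot_xi QQT (rX i) w; rewrite /= => <-.
  rewrite ger0_norm ?dot_ge0// (dot_xi QQT (rX i)).
  by rewrite gerBl sqr_ge0.
- by move=> i; rewrite (EB (P1 n) (b1 i) bc) Eb (Ecst (P1 n)) subrr.
Qed.

Let bmf_one_sub_cosine n : bmf (fun w => 1 - cosine n w).
Proof.
by apply: bmfB; [exact: bmf_cst|apply: bmfZ; apply: bmf_sum => i; exact: bmf_cosine].
Qed.

Lemma E_one_sub_cosine n (c : R) : (0 < n)%N ->
  (forall i, \int[P n]_w (1 - u n i w) <= c) -> \int[P n]_w (1 - cosine n w) <= c.
Proof.
move=> n0 Hc; have N0 : 0 < n%:R :> R by rewrite ltr0n.
have b1 i : bmf (fun w => 1 - u n i w) by apply: bmfB; [exact: bmf_cst|exact: bmf_cosine].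
rewrite (_ : \int[P n]_w _ = n%:R^-1 * \int[P n]_w (\sum_i (1 - u n i w))); last first.
  rewrite -(EZ (P1 n)); last exact: bmf_sum.
  apply: E_eq => w; rewrite sumrB sumr_const card_ord mulrBr.
  by rewrite mulVf ?gt_eqF.
rewrite (E_sum (P1 n))// ler_pdivrMl//.
apply: (@le_trans _ _ (\sum_(i < n) c)); first by apply: ler_sum.
by rewrite sumr_const card_ord -[X in X <= _]mulr_natl.
Qed.

Let stud n w : 'cV[R]_p := studentized theta (fun i => X n i w).
Local Arguments stud : clear implicits.

Let measurable_stud n : measurable_fun setT (stud n : T n -> V).
Proof. by apply: measurable_studentized => i; exact: mX. Qed.

Let cosine_le1 n w : 0 <= 1 - cosine n w.
Proof.
rewrite subr_ge0 /cosine /mean_cosine; case: n w => [|n] w.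
  by rewrite big_ord0 mulr0.
rewrite ler_pdivrMl// mulr1.
apply: (@le_trans _ _ (\sum_(i < n.+1) 1)); last by rewrite sumr_const card_ord.
apply: ler_sum => i _; apply: le_trans (ler_norm _) _.
exact: (normr_u theta1 (rX i)).
Qed.

(* The last four terms are Chebyshev weights of the four events on which the
   hypotheses of studentized_close fail; elsewhere the first term applies. *)
Let lipschitz_gap n (h : V -> R) (K L delta : R) : (0 < n)%N ->
  (forall x, `|h x| <= K) ->
  (forall x y : 'cV[R]_p, `|h x - h y| <= L * enorm (x - y)) ->
  0 < var n -> var n <= 1 -> 0 < delta -> delta <= 1 / 8 ->
  forall w, `|h (stud n w) - h (Q *m tangent_sum n w)| <=
    10 * `|L| * delta * (1 + dot (tangent_sum n w) (tangent_sum n w)) +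
    2 * K * ((delta ^+ 2 * n%:R * q%:R)^-1 * dot (tangent_sum n w) (tangent_sum n w) +
      (delta ^+ 2 * var n)^-1 * dot (cross n w) (cross n w) +
      (delta ^+ 2 * var n ^+ 2)^-1 * (sine2 n w - var n) ^+ 2 +
      delta^-1 * (1 - cosine n w)).
Proof.
move=> n0 hK hL b0 b1 d0 d8 w.
have N0 : 0 < n%:R :> R by rewrite ltr0n.
have q1 : 0 < q%:R :> R by rewrite ltr0n.
have K0 : 0 <= K := le_trans (normr_ge0 _) (hK 0).
set Y2 := dot (tangent_sum n w) _; set U2 := dot (cross n w) _.
set S2 := (_ - _) ^+ 2; set C1 := 1 - cosine n w.
have Y0 : 0 <= Y2 by exact: dot_ge0.
have U0 : 0 <= U2 by exact: dot_ge0.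
have S0 : 0 <= S2 by exact: sqr_ge0.
have c0 : 0 <= C1 by exact: cosine_le1.
have [k1 k2 k3 k4] : [/\ 0 < delta ^+ 2 * n%:R * q%:R, 0 < delta ^+ 2 * var n,
    0 < delta ^+ 2 * var n ^+ 2 & 0 < delta].
  by split; rewrite ?mulr_gt0 ?exprn_gt0.
have t1 : 0 <= (delta ^+ 2 * n%:R * q%:R)^-1 * Y2 by rewrite mulr_ge0 ?invr_ge0 ?(ltW k1).
have t2 : 0 <= (delta ^+ 2 * var n)^-1 * U2 by rewrite mulr_ge0 ?invr_ge0 ?(ltW k2).
have t3 : 0 <= (delta ^+ 2 * var n ^+ 2)^-1 * S2 by rewrite mulr_ge0 ?invr_ge0 ?(ltW k3).
have t4 : 0 <= delta^-1 * C1 by rewrite mulr_ge0 ?invr_ge0 ?(ltW k4).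
have t0 : 0 <= 10 * `|L| * delta * (1 + Y2).
  by rewrite !mulr_ge0 ?addr_ge0 ?(ltW d0).
have bad (t : R) : 1 <= t ->
    t <= (delta ^+ 2 * n%:R * q%:R)^-1 * Y2 + (delta ^+ 2 * var n)^-1 * U2 +
      (delta ^+ 2 * var n ^+ 2)^-1 * S2 + delta^-1 * C1 ->
    `|h (stud n w) - h (Q *m tangent_sum n w)| <= 10 * `|L| * delta * (1 + Y2) +
    2 * K * ((delta ^+ 2 * n%:R * q%:R)^-1 * Y2 + (delta ^+ 2 * var n)^-1 * U2 +
      (delta ^+ 2 * var n ^+ 2)^-1 * S2 + delta^-1 * C1).
  move=> t1' tle; apply: (@le_trans _ _ (2 * K)).
    by rewrite (le_trans (ler_normB _ _))// mulrDl mul1r lerD.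
  rewrite -[leLHS]add0r lerD// -[leLHS]mulr1 ler_wpM2l ?mulr_ge0//.
  exact: le_trans t1' tle.
have [H1|H1] := leP S2 (delta ^+ 2 * var n ^+ 2); last first.
  apply: (bad ((delta ^+ 2 * var n ^+ 2)^-1 * S2)); last by lra.
  by rewrite ler_pdivlMl// mulr1 ltW.
have [H3|H3] := leP U2 (delta ^+ 2 * var n); last first.
  apply: (bad ((delta ^+ 2 * var n)^-1 * U2)); last by lra.
  by rewrite ler_pdivlMl// mulr1 ltW.
have [H4|H4] := leP C1 delta; last first.
  by apply: (bad (delta^-1 * C1)); [rewrite ler_pdivlMl// mulr1 ltW|lra].
have [H2|H2] := leP Y2 (delta ^+ 2 * n%:R * q%:R); last first.
  apply: (bad ((delta ^+ 2 * n%:R * q%:R)^-1 * Y2)); last by lra.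
  by rewrite ler_pdivlMl// mulr1 ltW.
have H2' : dot (tangent n w) (tangent n w) <= delta ^+ 2 * var n.
  have s2 : scale n ^+ 2 = q%:R / (n%:R * var n).
    by rewrite sqr_sqrtr// divr_ge0// mulr_ge0// ltW.
  have -> : dot (tangent n w) (tangent n w) = Y2 * (var n / (n%:R * q%:R)).
    pose Z2 := dot (\sum_i xi n i w) (\sum_i xi n i w).
    have -> : Y2 = scale n ^+ 2 * Z2 by rewrite /Y2 /tangent_sum dotZl dotZr mulrA -expr2.
    have -> : dot (tangent n w) (tangent n w) = n%:R^-1 ^+ 2 * Z2.
      by rewrite /tangent /mean_tangent dotZl dotZr mulrA -expr2.
    by rewrite s2; field; rewrite !gt_eqF.
  rewrite (_ : delta ^+ 2 * var n = delta ^+ 2 * n%:R * q%:R * (var n / (n%:R * q%:R))).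
    by rewrite ler_wpM2r// divr_ge0 ?mulr_ge0 ?(ltW b0).
  by field; rewrite !gt_eqF.
have := studentized_close theta1 QTQ QQT QTtheta n0 (fun i => sX i w) b0 b1 d0 d8 H1 H2' H3 H4.
rewrite -/(stud n w) => close.
apply: (@le_trans _ _ (10 * `|L| * delta * (1 + Y2))); last first.
  by rewrite lerDl !mulr_ge0// !addr_ge0.
apply: le_trans (hL _ _) _.
apply: (@le_trans _ _ (`|L| * (10 * delta * enorm (tangent_sum n w)))).
  apply: (@le_trans _ _ (`|L| * enorm (stud n w - Q *m tangent_sum n w))).
    by rewrite ler_wpM2r ?enorm_ge0// ler_norm.
  by rewrite ler_wpM2l.
rewrite [leLHS](_ : _ = 10 * `|L| * delta * enorm (tangent_sum n w)); last by ring.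
rewrite ler_wpM2l ?mulr_ge0 ?(ltW d0)//.
(* The inequality e <= 1 + e^2 replaces the norm by its square, whose mean is known exactly. *)
have := enorm_sqr (tangent_sum n w); rewrite -/Y2 => <-.
have := enorm_ge0 (tangent_sum n w); set e := enorm _ => e0.
by have := sqr_ge0 (e - 1); nra.
Qed.

(** The tolerance [delta] is fixed first, so that the closeness term is at most e/4; then n and the
    rate are taken large, independently of each other, to bring the terms in 1/n and in 1/A below
    e/8 each. *)
Lemma studentized_lipschitz_cvg (h : V -> R) (L : R) : bmf h ->
  (forall x y : 'cV[R]_p, `|h x - h y| <= L * enorm (x - y)) ->
  \int[P n]_w h (stud n w) @[n --> \oo] --> \int[m0]_z h (Z0 z).
Proof.
move=> bh hL; have [mh [K hK]] := bh.
have K0 : 0 <= K := le_trans (normr_ge0 _) (hK 0).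
have q1 : 0 < q%:R :> R by rewrite ltr0n.
have hQ := tangent_sum_lipschitz_cvg bh hL.
have bM n : bmf (fun w => h (stud n w)) by exact: (bmf_comp bh (@measurable_stud n)).
have bQ n : bmf (fun w => h (Q *m tangent_sum n w)).
  by apply: (bmf_comp bh); apply: measurable_cV_mulmx; exact: measurable_tangent_sum.
apply/cvgrPdist_le => e e0.
have e2 : 0 < e / 2 by rewrite divr_gt0.
have e4 : 0 < e / 4 by rewrite divr_gt0.
have e8 : 0 < e / 8 by rewrite divr_gt0.
pose D := 10 * `|L| * (1 + q%:R) + 1.
have D0 : 0 < D by rewrite ltr_wpDl// !mulr_ge0// addr_ge0.
pose delta := Num.min (1 / 8) (e / 4 / D).
have d0 : 0 < delta by rewrite lt_min !divr_gt0.
have d8 : delta <= 1 / 8 by rewrite ge_min lexx.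
have dD : 10 * `|L| * delta * (1 + q%:R) <= e / 4.
  apply: (@le_trans _ _ (delta * D)).
    rewrite (_ : delta * D = 10 * `|L| * delta * (1 + q%:R) + delta); last by rewrite /D; ring.
    by rewrite lerDl ltW.
  by rewrite -ler_pdivlMr// ge_min lexx orbT.
have [C C0 HC] := rot_sym_var_bounds q0 theta1 Ff.
have {}HC : \forall n \near \oo, rot_sym_var_bounded theta f C (kappa n) := kappay HC.
(* The weights of the tangent, cross and sine terms contribute 1, 1 and C, whence 2 + C. *)
pose N1 := 2 * K * (2 + C) / delta ^+ 2 / (e / 8).
(* The summand C makes the variance at most 1, the second one controls the mean of 1 - [cosine], and
   1 keeps [A1] positive. *)
pose A1 := C + 2 * K * C ^+ 2 / delta / (e / 8) + 1.
have A10 : 0 <= 2 * K * C ^+ 2 / delta / (e / 8).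
  by rewrite !divr_ge0 ?mulr_ge0 ?exprn_ge0 ?(ltW C0) ?(ltW d0) ?(ltW e0).
have rate : \forall n \near \oo, A1 <= kappa n * phi f (kappa n).
  have /cvgryPge/(_ A1) := rate_cvg Ff; exact: kappay.
have big : \forall n \near \oo, N1 <= n%:R :> R.
  exists (Num.bound N1) => // n /= Nn; rewrite ltW// (lt_le_trans (archi_boundP _)) ?ler_nat//.
  by rewrite !divr_ge0 ?mulr_ge0 ?addr_ge0 ?exprn_ge0 ?(ltW C0) ?(ltW d0) ?(ltW e0).
have pos : \forall n \near \oo, (0 < n)%N by exists 1%N.
move/cvgrPdist_le: hQ => /(_ _ e2) hQ.
near=> n.
have n0 : (0 < n)%N by near: n; exact: pos.
have N0 : 0 < n%:R :> R by rewrite ltr0n.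
have bigN : N1 <= n%:R by near: n; exact: big.
have rateN : A1 <= kappa n * phi f (kappa n) by near: n; exact: rate.
have h1 : `|\int[m0]_z h (Z0 z) - \int[P n]_w h (Q *m tangent_sum n w)| <= e / 2.
  by near: n; exact: hQ.
have Hn : rot_sym_var_bounded theta f C (kappa n) by near: n; exact: HC.
have [b0 _ _ bA] := Hn _ _ _ _ (rX (Ordinal n0)).
set A := kappa n * _ in rateN bA.
have A1p : 0 < A1 by rewrite /A1 ltr_wpDl// addr_ge0// ltW.
have Ap : 0 < A by exact: lt_le_trans A1p rateN.
have b1 : var n <= 1.
  apply: (le_trans bA); rewrite ler_pdivrMr// mul1r (le_trans _ rateN)// /A1.
  by rewrite -addrA lerDl addr_ge0.
have bY := bmf_sqr_tangent_sum n; have bU := bmf_sqr_cross n.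
have bS := bmf_sine2 n; have bC := bmf_one_sub_cosine n.
have EY := E_sqr_tangent_sum n0 b0.
have EU := E_sqr_cross n0.
have ES := E_sqr_sine2 n0 (fun i => let: And4 _ h2 _ _ := Hn _ _ _ _ (rX i) in h2).
have EC := E_one_sub_cosine n0 (fun i => let: And4 _ _ h3 _ := Hn _ _ _ _ (rX i) in h3).
have gap := lipschitz_gap n0 hK hL b0 b1 d0 d8.
have k1 : 0 <= (delta ^+ 2 * n%:R * q%:R)^-1.
  by rewrite invr_ge0 ltW// (mulr_gt0 (mulr_gt0 (exprn_gt0 2 d0) N0) q1).
have k2 : 0 <= (delta ^+ 2 * var n)^-1 by rewrite invr_ge0 mulr_ge0 ?sqr_ge0 ?(ltW b0).
have k3 : 0 <= (delta ^+ 2 * var n ^+ 2)^-1 by rewrite invr_ge0 mulr_ge0 ?sqr_ge0.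
have k4 : 0 <= delta^-1 by rewrite invr_ge0 ltW.
have h2 : `|\int[P n]_w h (Q *m tangent_sum n w) - \int[P n]_w h (stud n w)| <= e / 2.
  rewrite distrC -(EB (P1 n) (bM n) (bQ n)).
  apply: le_trans (E_norm (P1 n) (bmfB (bM n) (bQ n))) _.
  have bs := bmfD (bmfD (bmfD (bmfZ (delta ^+ 2 * n%:R * q%:R)^-1 bY)
    (bmfZ (delta ^+ 2 * var n)^-1 bU)) (bmfZ (delta ^+ 2 * var n ^+ 2)^-1 bS))
    (bmfZ delta^-1 bC).
  have bl := bmfZ (10 * `|L| * delta) (bmfD (bmf_cst 1) bY).
  apply: le_trans (E_le (P1 n) (bmf_norm (bmfB (bM n) (bQ n))) (bmfD bl (bmfZ (2 * K) bs)) gap) _.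
  rewrite (ED (P1 n) bl (bmfZ (2 * K) bs)) (EZ (P1 n) _ bs).
  rewrite (EZ (P1 n) _ (bmfD (bmf_cst 1) bY)) (ED (P1 n) (bmf_cst 1) bY) (Ecst (P1 n)) EY.
  rewrite (ED (P1 n) (bmfD (bmfD (bmfZ (delta ^+ 2 * n%:R * q%:R)^-1 bY)
    (bmfZ (delta ^+ 2 * var n)^-1 bU)) (bmfZ (delta ^+ 2 * var n ^+ 2)^-1 bS))
    (bmfZ delta^-1 bC)).
  rewrite (ED (P1 n) (bmfD (bmfZ (delta ^+ 2 * n%:R * q%:R)^-1 bY)
    (bmfZ (delta ^+ 2 * var n)^-1 bU)) (bmfZ (delta ^+ 2 * var n ^+ 2)^-1 bS)).
  rewrite (ED (P1 n) (bmfZ (delta ^+ 2 * n%:R * q%:R)^-1 bY)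
    (bmfZ (delta ^+ 2 * var n)^-1 bU)).
  rewrite (EZ (P1 n) _ bY) (EZ (P1 n) _ bU) (EZ (P1 n) _ bS) (EZ (P1 n) _ bC) EY.
  have l2 := ler_wpM2l k2 EU; have l3 := ler_wpM2l k3 ES; have l4 := ler_wpM2l k4 EC.
  apply: (@le_trans _ _ (e / 4 + 2 * K * ((delta ^+ 2 * n%:R * q%:R)^-1 * q%:R +
      (delta ^+ 2 * var n)^-1 * (var n / n%:R) +
      (delta ^+ 2 * var n ^+ 2)^-1 * (C * var n ^+ 2 / n%:R) + delta^-1 * (C * (C / A))))).
    rewrite lerD// ler_wpM2l ?mulr_ge0// lerD//; first by rewrite !lerD.
    apply: (le_trans l4); rewrite ler_wpM2l// ler_wpM2l// ltW//.
  have -> : e / 4 + 2 * K * ((delta ^+ 2 * n%:R * q%:R)^-1 * q%:R +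
      (delta ^+ 2 * var n)^-1 * (var n / n%:R) +
      (delta ^+ 2 * var n ^+ 2)^-1 * (C * var n ^+ 2 / n%:R) + delta^-1 * (C * (C / A))) =
    e / 4 + (2 * K * (2 + C) / delta ^+ 2 / n%:R + 2 * K * C ^+ 2 / delta / A).
    by field; rewrite !gt_eqF.
  have m1 : 2 * K * (2 + C) / delta ^+ 2 / n%:R <= e / 8.
    by rewrite ler_pdivrMr// [leRHS]mulrC -ler_pdivrMr.
  have m2 : 2 * K * C ^+ 2 / delta / A <= e / 8.
    rewrite ler_pdivrMr// [leRHS]mulrC -ler_pdivrMr//; apply: le_trans rateN.
    by rewrite /A1 [X in X + 1]addrC -addrA lerDl addr_ge0// ltW.
  by lra.
rewrite -(subrKA (\int[P n]_w h (Q *m tangent_sum n w))).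
by apply: le_trans (ler_normD _ _) _; lra.
Unshelve. all: by end_near. Qed.

(** Controls the probability that the sample mean vanishes, an event on which the chi-square
    statistics need not be functions of the studentized vector. *)
Lemma mean_cosine_cvg :
  \int[P n]_w (1 - mean_cosine theta (fun i => X n i w)) @[n --> \oo] --> (0 : R).
Proof.
have [C C0 HC] := rot_sym_var_bounds q0 theta1 Ff.
have {}HC : \forall n \near \oo, rot_sym_var_bounded theta f C (kappa n) := kappay HC.
apply/cvgrPdist_le => e e0.
have rate : \forall n \near \oo, C ^+ 2 / e <= kappa n * phi f (kappa n).
  have /cvgryPge/(_ (C ^+ 2 / e)) := rate_cvg Ff; exact: kappay.
have pos : \forall n \near \oo, (0 < n)%N by exists 1%N.
apply: filterS3 HC rate pos => n Hn rateN n0.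
rewrite sub0r normrN ger0_norm; last by apply: E_ge0 => w; exact: cosine_le1.
have [_ _ _ bA] := Hn _ _ _ _ (rX (Ordinal n0)).
set A := kappa n * _ in rateN bA.
have Ap : 0 < A by apply: lt_le_trans rateN; rewrite divr_gt0// exprn_gt0.
apply: (le_trans (E_one_sub_cosine n0
  (fun i => let: And4 _ _ h3 _ := Hn _ _ _ _ (rX i) in h3))).
apply: (@le_trans _ _ (C * (C / A))); first by rewrite ler_wpM2l// ltW.
by rewrite mulrA -expr2 ler_pdivrMr// mulrC -ler_pdivrMr.
Qed.

Lemma studentized_cvg (g : V -> R) (K : R) : continuous (g : 'cV[R]_p -> R) ->
  (forall x, `|g x| <= K) ->
  \int[P n]_w g (stud n w) @[n --> \oo] --> \int[m0]_z g (Z0 z).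
Proof.
apply: (continuous_bounded_cvg m01 measurable_stud mZ0).
exact: studentized_lipschitz_cvg.
Qed.

(* When the sample mean vanishes so does the mean cosine, hence the indicator of
   that event is at most 1 - cosine, whose expectation tends to 0. *)
Lemma statistic_cvg (S : forall n, T n -> R) (F : 'cV[R]_p -> R) :
  continuous F -> (forall n, measurable_fun setT (@S n)) ->
  (forall n w, sample_mean (fun i => X n i w : 'cV[R]_p) != 0 -> S n w = F (stud n w)) ->
  forall (g : R -> R) (K : R), continuous g -> (forall x, `|g x| <= K) ->
  \int[P n]_w g (S n w) @[n --> \oo] --> \int[m0]_z g (F (Z0 z)).
Proof.
move=> cF mS SF g K cg gK.
have K0 : 0 <= K := le_trans (normr_ge0 _) (gK 0).
have cgF : continuous (g \o F) by move=> x; apply: continuous_comp; [exact: cF|exact: cg].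
have := studentized_cvg cgF (fun x => gK (F x)).
have bS n : bmf (fun w => g (S n w)).
  split; last by exists K.
  by apply: measurableT_comp => //; exact: continuous_measurable_fun.
have bF n : bmf (fun w => g (F (stud n w))).
  split; last by exists K.
  by apply: (measurableT_comp (continuous_borel_measurableR cgF)); exact: measurable_stud.
move=> /cvgrPdist_le h; apply/cvgrPdist_le => e e0.
have e2 : 0 < e / 2 by rewrite divr_gt0.
have K1 : 0 < 4 * K + 1 by rewrite ltr_wpDl// mulr_ge0.
have /cvgrPdist_le/(_ (e / (4 * K + 1)) (divr_gt0 e0 K1)) := mean_cosine_cvg.
apply: filterS2 (h _ e2) => n hn; rewrite sub0r normrN => cn.
have d1 : `|\int[P n]_w g (F (stud n w)) - \int[P n]_w g (S n w)| <=
    2 * K * \int[P n]_w (1 - cosine n w).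
  rewrite -(EB (P1 n) (bF n) (bS n)).
  have bC := bmf_one_sub_cosine n.
  apply: le_trans (E_norm (P1 n) (bmfB (bF n) (bS n))) _.
  rewrite -(EZ (P1 n) _ bC).
  apply: (E_le (P1 n) (bmf_norm (bmfB (bF n) (bS n))) (bmfZ _ bC)) => w.
  have [m|m] := eqVneq (sample_mean (fun i => X n i w : 'cV[R]_p)) 0.
    rewrite /cosine -mean_cosineE m dot0r subr0 mulr1.
    by rewrite (le_trans (ler_normB _ _))// mulrDl mul1r lerD.
  by rewrite SF// subrr normr0 !mulr_ge0// cosine_le1.
rewrite -(subrKA (\int[P n]_w g (F (stud n w)))) (le_trans (ler_normD _ _))//.
rewrite (splitr e) lerD//; apply: (le_trans d1).
have c0 := le_trans (ler_norm _) cn.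
apply: (@le_trans _ _ (2 * K * (e / (4 * K + 1)))).
  by rewrite ler_wpM2l// mulr_ge0.
rewrite mulrA ler_pdivrMr//; nra.
Qed.

End central_limit.

(** * Passage to the limit laws of the statement *)

Section convergence_in_law.
Context {R : realType}.

(** The law [nu] is a bare set function, known on measurable sets only; its integrals are identified
    here with those of a random variable on a measure space. *)
Lemma integral_law (E : ptopologicalType) d (S : measurableType d)
  (m : {measure set S -> \bar R}) (Z : S -> borel E) (nu : set (borel E) -> \bar R) :
  m setT = 1%E -> measurable_fun setT Z ->
  (forall B, measurable B -> nu B = m (Z @^-1` B)) ->
  forall (g : E -> R) (K : R), continuous g -> (forall x, `|g x| <= K) ->
  (\int[nu]_x (g x)%:E = (\int[m]_s g (Z s))%:E)%E.
Proof.
move=> m1 mZ nuE g K cg gK.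
have mg : measurable_fun setT (g : borel E -> R) by exact: continuous_borel_measurableR.
have bg : bmf (fun s => g (Z s)) by split; [exact: measurableT_comp|exists K].
rewrite (@eq_integral_set_function _ (borel E) R nu (pushforward_measure m mZ))//.
rewrite -(EFin_E m1 bg).
have mg' : measurable_fun setT (EFin \o (g : borel E -> R)) by exact/measurable_EFinP.
by rewrite (integral_pushforward mZ mg')// preimage_setT; exact: (bmf_integrable m1 bg).
Qed.

Lemma cvg_in_lawP (E : ptopologicalType) (d : nat -> measure_display)
  (T : forall n, measurableType (d n)) (P : forall n, probability (T n) R)
  (Y : forall n, T n -> E) d' (S : measurableType d') (m : {measure set S -> \bar R})
  (Z : S -> borel E) (nu : set (borel E) -> \bar R) :
  (forall n, measurable_fun setT (@Y n : T n -> borel E)) ->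
  m setT = 1%E -> measurable_fun setT Z ->
  (forall B, measurable B -> nu B = m (Z @^-1` B)) ->
  (forall (g : E -> R) (K : R), continuous g -> (forall x, `|g x| <= K) ->
    \int[P n]_w g (Y n w) @[n --> \oo] --> \int[m]_s g (Z s)) ->
  cvg_in_law P Y nu.
Proof.
move=> mY m1 mZ nuE h g cg /pinfty_ex_gt0[K _ gK].
have {}gK x : `|g x| <= K by exact: gK.
rewrite (integral_law m1 mZ nuE cg gK).
have bg n : bmf (fun w => g (Y n w)).
  split; last by exists K.
  exact: (measurableT_comp (continuous_borel_measurableR cg) (@mY n)).
under eq_fun do rewrite (EFin_E (probability_setT (P _)) (bg _)).
by apply: cvg_EFin; [exact: nearW|exact: h cg gK].
Qed.

Lemma measurable_sqr_dot p :
  measurable_fun setT (fun z : borel 'cV[R]_p => dot (z : 'cV[R]_p) z).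
Proof. by apply: measurable_dot; exact: measurable_id. Qed.

Lemma chi2E k (B : set (borel R)) : measurable B ->
  chi2 k B = stdn k ((fun z : borel 'cV[R]_k => dot (z : 'cV[R]_k) z) @^-1` B).
Proof.
move=> mB; rewrite /chi2 std_normalE// -[X in measurable X]setTI.
by apply: (measurable_borelR (fun z : borel 'cV[R]_k => dot (z : 'cV[R]_k) z)).2 => //;
  exact: measurable_sqr_dot.
Qed.

Lemma mvnormalE p (Sigma A : 'M[R]_p) (B : set (borel 'cV[R]_p)) :
  A = xget 0 [set A : 'M[R]_p | A *m A^T = Sigma] -> measurable B ->
  mvnormal 0 Sigma B = stdn p ((fun z : borel 'cV[R]_p => A *m (z : 'cV[R]_p) : borel _) @^-1` B).
Proof.
move=> AE mB; rewrite /mvnormal -AE.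
rewrite (_ : [set z | _] = (fun z : borel 'cV[R]_p => A *m (z : 'cV[R]_p) : borel _) @^-1` B).
  rewrite std_normalE// -[X in measurable X]setTI.
  by apply: measurable_cV_mulmx => //; exact: measurable_id.
by apply/seteqP; split => z /=; rewrite add0r.
Qed.

Lemma stdn_mulmx p q (A : 'M[R]_(p, q)) (t : 'cV[R]_p) :
  \int[stdn q]_z cos (dot t (A *m (z : 'cV[R]_q))) = expR (- dot (A^T *m t) (A^T *m t) / 2) /\
  \int[stdn q]_z sin (dot t (A *m (z : 'cV[R]_q))) = 0.
Proof.
have [h1 h2] := stdn_cos_sin (A^T *m t).
by split; [rewrite -h1|rewrite -h2]; apply: eq_Rintegral => z _; rewrite dot_mulmxr.
Qed.

Lemma continuous_enorm p : continuous (@enorm R p).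
Proof.
apply: (@lipschitz_continuous _ _ _ 1) => x y; rewrite mul1r.
have h (a b : 'cV[R]_p) : enorm a - enorm b <= enorm (a - b).
  by rewrite lerBlDr -[X in enorm X <= _](subrK b) enormD.
by rewrite ler_norml h andbT lerNl opprB -[leRHS]enormN opprB h.
Qed.

Lemma continuous_sqr_dot p : continuous (fun x : 'cV[R]_p => dot x x).
Proof.
under [X in continuous X]funext do rewrite -enorm_sqr expr2.
by move=> x; apply: (@cvgM _ _ (nbhs x)); exact: continuous_enorm.
Qed.

Lemma continuous_dot p (t : 'cV[R]_p) : continuous (dot t).
Proof.
apply: (@lipschitz_continuous _ _ _ (enorm t)) => x y.
by rewrite -dotBr normr_dot.
Qed.

End convergence_in_law.

Theorem theorem3p3 (R : realType) (p : nat) (theta : 'cV[R]_p) (f : R -> R)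
    (kappa : nat -> R) (d : nat -> measure_display)
    (T : forall n, measurableType (d n)) (P : forall n, probability (T n) R)
    (X : forall n, 'I_n -> T n -> 'cV[R]_p) :
  (2 <= p)%N ->
  theta \in @sphere R p ->
  class_F f ->
  (forall n, 0 < kappa n) ->
  kappa n @[n --> \oo] --> +oo ->
  (forall n, rot_sym_sample theta (kappa n) f (P n) (X n)) ->
  let hat_theta n w := spherical_mean (fun i => X n i w) in
  let hat_e2 n w := e_hat2 (fun i => X n i w) in
  [/\ cvg_in_law P
        (fun n w => (Num.sqrt (n%:R * (p%:R - 1)) / Num.sqrt (1 - hat_e2 n w))
                    *: (hat_theta n w - theta))
        (mvnormal 0 (1%:M - theta *m theta^T)),
      cvg_in_law P
        (fun n w => n%:R * (p%:R - 1) * (1 - dot theta (hat_theta n w) ^+ 2)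
                    / (1 - hat_e2 n w))
        (@chi2 R (p - 1))
    & cvg_in_law P
        (fun n w => 2 * n%:R * (p%:R - 1) * (1 - dot theta (hat_theta n w))
                    / (1 - hat_e2 n w))
        (@chi2 R (p - 1))].
Proof.
(* With p = q + 1, the number q is at once the dimension of the tangent space and the number of
   degrees of freedom; p >= 2 gives q > 0. *)
case: p theta X => [//|q] theta X; rewrite ltnS => q0 th Ff _ kappay sX /=.
have pq : q.+1%:R - 1 = q%:R :> R by rewrite -natr1 addrK.
rewrite pq subn1 /=.
have dot1 (x : 'cV[R]_q.+1) : x \in @sphere R q.+1 -> dot x x = 1.
  by rewrite inE /sphere/= -enorm_sqr => ->; rewrite expr1n.
have theta1 := dot1 _ th.
have [Q [QTQ QQT QTtheta]] := orthonormal_complement theta1.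
have mX n i : measurable_fun setT (X n i : T n -> borel 'cV[R]_q.+1) by have [] := sX n.
have indX n (B : 'I_n -> set (borel 'cV[R]_q.+1)) : (forall i, measurable (B i)) ->
    P n (\bigcap_(i : 'I_n) (X n i @^-1` B i)) = (\prod_(i < n) P n (X n i @^-1` B i))%E.
  by have [_ _ + _] := sX n; apply.
have rX n i : rot_sym_variable theta f (kappa n) (P n) (X n i).
  have [_ S _ law] := sX n; split; [exact: probability_setT|exact: mX| |exact: law].
  by move=> w; exact: dot1 (S i w).
have x1 n w i : dot (X n i w) (X n i w) = 1 by have [] := rX n i.
have mE n : measurable_fun setT (fun w => (1 - e_hat2 (fun i => X n i w))^-1).
  by apply: measurable_fun_inv; exact: measurable_one_sub_e_hat2.
have mC n : measurable_fun setT (fun w => dot theta (spherical_mean (fun i => X n i w))).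
  by apply: measurable_dotl; exact: measurable_spherical_mean.
have QZ m (A : 'M[R]_(q.+1, m)) : measurable_fun setT
    (fun z : borel 'cV[R]_m => A *m (z : 'cV[R]_m) : borel 'cV[R]_q.+1).
  by apply: measurable_cV_mulmx; exact: measurable_id.
(* Both chi-square limits in one form: [F] of the studentized vector, where [F] becomes the squared
   norm on vectors Q z. *)
have chi_cvg (S : forall n, T n -> R) (F : 'cV[R]_q.+1 -> R) :
    continuous F -> (forall n, measurable_fun setT (@S n)) ->
    (forall z, F (Q *m z) = dot z z) ->
    (forall n w, sample_mean (fun i => X n i w) != 0 ->
      S n w = F (studentized theta (fun i => X n i w))) ->
    cvg_in_law P S (@chi2 R q).
  move=> cF mS FQ SF.
  apply: (@cvg_in_lawP _ _ _ _ _ _ _ _ (stdn q) (fun z => dot (z : 'cV[R]_q) z)).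
  - by move=> n; apply/measurable_borelR; exact: mS.
  - exact: stdn_setT.
  - by apply/measurable_borelR; exact: measurable_sqr_dot.
  - exact: chi2E.
  - move=> g K cg gK; under eq_Rintegral do rewrite -FQ.
    apply: (statistic_cvg q0 theta1 QTQ QQT QTtheta Ff kappay rX indX (stdn_setT q)
      (@QZ _ Q) _ _ cF mS SF cg gK) => t.
      exact: (stdn_mulmx Q t).1.
    exact: (stdn_mulmx Q t).2.
split.
(* The covariance has a square root, namely the projection Q Q', so the choice made by [xget] is
   one; it need not be Q Q', but the characteristic function depends on A A' alone. *)
- pose A := xget 0 [set A : 'M[R]_q.+1 | A *m A^T = 1%:M - theta *m theta^T].
  have AAT : A *m A^T = 1%:M - theta *m theta^T.
    apply: (@xgetPex _ 0 [set A : 'M[R]_q.+1 | A *m A^T = 1%:M - theta *m theta^T]).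
    exists (Q *m Q^T) => /=.
    by rewrite trmx_mul trmxK mulmxA -(mulmxA Q) QTQ mulmx1.
  apply: (@cvg_in_lawP _ _ _ _ _ _ _ _ (stdn q.+1) (fun z => A *m (z : 'cV[R]_q.+1))).
  + by move=> n; exact: measurable_studentized.
  + exact: stdn_setT.
  + exact: QZ.
  + by move=> B; exact: mvnormalE.
  + move=> g K cg gK.
    apply: (studentized_cvg q0 theta1 QTQ QQT QTtheta Ff kappay rX indX (stdn_setT _)
      (@QZ _ A) _ _ cg gK) => t; last exact: (stdn_mulmx A t).2.
    rewrite (stdn_mulmx A t).1; congr (expR (- _ / 2)).
    by rewrite !dot_mulmxl !trmxK !mulmxA AAT QQT.
(* Vectors Q z are orthogonal to theta, so the subtracted square vanishes in the limit. *)
- apply: (chi_cvg _ (fun M => dot M M - dot theta M ^+ 2)).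
  + move=> x; apply: (@cvgB _ _ _ (nbhs x)); first exact: continuous_sqr_dot.
    by apply: (@cvgM _ _ (nbhs x)); exact: continuous_dot.
  + move=> n; apply: measurable_funM => //; apply: measurable_funM => //.
    by apply: measurable_funB => //; exact: measurable_funX.
  + by move=> z; rewrite dot_mulmxl mulmxA QTQ mul1mx dot_mulmxr QTtheta dot0l expr0n subr0.
  + by move=> n w /(sqr_studentized theta1 (x1 n w))[].
- apply: (chi_cvg _ (fun M => dot M M)).
  + exact: continuous_sqr_dot.
  + by move=> n; apply: measurable_funM => //; apply: measurable_funM => //; exact: measurable_funB.
  + by move=> z; rewrite dot_mulmxl mulmxA QTQ mul1mx.
  + by move=> n w /(sqr_studentized theta1 (x1 n w))[].
Qed.
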